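(* Let $\Gamma$ be a finite simple graph, with complement $\overline{\Gamma}$. Then the following are equivalent: (1) $\Gamma$ is isomorphic to the prime graph of some pseudo $\mathrm{PSL}(2,8)$-solvable group $G$. (2) $\overline{\Gamma}$ is $3$-colorable and has at most one triangle, which must be isolated if it exists.
   Context: All groups are finite and all graphs are simple. For a finite group $G$, the prime graph $\Gamma(G)$ has as vertices the prime divisors of $|G|$; two distinct vertices $p,q$ are adjacent if and only if $G$ contains an element of order $pq$. A group $G$ is pseudo $\mathrm{PSL}(2,8)$-solvable if each of its composition factors is abelian or isomorphic to $\mathrm{PSL}(2,8)$ (in particular solvable groups are allowed). A triangle in a graph is isolated if none of its three vertices is adjacent to a vertex outside the triangle. *)

(* Defs.v *)
From HB Require Import structures.
From mathcomp Require Import all_boot all_order all_algebra.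
From mathcomp Require Import all_fingroup all_solvable all_field.
Set Implicit Arguments.
Unset Strict Implicit.
Unset Printing Implicit Defensive.

Import GRing.Theory.
Local Open Scope group_scope.

Record sgraph := SGraph {
  vertex :> finType;
  adj : rel vertex;
  adj_sym : symmetric adj;
  adj_irr : irreflexive adj
}.

Section GraphNotions.
Implicit Types X Y : sgraph.

Definition compl_adj X : rel X := [rel x y | (x != y) && ~~ adj x y].

Lemma compl_adj_sym X : symmetric (@compl_adj X).
Proof. by move=> x y; rewrite /compl_adj /= eq_sym adj_sym. Qed.

Lemma compl_adj_irr X : irreflexive (@compl_adj X).
Proof. by move=> x; rewrite /compl_adj /= eqxx. Qed.

Definition complement X : sgraph :=
  SGraph (@compl_adj_sym X) (@compl_adj_irr X).

Definition graph_iso X Y : Prop :=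
  exists2 f : X -> Y, bijective f & {mono f : x y / adj x y}.

Definition colorable (k : nat) X : Prop :=
  exists c : X -> 'I_k, forall x y : X, adj x y -> c x != c y.

Definition triangle X (A : {set X}) : bool :=
  (#|A| == 3) && [forall x in A, forall y in A, (x != y) ==> adj x y].

Definition isolated X (A : {set X}) : Prop :=
  forall x y : X, x \in A -> y \notin A -> ~~ adj x y.

End GraphNotions.

Section PrimeGraph.
Variables (gT : finGroupType) (G : {group gT}).

Definition prime_adj : rel (seq_sub (primes #|G|)) :=
  [rel p q | (p != q) && [exists x in G, #[x] == (val p * val q)%N]].

Lemma prime_adj_sym : symmetric prime_adj.
Proof. by move=> p q; rewrite /prime_adj /= eq_sym mulnC. Qed.

Lemma prime_adj_irr : irreflexive prime_adj.
Proof. by move=> p; rewrite /prime_adj /= eqxx. Qed.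

Definition prime_graph : sgraph := SGraph prime_adj_sym prime_adj_irr.

End PrimeGraph.

Section SpecialLinear.
Variables (n : nat) (F : finFieldType).

Definition SL : {set {'GL_n[F]}} := [set u | (\det (GLval u) == 1)%R].

Lemma SL_group_set : group_set SL.
Proof.
apply/group_setP; split=> [|u v]; rewrite !inE ?GL_1E ?det1 // GL_ME.
by move=> /eqP du /eqP dv; rewrite det_mulmx du dv mulr1.
Qed.

Canonical SL_group : {group {'GL_n[F]}} := Group SL_group_set.

(* The center of SL consists of the scalar matrices of determinant 1. *)
Definition PSL : {group coset_of 'Z(SL)} := (SL / 'Z(SL))%G.

End SpecialLinear.

Definition F8 : finFieldType :=
  s2val (@pPrimePowerField 2 3 isT isT).

Lemma card_F8 : #|F8| = 8.
Proof. exact: (s2valP' (@pPrimePowerField 2 3 isT isT)). Qed.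

Section CompositionFactors.
Variables (gT : finGroupType) (G : {group gT}).

Definition composition_factor (S : section gT) : Prop :=
  exists2 s : seq {group gT}, comps G s & S \in pairmap (@mkSec gT) G s.

Definition pseudo_PSL28_solvable : Prop :=
  forall S : section gT, composition_factor S ->
    abelian S \/ S \isog PSL 2 F8.

End CompositionFactors.

(* Main.v *)
From HB Require Import structures.
Require Import Defs.
From mathcomp Require Import all_boot all_order all_algebra.
From mathcomp Require Import all_fingroup all_solvable all_field.

(** In a solvable group, orient a non-edge {p, q} of the prime graph from p to q when the Hall
    {p, q}-subgroups have a nontrivial normal q-subgroup.  No three primes are pairwise
    non-adjacent (Lucido), and there is no directed walk of length 3, so the lengths of walks give
    a 3-colouring of the complement.  In a nonsolvable pseudo PSL(2,8)-solvable group, a prime p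
    other than 2, 3, 7 is adjacent to 2 and 7, and also to 3 when 2, 3, 7 are pairwise
    non-adjacent.  Otherwise a group K with a quotient K / M isomorphic to PSL(2,8) acts on an
    abelian p-group V <> 1 so that the elements of order r = 2, 7 or 3 have no fixed point in V.
    For r = 2 the Sylow 2-subgroups of K would have rank 1 and could not map onto an elementary
    group of order 8; for r = 7 an element of order 7 normalising a 2-group S would centralise S
    modulo M, giving an element of order 14 in PSL(2,8); for r = 3 one is reduced to PSL(2,8)
    itself, where the elements of order 3 that are products of two opposite unipotent involutions
    force V = 1.  As the primes other than 2 and 7 all divide the order of one solvable subgroup,
    the conditions on the complement follow.

    Conversely, let O, D, J be the colours of a 3-coloured triangle-free complement.  A cyclic
    group of order the product of the primes of O acts on one of order the product of the primes
    of D, freely or trivially as prescribed; the resulting metacyclic group acts on a sum of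
    modules, one for each j in J, each induced from a linear character whose domain and kernel
    are chosen so that exactly the neighbours of j act freely.  A triangle is realised by a
    direct factor PSL(2,8), all the other primes being larger than 7. *)

Set Implicit Arguments.
Unset Strict Implicit.
Unset Printing Implicit Defensive.
Import GRing.Theory.
Local Open Scope group_scope.

(** * Element orders *)

(** The fixed-point statements about V are derived from sums over orbits, written additively: such a
    sum is invariant, hence zero, and the few integers that appear can be cancelled on V. PSL(2,8)
    enters through its order, its simplicity, the absence of elements of order 6, 14 and 21, and the
    relations of [PSL28_frame] between two opposite Sylow 2-subgroups. All of these are transported
    by isomorphisms, so no matrices occur later. An extension K of PSL(2,8) by M is controlled by
    shrinking K to a minimal supplement of M: Frattini's argument then makes Sylow subgroups of M
    normal in K. In the converse the primes of each colour must be 1 modulo the product of the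
    primes of the earlier colours, since otherwise the required automorphisms and linear characters
    would not exist. Such primes are found as divisors of values of cyclotomic polynomials. *)

Definition has_order (gT : finGroupType) (G : {set gT}) (n : nat) : bool :=
  [exists x in G, #[x] == n].

Section HasOrder.
Variable gT : finGroupType.
Implicit Types (G H V : {group gT}) (x y : gT).

Lemma has_orderP (A : {set gT}) n :
  reflect (exists2 x, x \in A & #[x] = n) (has_order A n).
Proof. by apply: (iffP exists_inP) => [] [x Ax /eqP]; exists x => //; apply/eqP. Qed.

Lemma has_orderS (A B : {set gT}) n : A \subset B -> has_order A n -> has_order B n.
Proof. by move=> sAB /has_orderP[x Ax <-]; apply/has_orderP; exists x; rewrite ?(subsetP sAB). Qed.

Lemma p_elt_power p x : prime p -> p.-elt x -> x != 1 ->
  exists2 y, y \in <[x]> & #[y] = p.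
Proof.
move=> pr_p px ntx; have ntX: <[x]>%G :!=: 1 by rewrite cycle_eq1.
have [_ dvdp _] := pgroup_pdiv px ntX.
by have [y Xy oy] := Cauchy pr_p dvdp; exists y.
Qed.

Lemma has_orderM G p q x y : prime p -> prime q -> p != q ->
    x \in G -> y \in G -> commute x y -> p.-elt x -> x != 1 -> q.-elt y -> y != 1 ->
  has_order G (p * q).
Proof.
move=> pr_p pr_q npq Gx Gy cxy px ntx qy nty.
have [_ /cycleP[i ->] oi] := p_elt_power pr_p px ntx.
have [_ /cycleP[j ->] oj] := p_elt_power pr_q qy nty.
apply/has_orderP; exists (x ^+ i * y ^+ j); first by rewrite groupM ?groupX.
rewrite orderM ?oi ?oj //; last by rewrite prime_coprime // dvdn_prime2.
exact/commuteX/commute_sym/commuteX/commute_sym.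
Qed.

Lemma has_order_mul G p q x y : prime p -> prime q -> p != q ->
    x \in G -> y \in G -> commute x y -> #[x] = p -> #[y] = q ->
  has_order G (p * q).
Proof.
move=> pr_p pr_q npq Gx Gy cxy ox oy; apply/has_orderP; exists (x * y); first exact: groupM.
by rewrite orderM // ox oy // prime_coprime // dvdn_prime2.
Qed.

Lemma has_order_split G p q : prime p -> prime q -> p != q -> has_order G (p * q) ->
  exists x y, [/\ x \in G, y \in G, #[x] = p, #[y] = q & commute x y].
Proof.
move=> pr_p pr_q npq /has_orderP[z Gz oz]; exists (z ^+ q), (z ^+ p).
rewrite !groupX // !orderXdiv ?oz ?(dvdn_mulr _ (dvdnn _)) ?(dvdn_mull _ (dvdnn _)) //.
rewrite mulnK ?mulKn ?prime_gt0 //; split=> //; exact/commuteX/commute_sym/commuteX.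
Qed.

Lemma nonadj_cent1 G V p q x : prime p -> prime q -> p != q ->
    ~~ has_order G (p * q) -> V \subset G -> p.-group V ->
  x \in G -> q.-elt x -> x != 1 -> 'C_V[x] = 1.
Proof.
move=> pr_p pr_q npq no sVG pV Gx qx ntx; apply/trivgP/subsetP=> v /setIP[Vv /cent1P cvx].
rewrite inE; apply: contraR no => ntv.
by apply: (@has_orderM _ _ _ v x) => //; [exact: (subsetP sVG) | exact: mem_p_elt Vv].
Qed.

End HasOrder.

Section HasOrderMorph.
Variables (aT rT : finGroupType) (D : {group aT}) (f : {morphism D >-> rT}).

Lemma has_order_morphim (G : {group aT}) n : has_order (f @* G) n -> has_order G n.
Proof.
case/has_orderP=> _ /morphimP[x Dx Gx ->] on.
have /dvdnP[k ox] := morph_order f Dx; rewrite on in ox.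
apply/has_orderP; exists (x ^+ k); first exact: groupX.
rewrite orderXdiv ox ?dvdn_mulr // mulKn //.
by have := order_gt0 x; rewrite ox muln_gt0 => /andP[].
Qed.

Lemma has_order_injm (G : {group aT}) n : 'injm f -> G \subset D ->
  has_order (f @* G) n = has_order G n.
Proof.
move=> injf sGD; apply/idP/idP=> [|/has_orderP[x Gx on]]; first exact: has_order_morphim.
apply/has_orderP; exists (f x); first by rewrite mem_morphim // (subsetP sGD).
by rewrite order_injm // (subsetP sGD).
Qed.

End HasOrderMorph.

Lemma has_order_isog (aT rT : finGroupType) (G : {group aT}) (H : {group rT}) n :
  G \isog H -> has_order G n = has_order H n.
Proof. by case/isogP=> f injf <-; rewrite has_order_injm. Qed.

Lemma has_order_quotient (gT : finGroupType) (G H : {group gT}) n :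
  has_order (G / H) n -> has_order G n.
Proof. exact: has_order_morphim. Qed.

(** * Fixed points of partitioned groups acting on abelian groups *)

Lemma expg_coprime_inj (gT : finGroupType) (a b : gT) j r :
  coprime j r -> 0 < j -> a ^+ r = 1 -> b ^+ r = 1 -> a ^+ j = b ^+ j -> a = b.
Proof.
move=> co j0 ar br eab; case: (egcdnP r j0) => u v e _.
rewrite (eqP co) in e.
have red (c : gT) : c ^+ r = 1 -> c = (c ^+ j) ^+ u.
  by move=> cr; rewrite -expgM mulnC e expgD mulnC expgM cr expg1n mul1g.
by rewrite (red a) // eab -red.
Qed.

Section Partition.
Import FiniteModule.

(* The sets <[x k]> with k in K cover G \ K evenly, and the orbit sums over each of them vanish;
   this forces the sum of the K-orbit of u to be #|K| times u. *)
Lemma partition_cent (gT : finGroupType) (V G K : {group gT}) (r : nat) :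
    abelian V -> G \subset 'N(V) -> K <| G -> prime r -> #|G : K| = r ->
    {in G :\: K, forall g, g ^+ r = 1} -> {in G :\: K, forall g, 'C_V[g] = 1} ->
  coprime #|V| #|K| -> K \subset 'C(V).
Proof.
move=> abV nVG nsKG pr_r iGK expr cV1 coVK.
have [sKG nKG] := andP nsKG.
have nV g : g \in G -> g \in 'N(V) by apply: (subsetP nVG).
have [x Gx notKx]: exists2 x, x \in G & x \notin K.
  apply/subsetPn/negP => sGK; move: (prime_gt1 pr_r).
  by rewrite -iGK (_ : G :=: K) ?indexgg //; apply/eqP; rewrite eqEsubset sGK.
pose act (u : fmod_of abV) g := actr u g.
have fix0 g u : g \in G :\: K -> act u g = u -> u = 0%R.
  move=> GKg fu; apply: val_inj; rewrite fmval0.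
  suff: val u \in 'C_V[g] by rewrite cV1 // => /set1P.
  rewrite inE fmodP.
  apply/cent1P; apply/commgP/conjg_fixP.
  by have /setDP[Gg _] := GKg; rewrite -fmvalJ ?nV //; congr (val _).
have actM u g h : g \in G -> h \in G -> act u (g * h) = act (act u g) h.
  by move=> Gg Gh; rewrite /act actrM ?nV.
have cyc0 g u : g \in G :\: K -> (\sum_(j < r) act u (g ^+ j)%g = 0)%R.
  move=> GKg; have /setDP[Gg _] := GKg; apply: (fix0 g) => //.
  rewrite /act actr_sum; have r0 := prime_gt0 pr_r.
  transitivity (\sum_(j < r) act u (g ^+ j.+1)%g)%R.
    by apply: eq_bigr => j _; rewrite -[LHS]/(act (act u _) _) -actM ?groupX // -expgSr.
  rewrite -(prednK r0) big_ord_recr big_ord_recl /= prednK // expr // expg0 addrC.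
  by congr (_ + _)%R; apply: eq_bigr => j _.
have GK k : k \in K -> x * k \in G :\: K.
  by move=> Kk; rewrite inE groupMr // notKx groupM // (subsetP sKG).
(* Summing [cyc0] over the elements [x * k] gives [E]. Its terms with j = 0 contribute #|K| times u.
   For each j > 0 the j-th powers run over the coset of [x ^+ j], so the rest is the K-orbit sum of
   u x + ... + u x^(r-1), which equals -u by [cyc0] for x. *)
have main u : (u *+ #|K| = \sum_(k in K) act u k)%R.
  have E : (\sum_(k in K) \sum_(j < r) act u ((x * k) ^+ j)%g = 0)%R.
    by rewrite big1 // => k Kk; rewrite cyc0 // GK.
  have r0 := prime_gt0 pr_r.
  rewrite exchange_big /= in E; move: E (cyc0 x u); rewrite -(prednK r0) !big_ord_recl /=.
  have -> : (\sum_(i in K) act u ((x * i) ^+ 0)%g = u *+ #|K|)%R.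
    by rewrite -sumr_const; apply: eq_bigr => k _; rewrite expg0 /act actr1.
  rewrite inE notKx Gx expg0 [act u 1]actr1 => E /(_ isT) C.
  apply/eqP; rewrite -subr_eq0 -[X in _ == X]E; apply/eqP; congr (_ + _)%R.
  have -> : (\sum_(i < r.-1) \sum_(k in K) act u ((x * k) ^+ bump 0 i)%g =
     \sum_(i < r.-1) \sum_(k in K) act (act u (x ^+ bump 0 i)%g) k)%R.
    apply: eq_bigr => i _; set j := bump 0 i.
    have co : coprime j r.
      rewrite coprime_sym prime_coprime // /j /bump add1n gtnNdvd //.
      by rewrite -ltn_predRL.
    pose h k := (x * k) ^+ j.
    have injh : {in K &, injective h}.
      move=> k k' Kk Kk' ekk; apply: (mulgI x).
      by apply: expg_coprime_inj co _ _ _ ekk; rewrite ?expr ?GK.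
    have imh : h @: K = mulg (x ^+ j) @: K.
      apply/eqP; rewrite eqEcard (card_imset _ (mulgI _)) (card_in_imset injh) leqnn andbT.
      apply/subsetP=> _ /imsetP[k Kk ->]; rewrite -(mulKVg (x ^+ j) (h k)) imset_f // /h.
      have Nx := subsetP nKG x Gx; have Nk := subsetP nKG k (subsetP sKG k Kk).
      apply: coset_idr; first by rewrite groupM ?groupV ?groupX ?groupM.
      rewrite morphM ?groupV ?groupX ?groupM //.
      have e : coset K (x * k) = coset K x by rewrite morphM //= (coset_id Kk) mulg1.
      rewrite morphV ?groupX // (morphX _ _ Nx) morphX ?groupM //.
      by rewrite -[coset_morphism K (x * k)]/(coset K (x * k)) e mulVg.
    rewrite -(big_imset (h := h) (fun g => act u g)) // imh big_imset /=; last first.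
      by move=> a b _ _ /mulgI.
    by apply: eq_bigr => k Kk; rewrite actM ?groupX // (subsetP sKG).
  rewrite exchange_big /=.
  rewrite -sumrN; apply: eq_bigr => k Kk.
  rewrite /act -actr_sum -actNr; congr (actr _ _).
  by apply/eqP; rewrite eq_sym -addr_eq0 addrC C.
(* The multiple of v by #|K| is an orbit sum, hence K-invariant, and #|K| can be divided out on
   V. *)
apply/centsP => k Kk v Vv; apply/esym/commgP/conjg_fixP.
have Gk := subsetP sKG k Kk.
have : act (fmod abV v *+ #|K|)%R k = (fmod abV v *+ #|K|)%R.
  rewrite main /act actr_sum [RHS](reindex_inj (mulIg k)) /=; apply: eq_big => [g|g Kg].
    by rewrite groupMr.
  by rewrite -/(act _ _) -/(act _ _) -actM // (subsetP sKG).
move/(congr1 val); rewrite /act fmvalJ ?nV // fmvalZ fmodK // => fixn.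
by rewrite -(expgK coVK Vv) conjXg fixn.
Qed.

End Partition.

Lemma cent1_prime_cycle (gT : finGroupType) (x y : gT) :
  prime #[x] -> y \in <[x]> -> y != 1 -> 'C[y] = 'C[x].
Proof.
move=> pr_x Xy nty; rewrite -!cent_cycle; congr 'C(_).
apply/eqP; rewrite eqEcard cycle_subG Xy -!orderE.
have nt1 : #[y] != 1%N by rewrite order_eq1.
have /(prime_nt_dvdP pr_x nt1) E : #[y] %| #[x] := order_dvdG Xy.
by rewrite E /=.
Qed.

(** K extended by x behaves as a Frobenius group with kernel K: each element outside K is
    K-conjugate to a nontrivial power of x, so it has prime order and no fixed point in V, and
    [partition_cent] applies. *)
Lemma Frobenius_cent (gT : finGroupType) (V K : {group gT}) (x : gT) :
    abelian V -> K \subset 'N(V) -> x \in 'N(V) -> x \in 'N(K) -> prime #[x] ->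
    coprime #|V| #|K| -> 'C_K[x] = 1 -> 'C_V[x] = 1 -> 
  K \subset 'C(V).
Proof.
move=> abV nVK nVx nKx pr_x coVK cK1 cV1.
have [/eqP K1|ntK] := boolP (K :==: 1); first by rewrite K1 sub1G.
have TI : K :&: <[x]> = 1.
  apply/trivgP; rewrite -cK1 setIS // -cent_cycle; exact: cycle_abelian.
have sGN: K <*> <[x]> \subset 'N(V) by rewrite join_subG nVK cycle_subG.
have nKX : <[x]> \subset 'N(K) by rewrite cycle_subG.
have defG : K <*> <[x]> = K * <[x]> by rewrite norm_joinEr.
have nsK : K <| K <*> <[x]> by rewrite normalYl.
have idx : #|K <*> <[x]> : K| = #[x].
  by rewrite -divgS ?joing_subl //= defG TI_cardMg // mulKn.
have conj g : g \in K <*> <[x]> :\: K -> exists2 k, k \in K & exists2 y, g = y ^ k & y \in <[x]>^#.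
  case/setDP; rewrite defG; case/mulsgP=> a y Ka Xy -> nK.
  have nty : y != 1 by apply: contraNneq nK => ->; rewrite mulg1.
  have cKy : 'C_K[y] = 1.
    by rewrite (cent1_prime_cycle pr_x).
  have Ny : y \in 'N(K) by apply: subsetP nKX y Xy.
  (* This map is injective on K because y has no fixed point there, hence it is onto; a preimage of
     a conjugates y to [a * y]. *)
  pose h k := y ^ k * y^-1.
  have injh : {in K &, injective h}.
    move=> k k' Kk Kk' /mulIg e; apply/eqP; rewrite eq_mulgV1; apply/eqP/set1P.
    rewrite -[[set 1]]/(1%g : {set gT}) -cKy inE groupM ?groupV //=.
    by apply/cent1P/commute_sym/commgP/conjg_fixP; rewrite conjgM e conjgK.
  have imh : h @: K = K.
    apply/eqP; rewrite eqEcard card_in_imset // leqnn andbT.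
    apply/subsetP=> _ /imsetP[k Kk ->]; rewrite /h conjgE -!mulgA groupMl ?groupV //.
    by have := memJ_norm k (groupVr Ny); rewrite conjgE invgK Kk.
  have: a \in h @: K by rewrite imh.
  case/imsetP=> k Kk ->; exists k => //; exists y; first by rewrite /h mulgKV.
  by rewrite !inE nty.
apply: (partition_cent abV sGN nsK pr_x idx) => //.
  move=> g /conj[k Kk [y -> /setD1P[_ Xy]]]; apply/eqP; rewrite -order_dvdn orderJ.
  exact: order_dvdG.
move=> g /conj[k Kk [y -> /setD1P[nty Xy]]].
have nVk := subsetP nVK k Kk.
rewrite cent1J -(normP nVk) -conjIg (_ : 'C_V[y] = 1) ?conjs1g //.
by rewrite (cent1_prime_cycle pr_x).
Qed.

(* An elementary abelian group of order q ^ 2 is partitioned by its q + 1 subgroups of order q. *)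
Lemma free_abelem_cyclic (gT : finGroupType) (V E : {group gT}) q :
    abelian V -> V :!=: 1 -> E \subset 'N(V) -> prime q -> coprime #|V| q ->
    q.-abelem E -> {in E^#, forall e, 'C_V[e] = 1} ->
  cyclic E.
Proof.
move=> abV ntV nVE pr_q coVq abE free; rewrite (abelem_cyclic abE) leqNgt; apply/negP=> rE.
have /andP[qE _] := abE.
have [b Eb ob] : {b | b \in E & #[b] = q}.
  apply: Cauchy => //; have : 0 < logn q #|E| by apply: leq_trans rE.
  by rewrite logn_gt0 mem_primes => /and3P[].
have : ~~ (E \subset <[b]>).
  apply: contraL rE => /subset_leq_card; rewrite -orderE ob -ltnNge ltnS => le.
  by rewrite -(leq_exp2l _ _ (prime_gt1 pr_q)) expn1 -(card_pgroup qE).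
case/subsetPn=> a Ea nba.
have abelE := abelem_abelian abE.
pose K := <[b]>%G; pose G := (<[a]> <*> <[b]>)%G.
have sGE : G \subset E by rewrite /= join_subG !cycle_subG Ea.
have sKG : K \subset G by rewrite /= joing_subr.
have abG : abelian G by apply: abelianS abelE.
have nKG : K <| G by rewrite /normal sKG (sub_abelian_norm abG).
have ex g : g \in E -> g ^+ q = 1 by case/(abelemP pr_q): abE => _; apply.
have oa : #[a] = q.
  have := order_dvdn a q; rewrite ex // eqxx => /(prime_nt_dvdP pr_q) -> //.
  by rewrite order_eq1; apply: contraNneq nba => ->; rewrite group1.
have TI : <[a]> :&: <[b]> = 1 by apply: prime_TIg; rewrite -?orderE ?oa // cycle_subG.
have iG : #|G : K| = q.
  rewrite -divgS //= norm_joinEr; last by rewrite (subset_trans _ (sub_abelian_norm abelE _)) ?cycle_subG.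
  by rewrite TI_cardMg // -!orderE oa ob mulKn ?prime_gt0.
have : K \subset 'C(V).
  apply: (partition_cent (G := G) (r := q)) => //.
  - exact: subset_trans sGE nVE.
  - by move=> g /setDP[Gg _]; rewrite ex ?(subsetP sGE).
  - move=> g /setDP[Gg nK]; apply: free; rewrite !inE (subsetP sGE) // andbT.
    by apply: contraNneq nK => ->; rewrite group1.
  by rewrite -orderE ob.
rewrite cycle_subG => cbV; case/negP: ntV; rewrite -(free b); last first.
  by rewrite !inE Eb andbT -order_gt1 ob prime_gt1.
by rewrite eq_sym; apply/eqP/setIidPl; rewrite sub_cent1 cbV.
Qed.

Lemma free_rank1 (gT : finGroupType) (V G : {group gT}) (p q : nat) :
    abelian V -> p.-group V -> V :!=: 1 -> G \subset 'N(V) -> prime p -> prime q -> p != q ->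
    ~~ has_order (V <*> G) (p * q) ->
  'r_q(G) <= 1.
Proof.
move=> abV pV ntV nVG pr_p pr_q npq no; have [E] := p_rank_witness q G.
case/pnElemP=> sEG abE <-; rewrite -(abelem_cyclic abE).
apply: (free_abelem_cyclic (q := q) abV) => //.
- exact: subset_trans sEG nVG.
- by rewrite coprime_sym prime_coprime // -p'natE //; apply: pi_pnat pV _; rewrite !inE.
move=> e /setD1P[nte Ee]; apply: (nonadj_cent1 pr_p pr_q npq no) => //.
- exact: joing_subl.
- by rewrite (subsetP (joing_subr _ _)) // (subsetP sEG).
exact: mem_p_elt (abelem_pgroup abE) Ee.
Qed.

(** * Solvable groups *)

Section Solvable.
Variable gT : finGroupType.
Implicit Types (G H K V W A B : {group gT}) (p q r s : nat).

Lemma Hall_prime_dvd G H (pi : nat_pred) s : pi.-Hall(G) H -> prime s -> s \in pi ->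
  (s %| #|H|) = (s %| #|G|).
Proof.
move=> hallH pr_s pis; have := pi_of_part pi (cardG_gt0 G) s.
by rewrite -(card_Hall hallH) !inE pis andbT !mem_primes pr_s !cardG_gt0.
Qed.

Lemma normal_TI_cent G H K : H <| G -> K <| G -> H :&: K = 1 -> H \subset 'C(K).
Proof.
move=> /andP[sHG nHG] /andP[sKG nKG] TI; apply/commG1P/trivgP; rewrite -TI.
by rewrite commg_subI // subsetI subxx ?(subset_trans sHG) ?(subset_trans sKG).
Qed.

(** The automorphism group of a cyclic group is abelian: K acts on a generator by powers, and these
    commute. *)
Lemma cyclic_der1_cent F K : cyclic F -> K \subset 'N(F) -> K^`(1) \subset 'C(F).
Proof.
case/cyclicP=> f defF nFK; rewrite gen_subG.
apply/subsetP=> _ /imset2P[a b Ka Kb ->].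
have pow c : c \in K -> exists i, f ^ c = f ^+ i.
  by move=> Kc; apply/cycleP; rewrite -defF memJ_norm ?(subsetP nFK) // defF cycle_id.
have [[i fa] [j fb]] := (pow _ (groupVr Ka), pow _ (groupVr Kb)).
have eab : f ^ (a^-1 * b^-1) = f ^ (b^-1 * a^-1).
  by rewrite !conjgM fa fb !conjXg fa fb -!expgM mulnC.
rewrite /= defF cent_cycle; apply/cent1P/commute_sym/commgP/conjg_fixP.
rewrite (_ : [~ a, b] = a^-1 * b^-1 * (a * b)); last by rewrite commgEl conjgE !mulgA.
by rewrite conjgM eab -conjgM mulgA mulgKV mulVg conjg1.
Qed.

(** [Frobenius_cent] makes W centralise V, whereas the non-adjacency of p and q forbids this to any
    nontrivial element of W. *)
Lemma nonadj_Frobenius G V W p q r x : prime p -> prime q -> prime r -> p != q -> p != r -> q != r ->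
    ~~ has_order G (p * q) -> ~~ has_order G (p * r) -> ~~ has_order G (q * r) ->
    abelian V -> p.-group V -> V :!=: 1 -> V \subset G ->
    q.-group W -> W :!=: 1 -> W \subset G -> W \subset 'N(V) ->
    x \in G -> #[x] = r -> x \in 'N(V) -> x \in 'N(W) ->
  False.
Proof.
move=> pr_p pr_q pr_r npq npr nqr no_pq no_pr no_qr abV pV ntV sVG qW ntW sWG nVW Gx ox nVx nWx.
have rx : r.-elt x by rewrite /p_elt ox pnat_id.
have ntx : x != 1 by rewrite -order_gt1 ox prime_gt1.
have /subsetP cVW : W \subset 'C(V).
  apply: (@Frobenius_cent _ V W x) => //.
  - by rewrite ox.
  - by apply: (pnat_coprime pV); apply: (pi_pnat qW); rewrite !inE eq_sym.
  - exact: (nonadj_cent1 pr_q pr_r nqr no_qr).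
  exact: (nonadj_cent1 pr_p pr_r npr no_pr).
have [w Ww ntw] := trivgPn _ ntW; case/negP: ntV; rewrite -subG1.
rewrite -(nonadj_cent1 pr_p pr_q npq no_pq sVG pV (subsetP sWG w Ww) (mem_p_elt qW Ww) ntw).
by rewrite subsetI subxx sub_cent1 cVW.
Qed.

Lemma minnormal_pi_sol G (pi : nat_pred) : solvable G -> G :!=: 1 -> pi.-group G ->
  exists W s, [/\ prime s, s \in pi, s.-abelem W, W :!=: 1 & W <| G].
Proof.
move=> solG ntG piG; have [W minW sWG] := minnormal_exists ntG (normG G).
have [nWG ntW /is_abelemP[s pr_s abW]] := minnormal_solvable minW sWG solG.
exists W, s; split=> //; last by rewrite /normal sWG.
have [_ dvd _] := pgroup_pdiv (abelem_pgroup abW) ntW.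
by have := pgroupP (pgroupS sWG piG) s pr_s dvd.
Qed.

(** A Hall {q, r}-subgroup has a minimal normal subgroup belonging to one of the two primes; an
    element of the other prime order acts on it, and both act on V, as in [nonadj_Frobenius]. *)
Lemma nonadj_two_primes G V p q r : prime p -> prime q -> prime r ->
    p != q -> p != r -> q != r ->
    ~~ has_order G (p * q) -> ~~ has_order G (p * r) -> ~~ has_order G (q * r) ->
    solvable G -> q %| #|G| -> r %| #|G| ->
    V <| G -> abelian V -> p.-group V -> V :!=: 1 ->
  False.
Proof.
move=> pr_p pr_q pr_r npq npr nqr no_pq no_pr no_qr solG dvq dvr /andP[sVG nVG] abV pV ntV.
have [H hallH] := Hall_exists (pred2 q r) solG.
have [sHG piH _] := and3P hallH.
have dvqH : q %| #|H| by rewrite (Hall_prime_dvd hallH) ?inE ?eqxx.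
have dvrH : r %| #|H| by rewrite (Hall_prime_dvd hallH) ?inE ?eqxx ?orbT.
have ntH : H :!=: 1.
  by apply: contraTneq dvqH => ->; rewrite cards1 dvdn1; case: (q) pr_q => [|[]].
have [W [s [pr_s pis abW ntW /andP[sWH nWH]]]] := minnormal_pi_sol (solvableS sHG solG) ntH piH.
have sW := abelem_pgroup abW.
have sWG := subset_trans sWH sHG; have nVH := subset_trans sHG nVG.
have nVW := subset_trans sWG nVG.
case/pred2P: pis => es; subst s.
  have [x Hx ox] := Cauchy pr_r dvrH.
  by apply: (@nonadj_Frobenius G V W p q r x) => //; rewrite ?(subsetP sHG) ?(subsetP nVH) ?(subsetP nWH).
have [x Hx ox] := Cauchy pr_q dvqH.
apply: (@nonadj_Frobenius G V W p r q x) => //; rewrite 1?eq_sym //; rewrite 1?mulnC //.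
- by rewrite (subsetP sHG).
- by rewrite (subsetP nVH).
by rewrite (subsetP nWH).
Qed.

Lemma solvable_three_primes G p q r : prime p -> prime q -> prime r ->
    p != q -> p != r -> q != r -> solvable G -> p %| #|G| -> q %| #|G| -> r %| #|G| ->
  [|| has_order G (p * q), has_order G (p * r) | has_order G (q * r)].
Proof.
move=> pr_p pr_q pr_r npq npr nqr solG dvp dvq dvr.
have [H hallH] := Hall_exists (pred3 p q r) solG.
have [sHG piH _] := and3P hallH; have solH := solvableS sHG solG.
have dvH s : prime s -> s \in pred3 p q r -> s %| #|H| = (s %| #|G|).
  by move=> pr_s pis; rewrite (Hall_prime_dvd hallH).
apply/negPn/negP; rewrite !negb_or => /and3P[].
do 3![move/(contra (has_orderS sHG)) => ?].
have ntH : H :!=: 1.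
  have := dvH p pr_p; rewrite dvp !inE eqxx => /(_ isT) dvpH.
  by apply: contraTneq dvpH => ->; rewrite cards1 dvdn1; case: (p) pr_p => [|[]].
have [V [s [pr_s pis abV ntV nsVH]]] := minnormal_pi_sol solH ntH piH.
have sV := abelem_pgroup abV; have {}abV := abelem_abelian abV.
rewrite !inE in pis; case/or3P: pis => /eqP es; subst s.
- by apply: (@nonadj_two_primes H V p q r) => //; rewrite dvH ?inE ?eqxx ?orbT.
- by apply: (@nonadj_two_primes H V q p r) => //; rewrite ?dvH ?inE ?eqxx ?orbT // 1?eq_sym // mulnC.
apply: (@nonadj_two_primes H V r p q) => //; rewrite ?dvH ?inE ?eqxx ?orbT // 1?eq_sym // 1?mulnC //.
Qed.

Definition arrow G p q : bool :=
  [&& p != q, ~~ has_order G (p * q)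
    & [exists A : {group gT}, (pred2 p q).-Hall(G) A && ('O_q(A) != 1)]].

Lemma arrow_total G p q : solvable G -> prime p -> prime q -> p %| #|G| -> p != q ->
  ~~ has_order G (p * q) -> arrow G p q || arrow G q p.
Proof.
move=> solG pr_p pr_q dvp npq no.
have [A hallA] := Hall_exists (pred2 p q) solG; have [sAG piA _] := and3P hallA.
have ntA : A :!=: 1.
  have : p %| #|A| by rewrite (Hall_prime_dvd hallA) ?inE ?eqxx.
  by apply: contraTneq => ->; rewrite cards1 dvdn1; case: (p) pr_p => [|[]].
have [W [s [pr_s pis abW ntW nsWA]]] := minnormal_pi_sol (solvableS sAG solG) ntA piA.
have ntO : 'O_s(A) != 1.
  by apply: contraNneq ntW => O1; rewrite -subG1 -O1 pcore_max ?(abelem_pgroup abW).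
rewrite /arrow npq eq_sym npq no mulnC no /=.
case/pred2P: pis => es; subst s; apply/orP; [right | left]; apply/existsP; exists A.
  rewrite ntO andbT; move: hallA; congr is_true; apply: eq_pHall => z.
  by rewrite !inE orbC.
by rewrite ntO andbT.
Qed.

(** Hall subgroups of a solvable group are conjugate, so the witness in [arrow] may be replaced by
    any other. *)
Lemma arrow_Hall G A p q : solvable G -> arrow G p q -> (pred2 p q).-Hall(G) A -> 'O_q(A) != 1.
Proof.
move=> solG /and3P[_ _ /existsP[B /andP[hallB ntO]]] hallA.
have [x Gx ->] := Hall_trans solG hallA hallB.
by rewrite pcoreJ -(conjs1g x) (inj_eq (act_inj 'Js x)).
Qed.

(** Cores for distinct primes centralise each other. This excludes opposite arrows between two
    primes and, below, the wrong primes for a minimal normal subgroup. *)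
Lemma nonadj_pcores G p q : prime p -> prime q -> p != q -> ~~ has_order G (p * q) ->
  'O_p(G) != 1 -> 'O_q(G) != 1 -> False.
Proof.
move=> pr_p pr_q npq no /trivgPn[x Px ntx] /trivgPn[y Qy nty]; case/negP: no.
apply: (has_orderM pr_p pr_q npq (subsetP (pcore_sub _ _) _ Px) (subsetP (pcore_sub _ _) _ Qy)) => //.
- have: 'O_q(G) \subset 'C('O_p(G)).
    apply: normal_TI_cent (pcore_normal q G) (pcore_normal p G) _.
    apply/coprime_TIg/(pnat_coprime (pcore_pgroup q G)).
    by apply: pi_pnat (pcore_pgroup p G) _; rewrite !inE.
  by move=> /centsP cPQ; apply/commute_sym/cPQ.
- exact: mem_p_elt (pcore_pgroup _ _) Px.
- exact: mem_p_elt (pcore_pgroup _ _) Qy.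
Qed.

(* If r -> s then the Sylow r-subgroups have rank one; in a Hall {p,q,r}-subgroup K the arrows
   p -> q -> r leave only O_r(K) nontrivial, and its cyclic socle Z makes K / C_K(Z) abelian,
   although the nonabelian Hall {p,q}-subgroups embed into that quotient. *)
Lemma arrow_no_walk3 G p q r s : solvable G -> prime p -> prime q -> prime r -> prime s ->
    p %| #|G| -> q %| #|G| ->
  arrow G p q -> arrow G q r -> arrow G r s -> False.
Proof.
move=> solG pr_p pr_q pr_r pr_s dvp dvq a_pq a_qr a_rs.
have rG : 'r_r(G) <= 1.
  have [A hallA] := Hall_exists (pred2 r s) solG; have [sAG _ _] := and3P hallA.
  have ntO := arrow_Hall solG a_rs hallA.
  rewrite -(p_rank_Hall hallA) ?inE ?eqxx //.
  have [nrs no _] := and3P a_rs.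
  have sO := pcore_pgroup s A; have nO : A \subset 'N('O_s(A)) := gFnorm _ _.
  apply: (@free_rank1 _ 'Z('O_s(A))%G A s r) => //.
  - exact: center_abelian.
  - exact: pgroupS (center_sub _) sO.
  - by apply: contraNneq ntO => /(trivg_center_pgroup sO)->.
  - exact: gFnorm_trans.
  - by rewrite eq_sym.
  rewrite mulnC; apply: contra no; apply: has_orderS.
  by rewrite join_subG (subset_trans _ sAG) // (subset_trans (center_sub _)) ?pcore_sub.
have [npq no_pq _] := and3P a_pq; have [nqr no_qr _] := and3P a_qr.
have [A0 hallA0] := Hall_exists (pred2 p q) solG.
(* A walk returning to p would give one Hall {p, q}-subgroup nontrivial cores for both primes. *)
have [epr|npr] := eqVneq p r.
  have [sAG _ _] := and3P hallA0.
  apply: (@nonadj_pcores A0 p q) => //.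
  - by apply: contra no_pq; apply: has_orderS.
  - apply: (arrow_Hall (p := q) solG); first by rewrite epr.
    by rewrite -(eq_pHall (pi := pred2 p q)) // => z; rewrite !inE orbC.
  exact: arrow_Hall a_pq _.
have [K hallK] := Hall_exists (pred3 p q r) solG; have [sKG piK _] := and3P hallK.
have solK := solvableS sKG solG.
have [A hallAK] := Hall_exists (pred2 p q) solK.
have [B hallBK] := Hall_exists (pred2 q r) solK.
have hallA : (pred2 p q).-Hall(G) A.
  by apply: subHall_Hall hallK _ hallAK => z; rewrite !inE => /orP[]->; rewrite ?orbT.
have hallB : (pred2 q r).-Hall(G) B.
  by apply: subHall_Hall hallK _ hallBK => z; rewrite !inE => /orP[]->; rewrite ?orbT.
have [sAK _ _] := and3P hallAK; have [sBK _ _] := and3P hallBK.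
have OqA := arrow_Hall solG a_pq hallA; have OrB := arrow_Hall solG a_qr hallB.
have noK n : ~~ has_order G n -> ~~ has_order K n by apply: contra; apply: has_orderS.
have noA n : ~~ has_order G n -> ~~ has_order A n.
  by move=> ?; apply: contra (noK n _) => //; apply: has_orderS.
have noB n : ~~ has_order G n -> ~~ has_order B n.
  by move=> ?; apply: contra (noK n _) => //; apply: has_orderS.
have dvpA : p %| #|A| by rewrite (Hall_prime_dvd hallA) ?inE ?eqxx.
have dvqA : q %| #|A| by rewrite (Hall_prime_dvd hallA) ?inE ?eqxx ?orbT.
have OpA : 'O_p(A) = 1.
  by apply/eqP/idPn => nt; apply: (@nonadj_pcores A p q) => //; apply: noA.
have ntK : K :!=: 1.
  have := dvdn_trans dvpA (cardSg sAK).
  by apply: contraTneq => ->; rewrite cards1 dvdn1; case: (p) pr_p => [|[]].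
have [F [t [pr_t pit abF ntF nsFK]]] := minnormal_pi_sol solK ntK piK.
have tF := abelem_pgroup abF; have [sFK nFK] := andP nsFK.
have pcoreH (rho : nat_pred) (H : {group gT}) : rho.-Hall(K) H -> t \in rho -> F \subset 'O_t(H).
  move=> hallH tr; have [sHK _ _] := and3P hallH.
  have sFH : F \subset H by rewrite (normal_sub_max_pgroup (Hall_max hallH)) // /pgroup (pi_pnat tF).
  by rewrite pcore_max // (normalS sFH sHK).
(* F lies in the t-core of each Hall subgroup of K whose primes include t. For t = p this core of A
   is trivial; for t = q that of B is excluded by its r-core. So t = r, and F is cyclic by the rank
   bound. *)
rewrite !inE in pit; case/or3P: pit => /eqP et; subst t.
- case/negP: ntF; rewrite -subG1 -OpA; apply: pcoreH hallAK _; by rewrite !inE eqxx.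
- have OqB : 'O_q(B) != 1.
    apply: contraNneq ntF => O1; rewrite -subG1 -O1; apply: pcoreH hallBK _; by rewrite !inE eqxx.
  by apply: (@nonadj_pcores B q r) => //; apply: noB.
have cycF : cyclic F.
  by rewrite (abelem_cyclic abF) -(p_rank_abelem abF) (leq_trans (p_rankS _ (subset_trans sFK sKG))).
have [f Ff ntf] := trivgPn _ ntF.
(* The derived subgroup of A centralises F, so it has no element of order q; being a normal
   p-subgroup, it lies in the trivial p-core of A. *)
have abA : abelian A.
  apply/derG1P/trivgP; rewrite -OpA; apply: pcore_max; last exact: der_normal.
  have sA'C : A^`(1) \subset 'C(F) by apply: subset_trans (dergS 1 sAK) (cyclic_der1_cent cycF nFK).
  have piA : (pred2 p q).-group A by case/and3P: hallA.
  apply/pgroupP => u pr_u /(Cauchy pr_u)[x A'x ox].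
  have Ax := subsetP (der_sub 1 A) x A'x.
  have: u \in pred2 p q by apply: (pgroupP piA); rewrite // -ox order_dvdG.
  case/pred2P=> [->|eu]; first by rewrite inE.
  case/negP: (noK _ no_qr); apply: (has_orderM pr_q pr_r nqr (subsetP sAK x Ax) (subsetP sFK f Ff)) => //.
  - exact: (centsP sA'C).
  - by rewrite /p_elt ox eu pnat_id.
  - by rewrite -order_gt1 ox prime_gt1.
  exact: mem_p_elt tF Ff.
have [[x Ax ox] [y Ay oy]] := (Cauchy pr_p dvpA, Cauchy pr_q dvqA).
case/negP: (noA _ no_pq); apply: (has_orderM pr_p pr_q npq Ax Ay) => //.
- exact: (centsP abA).
- by rewrite /p_elt ox pnat_id.
- by rewrite -order_gt1 ox prime_gt1.
- by rewrite /p_elt oy pnat_id.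
by rewrite -order_gt1 oy prime_gt1.
Qed.

(* Colour a prime by the length (capped at 2) of the longest walk starting from it. *)
Lemma solvable_3coloring G : solvable G -> exists c : nat -> 'I_3,
  forall p q, prime p -> prime q -> p %| #|G| -> q %| #|G| -> p != q ->
    ~~ has_order G (p * q) -> c p != c q.
Proof.
move=> solG; pose s := primes #|G|.
pose w1 p := has (arrow G p) s; pose w2 p := has (fun q => arrow G p q && w1 q) s.
exists (fun p => inord (w1 p + w2 p)) => p q pr_p pr_q.
wlog a_pq : p q pr_p pr_q / arrow G p q.
  move=> IH dvp dvq npq no.
  case/orP: (arrow_total solG pr_p pr_q dvp npq no) => [?|a_qp]; first exact: IH.
  by rewrite eq_sym; apply: IH => //; rewrite 1?eq_sym // mulnC.
move=> dvp dvq _ _.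
have s_q : q \in s by rewrite mem_primes pr_q cardG_gt0.
have w1p : w1 p by apply/hasP; exists q.
(* Since p points to q, a walk of length 2 from q would complete a walk of length 3. Hence q has
   colour [w1 q], and the colour of p is strictly larger. *)
have nw2q : ~~ w2 q.
  apply/negP => /hasP[r]; rewrite mem_primes => /and3P[pr_r _ dvr] /andP[a_qr /hasP[t]].
  rewrite mem_primes => /and3P[pr_t _ _] a_rt.
  exact: (arrow_no_walk3 solG pr_p pr_q pr_r pr_t).
rewrite -(inj_eq val_inj) /= !inordK; try by do 2![case: (w1 _)]; do 2![case: (w2 _)].
rewrite w1p (negbTE nw2q) addn0; case w1q: (w1 q); last by case: (w2 p).
suff -> : w2 p by [].
by apply/hasP; exists q; rewrite ?a_pq.
Qed.

End Solvable.

(** * Actions of 2-groups and of their automorphisms of order 7 *)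

Lemma cyclic_index2_quotient (gT : finGroupType) (S X N : {group gT}) :
    cyclic X -> X \subset S -> #|S : X| %| 2 -> S \subset 'N(N) -> 2.-abelem (S / N) ->
  #|S / N| <= 4.
Proof.
move=> cycX sXS iSX nNS abSN.
have cXN : #|X / N| <= 2.
  have abXN : 2.-abelem (X / N) := abelemS (quotientS N sXS) abSN.
  have := quotient_cyclic N cycX; rewrite (abelem_cyclic abXN) => l1.
  by rewrite (card_pgroup (abelem_pgroup abXN)) (leq_pexp2l (n2 := 1)).
have iXN : #|S / N : X / N| <= 2.
  apply: dvdn_leq => //; apply: dvdn_trans iSX; apply: index_morphim.
  by rewrite (subset_trans (subsetIl _ _)).
by rewrite -(Lagrange (quotientS N sXS)) (leq_mul (n1 := 2) (n2 := 2)).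
Qed.

(** Such a group is cyclic, dihedral, semidihedral or quaternion, so it has a cyclic subgroup of
    index at most 2, whose image in an elementary abelian quotient has order at most 2. *)
Lemma rank1_2group_quotient (gT : finGroupType) (S N : {group gT}) :
    2.-group S -> 'r_2(S) <= 1 -> S \subset 'N(N) -> 2.-abelem (S / N) ->
  #|S / N| <= 4.
Proof.
move=> pS rS nNS abSN.
have gen n x y : extremal_generators S 2 n (x, y) -> #|S / N| <= 4.
  case=> oS Sx ox Sy; apply: (@cyclic_index2_quotient _ S <[x]>%G) => //.
  - exact: cycle_cyclic.
  - by rewrite cycle_subG.
  rewrite -divgS ?cycle_subG // oS -orderE ox; case: (n) => // m.
  by rewrite /= expnS mulnK ?expn_gt0.
have [|cycS|] := normal_rank1_structure pS.
- move=> X /andP[sXS _] abX; rewrite abelian_rank1_cyclic // (rank_pgroup (pgroupS sXS pS)).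
  exact: leq_trans (p_rankS _ sXS) rS.
- by apply: (@cyclic_index2_quotient _ S S) => //; rewrite indexgg.
case/and3P=> _ ext _.
move: ext; rewrite /extremal2 !inE => /or3P[]/eqP.
- by case/dihedral_classP=> n n1 /(generators_2dihedral n1)[[x y] /gen].
- by case/semidihedral_classP=> n n1 /(generators_semidihedral n1)[[x y] /gen].
by case/quaternion_classP=> n n1 /(generators_quaternion n1)[[x y] /gen].
Qed.

Section Order7.

(* In char 2 one has 1 + X^7 = (1 + X)(1 + X + X^3)(1 + X^2 + X^3); the orbit of an element
   killed by 1 + X + X^3 modulo the centre is commutative. *)
Lemma orbit7_abelian (gT : finGroupType) (S : {group gT}) (x f : gT) :
    x \in 'N(S) -> x ^+ 7 = 1 -> S^`(1) \subset 'Z(S) -> 'Z(S) \subset 'C[x] -> f \in S ->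
    f * f ^ x * f ^ (x ^+ 3) \in 'Z(S) ->
  abelian << f ^: <[x]> >>.
Proof.
move=> nSx x7 S'Z cZx Sf aZ.
pose F k := f ^ (x ^+ k).
have SF k : F k \in S by rewrite memJ_norm // groupX.
have Z_comm g h : g \in S -> h \in S -> [~ g, h] \in 'Z(S).
  by move=> Sg Sh; rewrite (subsetP S'Z) // mem_commg.
have cZ z g : z \in 'Z(S) -> g \in S -> z ^ g = z.
  by move=> /centerP[_ cz] Sg; apply/conjg_fixP/commgP/cz.
have cZX z k : z \in 'Z(S) -> z ^ (x ^+ k) = z.
  move=> /(subsetP cZx)/cent1P cz; apply/conjg_fixP/commgP/commuteX.
  exact: commute_sym.
have bil g h k : g \in S -> h \in S -> k \in S -> [~ g, h * k] = [~ g, k] * [~ g, h].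
  by move=> Sg Sh Sk; rewrite commgMJ cZ ?Z_comm.
have FJ j k : F (j + k)%N = F k ^ (x ^+ j) by rewrite /F -conjgM -expgD addnC.
have F7 k : F (k + 7)%N = F k by rewrite /F expgD x7 mulg1.
pose c k := [~ F 0%N, F k].
have cE j k : [~ F j, F (j + k)%N] = c k.
  by rewrite -{1}(addn0 j) !FJ -conjRg cZX // Z_comm.
have cE' j k : [~ F (j + k)%N, F j] = (c k)^-1 by rewrite -(cE j) invg_comm.
have rel j : [~ F j, F 3] * ([~ F j, F 1%N] * [~ F j, F 0%N]) = 1.
  have SF01 : F 0%N * F 1%N \in S by rewrite groupM ?SF.
  rewrite -(bil _ _ _ (SF j) (SF _) (SF _)) -(bil _ _ _ (SF j) SF01 (SF _)).
  have -> : F 0%N * F 1%N * F 3 = f * f ^ x * f ^ (x ^+ 3) by rewrite /F expg0 conjg1 expg1.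
  by apply/eqP/commgP/commute_sym; case/centerP: aZ => _; apply.
have c2 : c 2 = 1.
  have := rel 2; rewrite -[X in [~ F 2, F X]]/(2 + 1)%N cE.
  rewrite (cE' 1%N 1%N) (cE' 0%N 2) mulKVg => /eqP.
  by rewrite eq_invg1 => /eqP.
have c1 : c 1%N = 1.
  have := rel 1%N; rewrite (cE 1%N 2) (cE 1%N 0%N) (cE' 0%N 1%N) c2 mul1g /c commgg mul1g => /eqP.
  by rewrite eq_invg1 => /eqP.
have c3 : c 3 = 1.
  by have := rel 0%N; rewrite (cE 0%N 3) (cE 0%N 1%N) c1 mul1g commgg mulg1.
have c0 : c 0%N = 1 by rewrite /c commgg.
have sym k : k <= 7 -> c (7 - k)%N = (c k)^-1.
  by move=> k7; rewrite -(cE' (7 - k)%N) subnK // -[7]/(0 + 7)%N F7.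
have c4 : c 4 = 1 by rewrite -[4]/(7 - 3)%N sym // c3 invg1.
have c5 : c 5 = 1 by rewrite -[5]/(7 - 2)%N sym // c2 invg1.
have c6 : c 6 = 1 by rewrite -[6]/(7 - 1)%N sym // c1 invg1.
have call k : c k = 1.
  have -> : c k = c (k %% 7)%N.
    by rewrite /c /F (expg_mod k x7).
  have := ltn_pmod k (isT : 0 < 7).
  by case: (k %% 7)%N => [|[|[|[|[|[|[|]]]]]]].
rewrite abelian_gen; apply/centsP => _ /imsetP[_ /cycleP[i ->] ->] _ /imsetP[_ /cycleP[j ->] ->].
wlog ij : i j / i <= j => [IH|].
  by case/orP: (leq_total i j) => /IH // /commute_sym.
by apply/commgP; rewrite -/(F i) -/(F j) -(subnKC ij) cE call.
Qed.

Import FiniteModule.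

(** Without fixed points of X on S / Z, the norm 1 + X + ... + X^6 = (1 + X + X^3)(1 + X^2 + X^3)
    acts as 0. An e outside Z is either killed modulo Z by the first factor, or sent by it to a
    nonzero element killed by the second. *)
Lemma order7_factor_root (gT : finGroupType) (S Z : {group gT}) (x : gT) :
    Z <| S -> 2.-abelem (S / Z) -> x \in 'N(S) -> x \in 'N(Z) -> x ^+ 7 = 1 ->
    'C_(S / Z)[coset Z x] = 1 -> ~~ (S \subset Z) ->
  exists2 f, f \in S :\: Z &
    (f * f ^ x * f ^ (x ^+ 3) \in Z) \/ (f * f ^ (x ^+ 2) * f ^ (x ^+ 3) \in Z).
Proof.
move=> nsZS abQ nSx nZx x7 cQ1 /subsetPn[e Se nZe].
have [sZS nZS] := andP nsZS.
have abelQ := abelem_abelian abQ; pose X := coset Z x.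
have nQX : X \in 'N(S / Z) by apply: (subsetP (quotient_norm Z S)); apply: mem_quotient.
pose phi w := fmod abelQ (coset Z w).
have SQ w : w \in S -> coset Z w \in S / Z by move=> Sw; apply: mem_quotient.
have phiM : {in S &, forall v w, phi (v * w) = (phi v + phi w)%R}.
  by move=> v w Sv Sw; rewrite /phi morphM ?(subsetP nZS) // fmodM ?SQ.
have SJ w k : w \in S -> w ^ (x ^+ k) \in S by move=> Sw; rewrite memJ_norm // groupX.
have SJ1 w : w \in S -> w ^ x \in S by move=> Sw; rewrite memJ_norm.
have phiJ1 w : w \in S -> phi (w ^ x) = (phi w ^@ X)%R.
  by move=> Sw; rewrite /phi -fmodJ // -morphJ // (subsetP nZS).
have phiJ w k : w \in S -> phi (w ^ (x ^+ k)) = (phi w ^@ (X ^+ k)%g)%R.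
  move=> Sw; rewrite /phi -fmodJ ?groupX //; congr (fmod _ _).
  have -> : X ^+ k = coset Z (x ^+ k) by rewrite -(morphX _ k nZx).
  by rewrite -morphJ ?groupX // (subsetP nZS).
have phi0 w : w \in S -> phi w = 0%R -> w \in Z.
  move=> Sw /(congr1 val); rewrite fmodK ?SQ // fmval0.
  exact: coset_idr (subsetP nZS w Sw).
have dbl u : (u + u)%R = 0%R :> fmod_of abelQ.
  apply: val_inj; rewrite fmvalA fmval0 -expg2.
  by have [_ ->] := abelemP (isT : prime 2) abQ; rewrite ?fmodP.
pose a w := w * w ^ x * w ^ (x ^+ 3).
have Sa w : w \in S -> a w \in S.
  by move=> Sw; rewrite /a (groupM (groupM Sw (SJ1 w Sw)) (SJ w 3 Sw)).
have phia w : w \in S -> phi (a w) = (phi w + phi w ^@ X + phi w ^@ (X ^+ 3)%g)%R.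
  move=> Sw; rewrite /a phiM ?(groupM Sw (SJ1 w Sw)) ?SJ // phiM ?SJ1 //.
  by rewrite phiJ1 // phiJ.
have nX k : X ^+ k \in 'N(S / Z) by rewrite groupX.
have X7 : X ^+ 7 = 1 by rewrite -morphX // x7 morph1.
have actM (u : fmod_of abelQ) j k : (u ^@ (X ^+ j)%g ^@ (X ^+ k)%g = u ^@ (X ^+ (j + k))%g)%R.
  by rewrite expgD actrM.
have actMX (u : fmod_of abelQ) j : (u ^@ (X ^+ j)%g ^@ X = u ^@ (X ^+ j.+1)%g)%R.
  by rewrite expgSr actrM.
have actXM (u : fmod_of abelQ) j : (u ^@ X ^@ (X ^+ j)%g = u ^@ (X ^+ j.+1)%g)%R.
  by rewrite expgS actrM.
have fix0 (u : fmod_of abelQ) : (u ^@ X = u -> u = 0)%R.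
  move=> fu; apply: val_inj; rewrite fmval0.
  suff: val u \in 'C_(S / Z)[X] by rewrite cQ1 => /set1P.
  rewrite inE fmodP; apply/cent1P/commgP/conjg_fixP.
  by rewrite -fmvalJ // fu.
have N0 (u : fmod_of abelQ) : (\sum_(k < 7) u ^@ (X ^+ k)%g = 0)%R.
  apply: fix0; rewrite actr_sum [RHS]big_ord_recl [LHS]big_ord_recr /= addrC.
  rewrite actMX X7 expg0; congr (_ + _)%R.
  by apply: eq_bigr => k _; rewrite actMX.
have [aZ|naZ] := boolP (a e \in Z).
  by exists e; [rewrite inE nZe | left].
exists (a e); first by rewrite inE naZ Sa.
right; move: (Sa e Se) (phia e Se); move: (a e) => g Sg phig.
have Sgg : g * g ^ (x ^+ 2) \in S by rewrite (groupM Sg (SJ _ 2 Sg)).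
apply: phi0; first by rewrite (groupM Sgg (SJ _ 3 Sg)).
rewrite (phiM _ _ Sgg (SJ _ 3 Sg)) (phiM _ _ Sg (SJ _ 2 Sg)) !phiJ // phig.
set u := phi e; have := N0 u; rewrite !big_ord_recl big_ord0 /= addr0 expg0 actr1.
rewrite !actAr !actM !actXM /= expg1 => N.
rewrite /bump /= !add1n in N.
(* Among the nine terms of the product X^3 occurs three times; two copies cancel and the others form
   the norm. *)
rewrite -[RHS]N -[RHS]addr0 -(dbl (u ^@ (X ^+ 3)%g)%R) -[(3 + 2)%N]/5 -[(3 + 3)%N]/6.
by rewrite [LHS](AC (3*3*3) ((1*(2*(4*(3*(8*(6*9))))))*(5*7))).
Qed.

Lemma quotient_abelian_rev3 (gT : finGroupType) (S Z : {group gT}) (u v f : gT) :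
    Z <| S -> abelian (S / Z) -> u \in S -> v \in S -> f \in S ->
  u * v * f \in Z -> f * v * u \in Z.
Proof.
move=> /andP[_ nZS] abQ Su Sv Sf /coset_id; have N w := subsetP nZS w.
have cq a b : a \in S -> b \in S -> coset Z a * coset Z b = coset Z b * coset Z a.
  by move=> Sa Sb; apply: (centsP abQ); apply: mem_quotient.
have M a b : a \in S -> b \in S -> coset Z (a * b) = coset Z a * coset Z b.
  by move=> Sa Sb; rewrite morphM ?N.
have [Suv Sfv] := (groupM Su Sv, groupM Sf Sv).
rewrite (M _ _ Suv Sf) M // => e; apply: coset_idr; first by rewrite N // groupM.
by rewrite (M _ _ Sfv Su) M // (cq f) // -mulgA (cq f) // mulgA (cq v).
Qed.

(** The minimal configuration, where x centralises every proper invariant subgroup. If [S, x] = S is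
    nonabelian, then S is special and its centre is the centraliser of x; a noncentral f with
    commuting conjugates spans a proper invariant subgroup, so x would centralise f. *)
Lemma order7_faithful_cent (gT : finGroupType) (S V : {group gT}) (x : gT) :
    2.-group S -> #[x] = 7 -> x \in 'N(S) -> abelian V -> coprime #|V| 2 ->
    S \subset 'N(V) -> x \in 'N(V) -> 'C_V[x] = 1 ->
    (forall A : {group gT}, A \proper S -> x \in 'N(A) -> [~: A, <[x]>] = 1) ->
  [~: S, <[x]>] \subset 'C(V).
Proof.
move=> pS ox nSx abV coV2 nVS nVx cV1 IH.
have nSX : <[x]> \subset 'N(S) by rewrite cycle_subG.
have coSX : coprime #|S| #|<[x]>|.
  by rewrite -orderE ox; apply: (pnat_coprime pS); rewrite pnatE.
have sRS : [~: S, <[x]>] \subset S by rewrite commg_subl.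
have centP A : [~: A, <[x]>] = 1 -> A \subset 'C[x].
  by move/commG1P; rewrite cent_cycle.
(* If [S, x] is proper, then x centralises it, and c = [s, x] satisfies s^(x^n) = s c^n; n = 7 gives
   c^7 = 1 in a 2-group. *)
have [eRS|nRS] := eqVneq [~: S, <[x]>] S; last first.
  have prR : [~: S, <[x]>] \proper S by rewrite properEneq nRS.
  have nRx : x \in 'N([~: S, <[x]>]) by rewrite (subsetP (commg_normr _ _)) ?cycle_id.
  have cRx := centP _ (IH _ prR nRx).
  have cSx : S \subset 'C[x].
    apply/subsetP=> s Ss; pose c := [~ s, x].
    have Rc : c \in [~: S, <[x]>] by rewrite mem_commg ?cycle_id.
    have cx : c ^ x = c by apply/conjg_fixP/commgP/cent1P/(subsetP cRx).
    have sxn n : s ^ (x ^+ n) = s * c ^+ n.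
      elim: n => [|n IHn]; first by rewrite !expg0 conjg1 mulg1.
      by rewrite expgSr conjgM IHn conjMg conjXg cx (conjg_mulR s x) -/c expgS -mulgA.
    have c1 : c = 1.
      have /eqP := sxn 7; rewrite -ox expg_order conjg1 -{1}(mulg1 s) (inj_eq (mulgI s)) eq_sym => c7.
      have o7 : #[c] %| 7 by rewrite order_dvdn -ox.
      apply/eqP; rewrite -order_eq1; apply/eqP/(@pnat_1 2).
        exact: mem_p_elt pS (subsetP sRS c Rc).
      exact: pnat_dvd o7 _.
    by apply/cent1P/commgP/eqP.
  by rewrite (commG1P _) ?sub1G // cent_cycle.
have [abS|nabS] := boolP (abelian S).
  rewrite eRS; apply: (@Frobenius_cent _ V S x) => //.
  - by rewrite ox.
  - by rewrite coprime_sym (pnat_coprime pS) // p'natE // -prime_coprime // coprime_sym.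
  by rewrite -cent_cycle -{1}eRS (coprime_abel_cent_TI nSX).
exfalso.
have [|[PhiZ S'Z] cSZ] := abelian_charsimple_special pS coSX eRS.
  apply/bigcupsP=> H /andP[chH abH]; rewrite cent_cycle; apply/centP/IH.
    rewrite properEneq char_sub // andbT; apply: contraNneq nabS => <-; exact: abH.
  by rewrite -cycle_subG; apply: char_norm_trans chH _.
rewrite cent_cycle in cSZ.
have nsZ := center_normal S.
have nZx : x \in 'N('Z(S)) by rewrite -cycle_subG; apply: gFnorm_trans.
have abQ : 2.-abelem (S / 'Z(S)) by rewrite -PhiZ Phi_quotient_abelem.
have x7 : x ^+ 7 = 1 by rewrite -ox expg_order.
have cQ1 : 'C_(S / 'Z(S))[coset 'Z(S) x] = 1.
  have := coprime_quotient_cent (center_sub S) (A := <[x]>%G) _ coSX (pgroup_sol pS).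
  rewrite cycle_subG cent_cycle cSZ => /(_ nZx).
  by rewrite trivg_quotient quotient_cycle // cent_cycle.
have ntS : ~~ (S \subset 'Z(S)).
  by apply: contra nabS => sSZ; apply: abelianS sSZ (center_abelian S).
have cZx : 'Z(S) \subset 'C[x] by rewrite -cSZ subsetIr.
have [f /setDP[Sf nZf] fZ] := order7_factor_root nsZ abQ nSx nZx x7 cQ1 ntS.
(* For the reciprocal factor, x is replaced by its inverse: X^-3 (1 + X^2 + X^3) = 1 + X^-1 +
   X^-3. *)
have [y defX aZ] : exists2 y, <[y]> = <[x]> & f * f ^ y * f ^ (y ^+ 3) \in 'Z(S).
  case: fZ => [aZ|bZ]; first by exists x.
  exists x^-1; first exact: cycleV.
  have bZ' := bZ; rewrite -(memJ_norm _ (groupVr (groupX 3 nZx))) in bZ'.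
  move: bZ'; rewrite conjMg conjMg -!conjgM mulgV conjg1 -(expgVn x 3) => bZ'.
  have e : x ^+ 2 * x^-1 ^+ 3 = x^-1 by rewrite expgVn (expgS x 2) invMg mulKVg.
  rewrite e in bZ'.
  have SJ k : k \in <[x]> -> f ^ k \in S by move=> Xk; rewrite memJ_norm // (subsetP nSX).
  apply: (quotient_abelian_rev3 nsZ (abelem_abelian abQ)) bZ' => //; apply: SJ.
    by rewrite groupX // groupV cycle_id.
  by rewrite groupV cycle_id.
have oy : #[y] = 7 by rewrite orderE defX -orderE.
have nSy : y \in 'N(S) by rewrite -cycle_subG defX.
have cZy : 'Z(S) \subset 'C[y] by rewrite -cent_cycle defX cent_cycle.
have y7 : y ^+ 7 = 1 by rewrite -oy expg_order.
have abA : abelian << f ^: <[x]> >>.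
  by rewrite -defX; apply: (orbit7_abelian nSy y7 _ cZy Sf aZ); rewrite S'Z.
have Af : f \in << f ^: <[x]> >> by rewrite mem_gen // class_refl.
have /centP cAx : [~: << f ^: <[x]> >>, <[x]>] = 1.
  apply: (IH << f ^: <[x]> >>%G).
    rewrite properEneq; apply/andP; split; first by apply: contraNneq nabS => <-.
    by rewrite gen_subG class_sub_norm // (subset_trans _ nSX).
  by rewrite -cycle_subG norms_gen // class_norm.
case/negP: nZf; rewrite /= -cSZ inE Sf; exact: (subsetP cAx).
Qed.



(* The exceptional (Hall-Higman) behaviour does not occur because 2 has odd order modulo 7. *)
Lemma order7_2group_cent (gT : finGroupType) (S V : {group gT}) (x : gT) :
    2.-group S -> #[x] = 7 -> x \in 'N(S) -> abelian V -> coprime #|V| 2 ->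
    S \subset 'N(V) -> x \in 'N(V) -> 'C_V[x] = 1 ->
  [~: S, <[x]>] \subset 'C(V).
Proof.
have [n leSn] := ubnP #|S|; elim: n => // n IHn in gT S V x leSn *.
move=> pS ox nSx abV coV2 nVS nVx cV1.
have nSX : <[x]> \subset 'N(S) by rewrite cycle_subG.
(* D is the kernel of S on V. If it is trivial, induction on proper invariant subgroups yields the
   hypothesis of [order7_faithful_cent]; otherwise induction applies modulo D, where V embeds
   because it meets D trivially. *)
pose D := 'C_S(V)%G; have sDS : D \subset S by apply: subsetIl.
have pD := pgroupS sDS pS.
have coVS : coprime #|V| #|S|.
  by rewrite coprime_sym (pnat_coprime pS) // p'natE // -prime_coprime // coprime_sym.
have VD1 : V :&: D = 1 by apply/coprime_TIg/(coprimegS sDS).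
have nDS : S \subset 'N(D) by rewrite normsI ?normG // norms_cent.
have nDx : x \in 'N(D) by rewrite -cycle_subG normsI // norms_cent ?cycle_subG.
have nDV : V \subset 'N(D) by rewrite cents_norm // centsC subsetIr.
have [D1|ntD] := eqVneq (D : {set gT}) 1.
  apply: order7_faithful_cent => // A prA nAx.
  have sAS := proper_sub prA; have sXA : <[x]> \subset 'N(A) by rewrite cycle_subG.
  have := IHn gT A V x (leq_trans (proper_card prA) leSn) (pgroupS sAS pS) ox nAx abV coV2.
  move/(_ (subset_trans sAS nVS) nVx cV1) => cA.
  by apply/trivgP; rewrite -D1 subsetI cA andbT (subset_trans _ sAS) // commg_subl.
have ltS : #|S / D| < n.
  by apply: leq_trans (ltn_quotient ntD sDS) _.
pose xb := coset D x.
have nXD : <[x]> \subset 'N(D) by rewrite cycle_subG.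
have oxb : #[xb] = 7.
  have dv : #[xb] %| 7 by rewrite -ox morph_order.
  apply/eqP; move/(dvdn_pfactor _ 1 (isT : prime 7)): dv => [[|[|//]] _ ] e; last by rewrite e.
  have /eqP xb1 : xb == 1 by rewrite -order_eq1 e.
  have Dx := coset_idr nDx xb1.
  have: 2.-elt x by apply: mem_p_elt pD Dx.
  by rewrite /p_elt ox.
have VD g : g \in V -> coset D g = 1 -> g = 1.
  move=> Vg /(coset_idr (subsetP nDV g Vg)) Dg; apply/set1P.
  by rewrite -[[set 1]]/(1%g : {set gT}) -VD1 inE Vg.
have cVb : 'C_(V / D)[xb] = 1.
  apply/trivgP/subsetP=> vb /setIP[/morphimP[v Nv Vv ->] /cent1P cvx]; apply/set1P.
  suff -> : v = 1 by rewrite morph1.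
  apply/set1P; rewrite -[[set 1]]/(1%g : {set gT}) -cV1 inE Vv; apply/cent1P/commgP/eqP.
  apply: VD; first by rewrite groupMl ?groupV ?memJ_norm.
  by rewrite morphR //; apply/eqP/commgP.
have := IHn _ (S / D)%G (V / D)%G xb ltS.
rewrite quotient_pgroup ?quotient_abelian ?quotient_norms //.
move/(_ isT oxb) => cb.
have {}cb : [~: S / D, <[xb]>] \subset 'C(V / D).
  apply: cb => //.
  - by apply: (subsetP (quotient_norms D nSX)); rewrite mem_quotient ?cycle_id.
  - exact: coprime_dvdl (dvdn_quotient _ _) coV2.
  apply: (subsetP (quotient_norms (A := <[x]>) D _)); first by rewrite cycle_subG.
  by rewrite mem_quotient ?cycle_id.
rewrite -quotient_cycle // -quotientR // in cb.
apply/centsP=> g Rg v Vv; apply/commgP/eqP.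
have Sg : g \in S by apply: subsetP Rg; rewrite commg_subl.
apply: VD; first by rewrite commgEr groupMr ?memJ_norm ?groupV // (subsetP nVS).
have /commgP/eqP cgv : commute (coset D g) (coset D v).
  by apply: (centsP cb); apply: mem_quotient.
by rewrite morphR ?(subsetP nDS g Sg) ?(subsetP nDV v Vv).
Qed.

End Order7.

(** * The group SL(2,8) *)

Section Field8.
Variable F : finFieldType.
Hypothesis cardF : #|F| = 8.
Local Open Scope ring_scope.
Implicit Types a : F.

Lemma addff a : a + a = 0.
Proof.
have e8 : (2%:R ^+ 3 = 0 :> F).
  rewrite -natrX -[(2 ^ 3)%N]cardF.
  have := expg_cardG (in_setT (1 : F)).
  by rewrite cardsT FinRing.Theory.zmodXgE.
have /eqP := e8; rewrite expf_eq0 /= => /eqP e2.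
by rewrite -mulr2n -mulr_natr e2 mulr0.
Qed.

Lemma oppff a : - a = a.
Proof. by apply/eqP; rewrite eq_sym -subr_eq0 opprK addff. Qed.

Lemma expf8 a : a ^+ 8 = a.
Proof. by rewrite -cardF expf_card. Qed.

Lemma expf7 a : a != 0 -> a ^+ 7 = 1.
Proof. by move=> nza; apply: (mulfI nza); rewrite mulr1 -exprS expf8. Qed.

End Field8.

Lemma no_order_of_exponents (gT : finGroupType) (T : {set gT}) n :
    (forall g, g \in T -> [\/ g ^+ 2 = 1, g ^+ 7 = 1 | g ^+ 9 = 1]) ->
  n \in [:: 6; 14; 21] -> ~~ has_order T n.
Proof.
move=> ex n_in; apply/negP=> /has_orderP[g /ex Tg og]; move: n_in.
by case: Tg => /eqP; rewrite -order_dvdn og !inE => dv /or3P[]/eqP e; rewrite e in dv.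
Qed.

Lemma order7_of_expg (gT : finGroupType) (y : gT) : y ^+ 7 = 1 -> y != 1 -> #[y] = 7.
Proof.
move=> y7 nty; have d7 : #[y] %| 7 by rewrite order_dvdn y7.
by move: nty; rewrite -order_eq1; have /primeP[_ /(_ _ d7)/orP[]/eqP->] : prime 7 by [].
Qed.

Section Transvections.
Variable F : finFieldType.
Hypothesis cardF : #|F| = 8.

(* A normal subgroup of even order contains a transvection, hence all of them; on one of odd
   order the group of transvections, elementary abelian of rank 3, would act freely. *)
Lemma simple_of_transvections (gT : finGroupType) (T : {group gT})
    (upper lower torus : F -> gT) (weyl : gT) : #|T| = 504 ->
    (forall n, n \in [:: 6; 14; 21] -> ~~ has_order T n) ->
    (forall a b, upper a * upper b = upper (a + b)%R) -> injective upper ->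
    (forall a, upper a \in T) -> weyl \in T -> (forall a, upper a ^ weyl = lower a) ->
    (forall a, (a != 0)%R -> torus a \in T) ->
    (forall a b, (a != 0)%R -> upper b ^ torus a = upper (b * a^-1 ^+ 2)%R) ->
    (forall N : {group gT}, (forall a, upper a \in N) -> (forall a, lower a \in N) -> T \subset N) ->
  simple T.
Proof.
move=> cardT no upperM upper_inj Tu Tw upper_weyl Tt upper_torus gen.
have upper0 : upper 0%R = 1 by apply: (mulgI (upper 0%R)); rewrite upperM addr0 mulg1.
pose U := upper @: F.
have gU : group_set U.
  apply/group_setP; split; first by rewrite -upper0 imset_f.
  by move=> _ _ /imsetP[a _ ->] /imsetP[b _ ->]; rewrite upperM imset_f.
have cardU : #|U| = 8 by rewrite card_imset.
have sUT : U \subset T by apply/subsetP=> _ /imsetP[a _ ->].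
apply/simpleP; split=> [|N nsN].
  by apply/eqP => T1; have := cardT; rewrite T1 cards1.
have [sNT nNT] := andP nsN.
have sylU : 2.-Sylow(T) (Group gU) by rewrite pHallE sUT /= cardU cardT p_part.
have [even|odd] := boolP (2 %| #|N|).
  right; have [x Nx ox] := Cauchy (isT : prime 2) even.
  have pX : 2.-group <[x]> by rewrite /pgroup -orderE ox.
  have sXT : <[x]> \subset T by rewrite cycle_subG (subsetP sNT).
  have [g Tg] := Sylow_subJ sylU sXT pX.
  rewrite cycle_subG => Ux.
  have {Ux} : x ^ g^-1 \in U by rewrite -mem_conjg.
  have Nxg : x ^ g^-1 \in N by rewrite memJ_norm // (subsetP nNT) // groupV.
  case/imsetP=> a _ ea; rewrite ea in Nxg.
  have nza : (a != 0)%R.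
    apply: contra_eqN ox => /eqP a0; move/eqP: ea; rewrite a0 upper0 conjg_eq1 => /eqP->.
    by rewrite order1.
  have NU b : upper b \in N.
    have [->|nzb] := eqVneq b 0%R; first by rewrite upper0 group1.
    (* As t^8 = t in F, the fourth power is a square root: z^2 = a / b, so [torus z] conjugates
       [upper a] to [upper b]. *)
    pose z := ((a / b) ^+ 4)%R.
    have nzz : (z != 0)%R by rewrite expf_neq0 // mulf_neq0 // invr_eq0.
    have z2 : (z ^+ 2 = a / b)%R by rewrite -exprM (expf8 cardF).
    have : upper a ^ torus z \in N by rewrite memJ_norm // (subsetP nNT) // Tt.
    by rewrite upper_torus // exprVn z2 invfM invrK mulrA mulfV // mul1r.
  apply/eqP; rewrite eqEsubset sNT gen // => b.
  by rewrite -upper_weyl memJ_norm // (subsetP nNT).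
left; apply/eqP/negPn/negP=> ntN.
pose q := pdiv #|N|; have pr_q : prime q by rewrite pdiv_prime // cardG_gt1.
have q2 : q != 2 by apply: contraNneq odd => <-; apply: pdiv_dvd.
have nNU : Group gU \subset 'N(N) := subset_trans sUT nNT.
have pU : 2.-group (Group gU) by rewrite /pgroup /= cardU.
have coNU : coprime #|N| #|Group gU|.
  by rewrite /= cardU (@coprime_pexpr 3 _ 2) // coprime_sym prime_coprime.
(* U normalises a Sylow q-subgroup P of the odd-order group N, and q is 3 or 7. In the absence of
   elements of order 2q, U acts freely on the centre of P, which forces rank at most 1 instead of
   3. *)
have [P sylP nPU] := sol_coprime_Sylow_exists q (pgroup_sol pU) nNU coNU.
have [sPN qP _] := and3P sylP.
have ntP : P :!=: 1.
  rewrite -cardG_gt1 (card_Hall sylP) p_part_gt1 mem_primes pr_q cardG_gt0.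
  exact: pdiv_dvd.
have rU : 'r_2(Group gU) = 3.
  have abU : 2.-abelem (Group gU).
    apply/(abelemP (isT : prime 2)); split.
      apply/centsP=> _ /imsetP[a _ ->] _ /imsetP[b _ ->].
      by rewrite /commute !upperM addrC.
    by move=> _ /imsetP[a _ ->]; rewrite expg2 upperM addff.
  by rewrite (p_rank_abelem abU) /= cardU.
have no2q : ~~ has_order ('Z(P) <*> Group gU) (q * 2).
  have sST : 'Z(P) <*> Group gU \subset T.
    by rewrite join_subG sUT (subset_trans (center_sub P)) // (subset_trans sPN).
  apply: contra (no (q * 2)%N _); first exact: has_orderS.
  have : q %| 504 by rewrite -cardT (dvdn_trans (pdiv_dvd _)) // cardSg.
  move: q2; move: (q) pr_q => q' pr_q' q2 dv.
  have : q' \in primes 504 by rewrite mem_primes pr_q'.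
  by rewrite !inE => /or3P[]/eqP e; rewrite e ?inE // in q2 *.
have := @free_rank1 _ 'Z(P)%G (Group gU) q 2 (center_abelian P) (pgroupS (center_sub P) qP).
rewrite rU; case/(_ _ _ pr_q isT q2 no2q)/negP => //.
  by apply: contraNneq ntP => /(trivg_center_pgroup qP)->.
exact: gFnorm_trans.
Qed.

End Transvections.

Section SL28.
Variable F : finFieldType.
Hypothesis cardF : #|F| = 8.
Local Open Scope ring_scope.
Local Notation gT := {'GL_2[F]}.
Implicit Types (a b c d : F).

Let addff := addff cardF.
Let oppff := oppff cardF.
Let expf8 := expf8 cardF.
Let expf7 := expf7 cardF.

Definition mx2 a b c d : 'M[F]_2 :=
  \matrix_(i, j) (if i == 0 then if j == 0 then a else b else if j == 0 then c else d).

Lemma mx2E (A : 'M[F]_2) : A = mx2 (A 0 0) (A 0 1) (A 1 0) (A 1 1).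
Proof.
apply/matrixP=> i j; rewrite mxE.
by case: i => [[|[|//]] Hi]; case: j => [[|[|//]] Hj] /=; congr (A _ _); apply: val_inj.
Qed.

Lemma mx2M a b c d a' b' c' d' : mx2 a b c d *m mx2 a' b' c' d' =
  mx2 (a * a' + b * c') (a * b' + b * d') (c * a' + d * c') (c * b' + d * d').
Proof.
apply/matrixP=> i j; rewrite !mxE !big_ord_recl big_ord0 !mxE /= addr0.
by case: i => [[|[|//]] Hi]; case: j => [[|[|//]] Hj].
Qed.

Lemma mx2_det a b c d : \det (mx2 a b c d) = a * d - b * c.
Proof.
rewrite (expand_det_row _ ord0) !big_ord_recl big_ord0 /cofactor !det_mx11 !mxE /=.
by rewrite expr0 expr1 mul1r mulN1r mulrN addr0.
Qed.

Lemma mx2_inj a b c d a' b' c' d' : mx2 a b c d = mx2 a' b' c' d' ->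
  [/\ a = a', b = b', c = c' & d = d'].
Proof.
move/matrixP=> e; have e00 := e 0 0; have e01 := e 0 1; have e10 := e 1 0; have e11 := e 1 1.
by rewrite !mxE /= in e00 e01 e10 e11.
Qed.

Lemma mx2_1 : mx2 1 0 0 1 = 1%:M.
Proof.
apply/matrixP=> i j; rewrite !mxE.
by case: i => [[|[|//]] Hi]; case: j => [[|[|//]] Hj].
Qed.

(** Total in its entries: the value is 1 when the matrix is not invertible, so the matrix laws below
    assume [det1], where the sign is a plus because the characteristic is 2. *)
Definition sl a b c d : gT := odflt (1%g : gT) (insub (mx2 a b c d)).

Definition det1 a b c d := a * d + b * c = 1.

Lemma slE a b c d : det1 a b c d -> GLval (sl a b c d) = mx2 a b c d.
Proof.
move=> dt; rewrite /sl; case: insubP => [u _ <- //|]; case/negP.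
by rewrite -[_ \is a _]/(_ \in unitmx) unitmxE mx2_det oppff dt unitr1.
Qed.

Lemma mem_sl a b c d : det1 a b c d -> sl a b c d \in SL 2 F.
Proof. by move=> dt; rewrite inE slE // mx2_det oppff dt. Qed.

Lemma slP g : reflect (exists a b c d, det1 a b c d /\ g = sl a b c d) (g \in SL 2 F).
Proof.
apply: (iffP idP) => [|[a [b [c [d [dt ->]]]]]]; last exact: mem_sl.
rewrite inE (mx2E (GLval g)) mx2_det => /eqP.
set a := GLval g 0 0; set b := GLval g 0 1; set c := GLval g 1 0; set d := GLval g 1 1.
rewrite oppff => dt; exists a, b, c, d; split=> //.
by apply: val_inj; rewrite -[LHS]/(GLval g) -[RHS]/(GLval _) slE // [LHS]mx2E.
Qed.

Lemma det1M a b c d a' b' c' d' : det1 a b c d -> det1 a' b' c' d' ->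
  det1 (a * a' + b * c') (a * b' + b * d') (c * a' + d * c') (c * b' + d * d').
Proof.
move=> dt dt'; have : \det (mx2 a b c d *m mx2 a' b' c' d') = 1.
  by rewrite det_mulmx !mx2_det oppff dt oppff dt' mulr1.
by rewrite mx2M mx2_det oppff.
Qed.

Lemma slM a b c d a' b' c' d' : det1 a b c d -> det1 a' b' c' d' ->
  (sl a b c d * sl a' b' c' d')%g =
  sl (a * a' + b * c') (a * b' + b * d') (c * a' + d * c') (c * b' + d * d').
Proof.
move=> dt dt'; apply: val_inj; rewrite -[LHS]/(GLval _) -[RHS]/(GLval _) GL_MxE.
by rewrite (slE dt) (slE dt') mx2M slE //; apply: det1M.
Qed.

Lemma sl_inj a b c d a' b' c' d' : det1 a b c d -> det1 a' b' c' d' ->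
  sl a b c d = sl a' b' c' d' -> [/\ a = a', b = b', c = c' & d = d'].
Proof. by move=> dt dt' /(congr1 (@GLval 2 F)); rewrite !slE // => /mx2_inj. Qed.

Lemma sl1 : sl 1 0 0 1 = 1%g.
Proof.
apply: val_inj; rewrite -[LHS]/(GLval _) -[RHS]/(GLval _) GL_1E slE ?mx2_1 //.
by rewrite /det1 mulr1 mulr0 addr0.
Qed.

Lemma sl_eq1 a b c d : det1 a b c d -> sl a b c d = 1%g -> [/\ a = 1, b = 0, c = 0 & d = 1].
Proof.
by move=> dt; rewrite -sl1; apply: sl_inj => //; rewrite /det1 mulr1 mulr0 addr0.
Qed.

(* In characteristic 2 with trace t, A ^ 2 = t A + 1, hence A ^ 8 = t ^ 7 A + k where
   k = t ^ 6 + t ^ 4 + 1 satisfies k ^ 2 = k t when t ^ 7 = 1. *)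
Lemma sl_order g : g \in SL 2 F -> [\/ g ^+ 2 = 1, g ^+ 7 = 1 | g ^+ 9 = 1]%g.
Proof.
case/slP=> a [b [c [d [dt eg]]]].
pose A : 'M[F]_2 := mx2 a b c d; have [t et] : exists t, t = a + d by exists (a + d).
have dbl (X : 'M[F]_2) : X + X = 0 by rewrite -{1 2}(scale1r X) -scalerDl addff scale0r.
have A2 : A * A = t *: A + 1.
  rewrite -[A * A]/(A *m A) mx2M [RHS]mx2E !mxE /= et !mulrDl !mulr0n !addr0 !mulr1n.
  rewrite -(dt : _ = 1); congr mx2.
  - by rewrite [d * a]mulrC addrA -(addrA (a * a)) addff addr0.
  - by rewrite [b * d]mulrC.
  - by rewrite [c * a]mulrC.
  - by rewrite [c * b]mulrC [a * d + d * d]addrC addrA -(addrA (d * d)) addff addr0 addrC.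
pose lin p q := p *: A + q *: (1 : 'M[F]_2).
have linM p q : lin p q ^+ 2 = lin (p ^+ 2 * t) (p ^+ 2 + q ^+ 2).
  rewrite expr2 /lin mulrDl !mulrDr -!scalerAl -!scalerAr mulr1 mul1r.
  rewrite !scalerA (mulrC q p) -addrA (addrA ((p * q) *: A)) dbl add0r.
  by rewrite A2 mulr1 scalerDr scalerA -!expr2 scalerDl addrA.
have linA : lin 1 0 = A by rewrite /lin scale1r scale0r addr0.
have GX n : GLval (g ^+ n)%g = A ^+ n.
  elim: n => [|n IHn]; first by rewrite expg0 expr0 GL_1E.
  by rewrite expgS exprS GL_ME IHn eg slE.
have GI (x y : gT) : GLval x = GLval y -> x = y by move=> e; apply: val_inj.
have eA2 : A ^+ 2 = lin t 1 by rewrite -linA linM expr1n expr0n mul1r addr0.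
have eA4 : A ^+ 4 = lin (t ^+ 3) (t ^+ 2 + 1).
  by rewrite (exprM A 2 2) eA2 linM -exprSr expr1n.
have sqD x y : (x + y) ^+ 2 = x ^+ 2 + y ^+ 2 :> F.
  by rewrite sqrrD mulr2n addff addr0.
have eA8 : A ^+ 8 = lin (t ^+ 7) (t ^+ 6 + (t ^+ 4 + 1)).
  by rewrite (exprM A 4 2) eA4 linM -!exprM -exprSr sqD -exprM expr1n.
have [t0|nzt] := eqVneq t 0.
  by constructor 1; apply: GI; rewrite GX eA2 /lin t0 scale0r add0r scale1r.
set k := t ^+ 6 + (t ^+ 4 + 1) in eA8.
have t7 := expf7 nzt; have t8 := expf8 t.
have kk : k * (k + t) = 0.
  rewrite mulrDr -expr2 !sqD -!exprM expr1n -[(6 * 2)%N]/(7 + 5)%N exprD t7 mul1r.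
  rewrite -[(4 * 2)%N]/8%N t8 !mulrDl mul1r -!exprSr t7.
  by rewrite (addrA (t ^+ 5)) (addrC 1) addff.
(* Now A^8 = A + k. For k = 0 this gives A^7 = 1; for k = t it gives A^9 = A^2 + t A = 1. *)
move: kk eA8 => /eqP; rewrite mulf_eq0 t7 /lin scale1r => /orP[/eqP->|kt] eA8.
  rewrite scale0r addr0 in eA8.
  by constructor 2; apply: (mulgI g); rewrite mulg1 -expgS; apply: GI; rewrite GX eA8 eg slE.
constructor 3; apply: GI; rewrite GX exprS eA8.
have -> : k = t by apply/eqP; rewrite -subr_eq0 oppff.
by rewrite mulrDr A2 -scalerAr mulr1 addrAC dbl add0r GL_1E.
Qed.

Lemma card_SL28 : #|SL 2 F| = 504.
Proof.
(* Matrices with c nonzero are determined by a, c, d, which accounts for 8 * 7 * 8 of them; those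
   with c = 0 by a nonzero a and any b, which adds 7 * 8. *)
pose f (x : F * F * F) := sl x.1.1 ((x.1.1 * x.2 + 1) / x.1.2) x.1.2 x.2.
pose h (x : F * F) := sl x.1 x.2 0 x.1^-1.
pose A := setX (setX [set: F] [set~ (0 : F)]) [set: F].
pose B := setX [set~ (0 : F)] [set: F].
have dtf x : x \in A -> det1 x.1.1 ((x.1.1 * x.2 + 1) / x.1.2) x.1.2 x.2.
  case: x => [[a c] d]; rewrite !inE /= andbT => nzc.
  by rewrite /det1 divfK // addrA addff add0r.
have dth x : x \in B -> det1 x.1 x.2 0 x.1^-1.
  case: x => a b; rewrite !inE /= andbT => nza.
  by rewrite /det1 mulr0 addr0 mulfV.
have injf : {in A &, injective f}.
  move=> [[a c] d] [[a' c'] d'] Ax Ax' /(sl_inj (dtf _ Ax) (dtf _ Ax'))[/= -> _ -> ->].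
  by [].
have injh : {in B &, injective h}.
  by move=> [a b] [a' b'] Ax Ax' /(sl_inj (dth _ Ax) (dth _ Ax'))[/= -> ->].
have -> : SL 2 F = f @: A :|: h @: B.
  apply/setP=> g; rewrite in_setU; apply/slP/orP=> [[a [b [c [d [dt ->]]]]]|].
    have [c0|nzc] := eqVneq c 0.
      right; have ad : a * d = 1 by rewrite -[RHS]dt c0 mulr0 addr0.
      have nza : a != 0 by apply: contraTneq (oner_neq0 F) => a0; rewrite -ad a0 mul0r eqxx.
      apply/imsetP; exists (a, b); first by rewrite !inE /= nza.
      by rewrite /h /= c0; congr (sl _ _ _ _); apply: (mulfI nza); rewrite ad mulfV.
    left; apply/imsetP; exists (a, c, d); first by rewrite !inE /= nzc.
    by rewrite /f /=; congr (sl _ _ _ _); apply: (mulIf nzc); rewrite divfK // -dt addrA addff add0r.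
  case=> /imsetP[x Ax ->]; first by exists x.1.1, ((x.1.1 * x.2 + 1) / x.1.2), x.1.2, x.2; split=> //; apply: dtf.
  by exists x.1, x.2, 0, x.1^-1; split=> //; apply: dth.
have dis : [disjoint f @: A & h @: B].
  apply/pred0P=> g; apply/negbTE/negP=> /andP[/imsetP[x Ax ->] /imsetP[y By]].
  case/(sl_inj (dtf _ Ax) (dth _ By)) => _ _ e _; move: Ax; case: x e => [[a c] d] /= ->.
  by rewrite !inE /= eqxx.
rewrite cardsU disjoint_setI0 // cards0 subn0 !card_in_imset // !cardsX !cardsT !cardsC1.
by rewrite cardF.
Qed.

Definition upper a := sl 1 a 0 1.
Definition lower a := sl 1 0 a 1.

Lemma det1_upper a : det1 1 a 0 1. Proof. by rewrite /det1 mulr1 mulr0 addr0. Qed.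
Lemma det1_lower a : det1 1 0 a 1. Proof. by rewrite /det1 mulr1 mul0r addr0. Qed.
Hint Resolve det1_upper det1_lower : core.

Lemma upperM a b : (upper a * upper b)%g = upper (a + b).
Proof. by rewrite slM // !mulr1 !mul1r !mulr0 !mul0r !addr0 add0r addrC. Qed.

Lemma lowerM a b : (lower a * lower b)%g = lower (a + b).
Proof. by rewrite slM // !mulr1 !mul1r !mulr0 !mul0r !addr0 !add0r. Qed.

Lemma upper0 : upper 0 = 1%g. Proof. exact: sl1. Qed.
Lemma lower0 : lower 0 = 1%g. Proof. exact: sl1. Qed.

Lemma upper_inj : injective upper. Proof. by move=> a b /sl_inj[]. Qed.
Lemma lower_inj : injective lower. Proof. by move=> a b /sl_inj[]. Qed.

Definition U28 := [set upper a | a in F].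
Definition L28 := [set lower a | a in F].

Lemma U28_group_set : group_set U28.
Proof.
apply/group_setP; split; first by rewrite -upper0 imset_f.
by move=> _ _ /imsetP[a _ ->] /imsetP[b _ ->]; rewrite upperM imset_f.
Qed.

Lemma L28_group_set : group_set L28.
Proof.
apply/group_setP; split; first by rewrite -lower0 imset_f.
by move=> _ _ /imsetP[a _ ->] /imsetP[b _ ->]; rewrite lowerM imset_f.
Qed.

Canonical U28_group := Group U28_group_set.
Canonical L28_group := Group L28_group_set.

Lemma card_U28 : #|U28| = 8. Proof. by rewrite card_imset ?cardF //; apply: upper_inj. Qed.
Lemma card_L28 : #|L28| = 8. Proof. by rewrite card_imset ?cardF //; apply: lower_inj. Qed.

Lemma U28_sub : U28 \subset SL 2 F.
Proof. by apply/subsetP=> _ /imsetP[a _ ->]; apply: mem_sl. Qed.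
Lemma L28_sub : L28 \subset SL 2 F.
Proof. by apply/subsetP=> _ /imsetP[a _ ->]; apply: mem_sl. Qed.

Lemma U28_invol g : g \in U28 -> (g ^+ 2 = 1)%g.
Proof. by case/imsetP=> a _ ->; rewrite expg2 upperM addff upper0. Qed.
Lemma L28_invol g : g \in L28 -> (g ^+ 2 = 1)%g.
Proof. by case/imsetP=> a _ ->; rewrite expg2 lowerM addff lower0. Qed.

(** The entry is inverted because [upper a * lower b] has trace a b, and trace 1 means A^2 = A + 1,
    hence A^3 = 1. *)
Definition swap_inv (g : gT) := lower ((GLval g 0 1)^-1).

Lemma swap_upper a : swap_inv (upper a) = lower a^-1.
Proof. by rewrite /swap_inv slE // mxE. Qed.

(** For i the inverse of a, the product [lower i * upper a * lower i] is antidiagonal: a Weyl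
    element, which interchanges the two unipotent subgroups. *)
Lemma swap_facts g : g \in U28 -> g != 1%g ->
  [/\ swap_inv g \in L28, swap_inv g != 1%g, (g * swap_inv g) ^+ 3 = 1, g * swap_inv g != 1
    & L28 :^ (swap_inv g * g * swap_inv g) = U28]%g.
Proof.
case/imsetP=> a _ -> nt1; have nza : a != 0 by apply: contraNneq nt1 => ->; rewrite upper0.
rewrite swap_upper; have ai := mulfV nza; have ia := mulVf nza; move: a^-1 ai ia => i ai ia.
pose simp := (mulr0, mul0r, mulr1, mul1r, addr0, add0r, ai, ia, addff).
have eX : (upper a * lower i)%g = sl 0 a i 1 by rewrite /upper /lower slM // !simp.
have dX : det1 0 a i 1 by rewrite /det1 !simp.
have eW : (lower i * upper a * lower i)%g = sl 0 a i 0.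
  by rewrite -mulgA eX /lower slM // !simp.
have dW : det1 0 a i 0 by rewrite /det1 !simp.
have W2 : (sl 0 a i 0 * sl 0 a i 0 = 1)%g by rewrite (slM dW dW) !simp sl1.
have WV : ((sl 0 a i 0)^-1 = sl 0 a i 0)%g by apply: (mulgI (sl 0 a i 0)); rewrite mulgV W2.
have dX2 : det1 1 a i 0 by rewrite /det1 !simp.
split.
- exact: imset_f.
- rewrite -lower0 (inj_eq lower_inj); apply: contraTneq (oner_neq0 F) => i0.
  by rewrite -ai i0 mulr0 eqxx.
- by rewrite eX (expgS _ 2) expg2 (slM dX dX) !simp (slM dX dX2) !simp sl1.
- by rewrite eX; apply/eqP => /(sl_eq1 dX)[/esym/eqP]; rewrite oner_eq0.
rewrite eW; apply/eqP; rewrite eqEcard cardJg card_U28 card_L28 leqnn andbT.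
apply/subsetP=> _ /imsetP[_ /imsetP[c _ ->] ->]; apply/imsetP; exists (a * (c * a)) => //.
have dWc : det1 0 a i (c * a) by rewrite /det1 !simp.
by rewrite conjgE WV (slM (det1_lower c) dW) !simp (slM dW dWc) !simp.
Qed.


Definition torus a := sl a 0 0 a^-1.
Definition weyl := sl 0 1 1 0.

Lemma det1_torus a : a != 0 -> det1 a 0 0 a^-1.
Proof. by move=> nza; rewrite /det1 mulfV // mulr0 addr0. Qed.

Lemma det1_weyl : det1 0 1 1 0.
Proof. by rewrite /det1 mulr1 mulr0 add0r. Qed.

Lemma torusM a b : a != 0 -> b != 0 -> (torus a * torus b)%g = torus (a * b).
Proof.
move=> nza nzb; rewrite /torus (slM (det1_torus nza) (det1_torus nzb)).
by rewrite !mulr0 !mul0r !addr0 !add0r invfM.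
Qed.

Lemma torusV a : a != 0 -> (torus a)^-1%g = torus a^-1.
Proof.
move=> nza; apply: (mulgI (torus a)); rewrite mulgV torusM ?invr_eq0 // mulfV //.
by rewrite /torus invr1 sl1.
Qed.

Lemma upper_torus a b : a != 0 -> (upper b ^ torus a)%g = upper (b * a^-1 ^+ 2).
Proof.
move=> nza; have dt := det1_torus nza; have := det1_torus (a := a^-1); rewrite invr_eq0 => /(_ nza).
rewrite conjgE torusV // /torus invrK => dti.
have ai := mulfV nza; have ia := mulVf nza; move: (a^-1) ai ia dt dti => i ai ia dt dti.
pose simp := (mulr0, mul0r, mulr1, mul1r, addr0, add0r, ai, ia, addff).
have d2 : det1 a (b * i) 0 i by rewrite /det1 !simp.
by rewrite /upper (slM (det1_upper b) dt) !simp (slM dti d2) !simp mulrCA.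
Qed.

Lemma weylV : (weyl^-1 = weyl)%g.
Proof.
apply: (mulgI weyl); rewrite mulgV (slM det1_weyl det1_weyl).
by rewrite !mulr0 !mulr1 !addr0 !add0r sl1.
Qed.

Lemma torus_weyl a : a != 0 -> (torus a ^ weyl = (torus a)^-1)%g.
Proof.
move=> nza; have dt := det1_torus nza; rewrite torusV // conjgE weylV /torus invrK.
move: (a^-1) dt => i dt; have ai : a * i = 1 by rewrite -[RHS]dt mulr0 addr0.
pose simp := (mulr0, mul0r, mulr1, mul1r, addr0, add0r).
have d2 : det1 0 a i 0 by rewrite /det1 !simp.
by rewrite (slM dt det1_weyl) !simp (slM det1_weyl d2) !simp.
Qed.

Lemma upper_weyl a : (upper a ^ weyl = lower a)%g.
Proof.
rewrite conjgE weylV (slM (det1_upper a) det1_weyl).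
pose simp := (mulr0, mul0r, mulr1, mul1r, addr0, add0r).
have d2 : det1 a 1 1 0 by rewrite /det1 !simp.
by rewrite !simp (slM det1_weyl d2) !simp.
Qed.

Lemma torus_order7 : exists2 y, y \in SL 2 F &
  [/\ #[y] = 7, y \in 'N(U28) & (y ^ weyl = y^-1)%g].
Proof.
have [a nza nea] : exists2 a : F, a != 0 & a != 1.
  pose A := [set~ (0%R : F)] :\ 1%R; have : (0 < #|A|)%N.
    by have := cardsD1 1%R [set~ (0%R : F)]; rewrite cardsC1 cardF !inE oner_neq0 -/A; case: #|A|.
  by case/card_gt0P=> a; rewrite !inE => /andP[n1 n0]; exists a.
have tX n : (torus a ^+ n)%g = torus (a ^+ n).
  elim: n => [|n IHn]; first by rewrite expg0 expr0 /torus invr1 sl1.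
  by rewrite expgS exprS IHn torusM // expf_neq0.
exists (torus a); first by apply: mem_sl; apply: det1_torus.
split; last by apply: torus_weyl.
  apply: order7_of_expg; first by rewrite tX expf7 // /torus invr1 sl1.
  by apply/eqP=> /(sl_eq1 (det1_torus nza))[/eqP]; rewrite (negbTE nea).
rewrite inE; apply/subsetP=> _ /imsetP[_ /imsetP[b _ ->] ->].
by rewrite upper_torus // imset_f.
Qed.

Lemma SL28_no_order n : n \in [:: 6; 14; 21] -> ~~ has_order (SL 2 F) n.
Proof. exact: no_order_of_exponents sl_order. Qed.

(** A matrix with c nonzero is a product upper-lower-upper with entries (a + 1) / c, c and (d + 1) /
    c. One with c = 0 is first multiplied by [lower 1], which puts d in the place of c. *)
Lemma SL28_gen (N : {group gT}) :
  (forall a, upper a \in N) -> (forall a, lower a \in N) -> SL 2 F \subset N.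
Proof.
move=> NU NL; apply/subsetP=> g' /slP[a' [b [c [d [dt ->]]]]].
have main a1 b1 c1 d1 : c1 != 0 -> det1 a1 b1 c1 d1 -> sl a1 b1 c1 d1 \in N.
  move=> nzc dt1; pose p := (a1 + 1) / c1; pose q := (d1 + 1) / c1.
  have cp : c1 * p = a1 + 1 by rewrite mulrC divfK.
  have cq : c1 * q = d1 + 1 by rewrite mulrC divfK.
  have d2 : det1 1 q c1 (c1 * q + 1).
    by rewrite /det1 mul1r [q * _]mulrC addrAC addff add0r.
  have -> : sl a1 b1 c1 d1 = (upper p * (lower c1 * upper q))%g.
    pose simp := (mulr0, mul0r, mulr1, mul1r, addr0, add0r).
    rewrite (slM (det1_lower c1) (det1_upper q)) !simp.
    rewrite (slM (det1_upper p) d2) !simp [p * c1]mulrC cp.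
    rewrite addrCA addff addr0 cq -addrA addff addr0; congr (sl _ _ _ _).
    apply: (mulfI nzc); rewrite mulrDr cq mulrA cp mulrDl mul1r.
    have bc : c1 * b1 = a1 * d1 + 1.
      by rewrite -dt1 addrA addff add0r mulrC.
    by rewrite bc [d1 + 1]addrC [a1 * d1 + d1]addrC addrA -(addrA 1) addff addr0 addrC.
  exact: groupM (NU p) (groupM (NL c1) (NU q)).
have [c0|nzc] := eqVneq c 0; last exact: main.
have ad : a' * d = 1 by rewrite -[RHS]dt c0 mulr0 addr0.
have nzd : d != 0 by apply: contraTneq (oner_neq0 F) => d0; rewrite -ad d0 mulr0 eqxx.
rewrite -(groupMr _ (NL 1)) c0 slM //; last by rewrite /det1 mulr0 addr0.
rewrite !(mulr0, mul0r, mulr1, mul1r, addr0, add0r); apply: main => //.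
by rewrite /det1 mulrDl ad -addrA addff addr0.
Qed.

Lemma simple_SL28 : simple (SL 2 F).
Proof.
apply: (@simple_of_transvections F cardF _ _ upper lower torus weyl card_SL28).
- exact: SL28_no_order.
- exact: upperM.
- exact: upper_inj.
- by move=> a; apply: mem_sl.
- exact: mem_sl det1_weyl.
- exact: upper_weyl.
- by move=> a nza; apply: mem_sl; apply: det1_torus.
- exact: upper_torus.
exact: SL28_gen.
Qed.

End SL28.

(** A matrix-free description: U and L stand for the opposite unipotent subgroups, t for inversion
    of the entry, [t g * g * t g] for a Weyl element, y for a generator of the torus and w for an
    element inverting it. *)
Record PSL28_frame (gT : finGroupType) (T U L : {group gT}) (t : gT -> gT) (y w : gT) : Prop := {
  frame_sU : U \subset T;
  frame_sL : L \subset T;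
  frame_cardU : #|U| = 8;
  frame_cardL : #|L| = 8;
  frame_invU : {in U, forall g, g ^+ 2 = 1};
  frame_invL : {in L, forall g, g ^+ 2 = 1};
  frame_t : {in U^#, forall g, t g \in L^#};
  frame_t_inj : {in U^# &, injective t};
  frame_t3 : {in U^#, forall g, (g * t g) ^+ 3 = 1 /\ g * t g != 1};
  frame_tJ : {in U^#, forall g, L :^ (t g * g * t g) = U};
  frame_y : y \in T;
  frame_oy : #[y] = 7;
  frame_ny : y \in 'N(U);
  frame_w : w \in T;
  frame_yw : y ^ w = y^-1
}.

Lemma SL28_frame (F : finFieldType) : #|F| = 8 -> exists U L t y w,
  PSL28_frame (SL_group 2 F) U L t y w.
Proof.
move=> cardF; have [y Sy [oy ny yw]] := torus_order7 cardF.
exists (U28_group cardF), (L28_group cardF), (@swap_inv F), y, (weyl F).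
have nt g : g \in (U28 F)^# -> g \in U28 F /\ g != 1 by case/setD1P.
have facts g : g \in (U28 F)^# -> _ := fun Ug => swap_facts cardF (nt g Ug).1 (nt g Ug).2.
split.
- exact: U28_sub cardF.
- exact: L28_sub cardF.
- exact: card_U28 cardF.
- exact: card_L28 cardF.
- exact: U28_invol cardF.
- exact: L28_invol cardF.
- by move=> g /facts[Lt ntt _ _ _]; apply/setD1P.
- move=> g h /nt[/imsetP[a _ ->] _] /nt[/imsetP[b _ ->] _].
  by rewrite !swap_upper // => /lower_inj /invr_inj ->.
- by move=> g /facts[_ _ e3 n1 _].
- by move=> g /facts[_ _ _ _ eJ].
- exact: Sy.
- exact: oy.
- exact: ny.
- exact: mem_sl (det1_weyl F).
exact: yw.
Qed.

Lemma frame_morphim (aT rT : finGroupType) (D : {group aT}) (f : {morphism D >-> rT}) U L t y w :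
  'injm f -> PSL28_frame D U L t y w ->
  exists U' L' t' y' w', PSL28_frame (f @* D)%G U' L' t' y' w'.
Proof.
move=> injf [sU sL cU cL iU iL tL tinj t3 tJ Dy oy ny Dw yw].
pose t' g := f (t (invm injf g)).
exists (f @* U)%G, (f @* L)%G, t', (f y), (f w).
have U1 g : g \in (f @* U)^# -> exists2 h, h \in U^# & [/\ h \in D, t h \in D, g = f h & t' g = f (t h)].
  case/setD1P=> ntg /morphimP[h Dh Uh eg]; rewrite eg in ntg *.
  have Uh1 : h \in U^# by apply/setD1P; split=> //; apply: contraNneq ntg => ->; rewrite morph1.
  exists h => //; split=> //; last by rewrite /t' invmE.
  by rewrite (subsetP sL) //; case/setD1P: (tL h Uh1).
have f1 h : h \in D -> f h = 1 -> h = 1.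
  by move=> Dh e; apply: (injmP injf); rewrite ?group1 ?morph1.
split=> /=.
- exact: morphimS.
- exact: morphimS.
- by rewrite card_injm.
- by rewrite card_injm.
- by move=> _ /morphimP[g Dg Ug ->]; rewrite -morphX // iU // morph1.
- by move=> _ /morphimP[g Dg Lg ->]; rewrite -morphX // iL // morph1.
- move=> g /U1[h Uh [Dh Dt _ ->]]; have /setD1P[nt Lt] := tL h Uh.
  apply/setD1P; rewrite mem_morphim //; split=> //.
  by apply: contraNneq nt => /(f1 _ Dt)->.
- move=> g g' /U1[h Uh [Dh Dt -> ->]] /U1[h' Uh' [Dh' Dt' -> ->]].
  by move/(injmP injf) => e; congr (f _); apply: tinj => //; apply: e.
- move=> g /U1[h Uh [Dh Dt -> ->]]; have [e3 n1] := t3 h Uh.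
  rewrite -morphM // -morphX ?groupM // e3 morph1; split=> //.
  by apply: contraNneq n1 => /(f1 _ (groupM Dh Dt))->.
- move=> g /U1[h Uh [Dh Dt -> ->]].
  by rewrite -!morphM ?groupM // -morphimJ ?groupM // (tJ h Uh).
- exact: mem_morphim.
- by rewrite order_injm.
- rewrite inE -morphimJ //; apply: morphimS; rewrite (normP ny) //.
- exact: mem_morphim.
by rewrite -morphJ // yw morphV.
Qed.

(** SL(2,8) is simple of nonprime order, so its centre is trivial. *)
Lemma PSL28_isog_SL : SL_group 2 F8 \isog PSL 2 F8.
Proof.
have simS := simple_SL28 card_F8.
have Z1 : 'Z(SL 2 F8) = 1.
  have /simpleP[_ /(_ 'Z(SL_group 2 F8)%G (center_normal _))] := simS.
  case=> //= ZS; have abS : abelian (SL 2 F8) by rewrite -ZS center_abelian.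
  have := simple_sol_prime (abelian_sol abS) simS.
  by rewrite (card_SL28 card_F8).
apply: quotient_isog; first exact: gFnorm.
by rewrite /= Z1 setI1g.
Qed.

Lemma PSL28P (gT : finGroupType) (T : {group gT}) : T \isog PSL 2 F8 ->
  [/\ #|T| = 504, simple T, forall n, n \in [:: 6; 14; 21] -> ~~ has_order T n
    & exists U L t y w, PSL28_frame T U L t y w].
Proof.
move=> isoT; have isoS : SL_group 2 F8 \isog T.
  by apply: isog_trans PSL28_isog_SL _; rewrite isog_sym.
split.
- by rewrite -(card_isog isoS) (card_SL28 card_F8).
- by rewrite -(isog_simple isoS) simple_SL28 // card_F8.
- by move=> n n_in; rewrite -(has_order_isog n isoS) SL28_no_order // card_F8.
have [f injf fS] := isogP isoS; have [U [L [t [y [w fr]]]]] := SL28_frame card_F8.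
have := frame_morphim injf fr; suff -> : (f @* SL_group 2 F8)%G = T by [].
by apply: val_inj.
Qed.

(** * Elements of order 3 of PSL(2,8) in coprime modules *)

Section FrameModule.
Variables (gT : finGroupType) (T U L : {group gT}) (t : gT -> gT) (y w : gT).
Hypothesis fr : PSL28_frame T U L t y w.
Variables (W : finZmodType) (act : W -> gT -> W).
Hypothesis actD : forall g, {morph act^~ g : u v / (u + v)%R}.
Hypothesis act1 : forall u, act u 1 = u.
Hypothesis actM : {in T &, forall g h u, act u (g * h) = act (act u g) h}.
Hypothesis tors2 : forall u : W, (u *+ 2 = 0)%R -> (u = 0)%R.
Hypothesis tors3 : forall u : W, (u *+ 3 = 0)%R -> (u = 0)%R.
Hypothesis free3 : {in T, forall g, g ^+ 3 = 1 -> g != 1 -> forall u, act u g = u -> (u = 0)%R}.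

Let sU := subsetP (frame_sU fr).
Let sL := subsetP (frame_sL fr).

Let act0 g : act 0%R g = 0%R.
Proof. by apply: (addrI (act 0%R g)); rewrite -actD !addr0. Qed.

Let actN g u : act (- u)%R g = (- act u g)%R.
Proof. by apply: (addrI (act u g)); rewrite -actD !subrr act0. Qed.

Let act_sum g := big_morph (act^~ g) (actD g) (act0 g).

Let actMn g u n : act (u *+ n)%R g = (act u g *+ n)%R.
Proof. by elim: n => [|n IHn]; rewrite ?mulr0n ?act0 // !mulrS actD IHn. Qed.

Let order3_sum g u : g \in T -> g ^+ 3 = 1 -> g != 1 -> (u + act u g + act u (g ^+ 2) = 0)%R.
Proof.
move=> Tg g3 ntg; apply: (free3 Tg g3 ntg).
rewrite !actD -!actM ?groupX // -expgSr g3 act1 -expg2.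
by rewrite addrC addrA.
Qed.

Let nt_U g : g \in U^# -> [/\ g \in U, g \in T, t g \in T & t g \in L].
Proof.
move=> Ug; have /setD1P[_ Lt] := frame_t fr Ug; have /setD1P[_ Ug'] := Ug.
by split=> //; [apply: sU | apply: sL].
Qed.

Let tst_sub g u : g \in U^# -> {in L, forall l, act u l = u} ->
  {in U, forall h, act (act u (t g * g * t g)) h = act u (t g * g * t g)}.
Proof.
move=> Ug fixu h; have [_ Tg Tt Lt] := nt_U Ug.
rewrite -(frame_tJ fr Ug) => /imsetP[l Ll ->].
have TW : t g * g * t g \in T by rewrite !groupM.
move: TW; set W0 := t g * g * t g => TW.
have Tl := sL Ll; have TlW : l ^ W0 \in T by rewrite groupJ.
by rewrite -(actM TW TlW) -conjgC (actM Tl TW) fixu.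
Qed.

Let invol g : g \in U^# -> [/\ g * g = 1, t g * t g = 1, (g * t g)^-1 = t g * g & (g * t g) ^+ 2 = t g * g].
Proof.
move=> Ug; have [Ug' _ _ Lt] := nt_U Ug.
have g2 := frame_invU fr Ug'; have t2 := frame_invL fr Lt; rewrite !expg2 in g2 t2.
have eV : (g * t g)^-1 = t g * g.
  by apply: (mulgI (g * t g)); rewrite mulgV -mulgA (mulgA (t g)) t2 mul1g g2.
split=> //; have [e3 _] := frame_t3 fr Ug.
by rewrite -eV; apply: (mulgI (g * t g)); rewrite mulgV -expgS.
Qed.

Let braid g : g \in U^# -> g * t g * g = t g * g * t g.
Proof.
move=> Ug; have [g2 t2 eV e2] := invol Ug.
by apply: (mulIg (t g)); rewrite -(mulgA (t g * g)) t2 mulg1 -e2 expg2 !mulgA.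
Qed.

Let ntU_exists : exists g, g \in U^#.
Proof.
have /trivgPn[g Ug ntg] : U :!=: 1 by rewrite -cardG_gt1 (frame_cardU fr).
by exists g; apply/setD1P.
Qed.

Let sum_fix (H : {group gT}) u : H \subset T ->
  {in H, forall h, act (\sum_(g in H) act u g)%R h = (\sum_(g in H) act u g)%R}.
Proof.
move=> /subsetP sHT h Hh; rewrite act_sum [RHS](reindex_inj (mulIg h)) /=.
by apply: eq_big => [g|g Hg]; rewrite ?groupMr // actM ?sHT.
Qed.

(* For u fixed by L and s in U^#, the relation of the order 3 element t(s) s shows that u + u s
   is fixed by U; summing over s, so is 6 u. *)
Let fixL0 u : {in L, forall l, act u l = u} -> u = 0%R.
Proof.
move=> fixu.
(* As u is fixed by L, the relation for t(s) s reads u + u s + u s t(s) = 0, and u s t(s) is u moved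
   by the Weyl element t(s) s t(s), hence fixed by U. *)
have fixs s : s \in U^# -> {in U, forall h, act (u + act u s)%R h = (u + act u s)%R}.
  move=> Us h Uh; have [Us' Ts Tt Lt] := nt_U Us; have [s2 t2 eV e2] := invol Us.
  have [e3 n1] := frame_t3 fr Us.
  have T3 : t s * s \in T by rewrite groupM.
  have ts3 : (t s * s) ^+ 3 = 1 by rewrite -eV expgVn e3 invg1.
  have nts : t s * s != 1 by rewrite -eV eq_invg1.
  have := order3_sum u T3 ts3 nts; rewrite (actM Tt Ts) (fixu _ Lt).
  have -> : (t s * s) ^+ 2 = s * t s by rewrite -eV expgVn e2 -eV invgK.
  move/eqP; rewrite addr_eq0 => /eqP eu.
  have eu' : act u (s * t s) = act u (t s * s * t s).
    by rewrite -mulgA (actM Tt (groupM Ts Tt)) (fixu _ Lt).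
  by rewrite eu eu' actN (tst_sub Us fixu).
have fix6 : {in U, forall h, act (u *+ 6)%R h = (u *+ 6)%R}.
  (* The seven terms u + u s add up to 7 u plus the sum over all of U minus u, whence 6 u. *)
  move=> h Uh; have e : (u *+ 6 + \sum_(s in U) act u s = \sum_(s in U^#) (u + act u s))%R.
    rewrite big_split /= sumr_const (big_setD1 1) ?group1 //= act1 addrA -mulrSr.
    by have := cardsD1 1 U; rewrite group1 (frame_cardU fr) add1n => -[<-].
  have {}e : (u *+ 6 = \sum_(s in U^#) (u + act u s) - \sum_(s in U) act u s)%R by rewrite -e addrK.
  rewrite e actD actN sum_fix ?(frame_sU fr) //; congr (_ - _)%R.
  by rewrite act_sum; apply: eq_bigr => s Us; rewrite fixs.
have [s Us] := ntU_exists; have [Us' Ts Tt Lt] := nt_U Us; have [e3 n1] := frame_t3 fr Us.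
apply: tors2; apply: tors3; rewrite -mulrnA; apply: (free3 (groupM Ts Tt) e3 n1).
by rewrite actM // fix6 // actMn fixu.
Qed.

Let fixU0 u : {in U, forall h, act u h = u} -> u = 0%R.
Proof.
move=> fixu; have [s Us] := ntU_exists; have [Us' Ts Tt Lt] := nt_U Us.
have TW : t s * s * t s \in T by rewrite !groupM.
have e := frame_tJ fr Us; move: TW e; move: (t s * s * t s) => W0 TW e.
have : act u W0^-1 = 0%R.
  apply: fixL0 => l Ll; have Tl := sL Ll.
  have Ul : l ^ W0 \in U by rewrite -e memJ_conjg.
  rewrite -actM ?groupV // (_ : W0^-1 * l = l ^ W0 * W0^-1); last by rewrite conjgE !mulgA mulgK.
  by rewrite actM ?groupV ?(sU Ul) // fixu.
by move/(congr1 (act^~ W0)); rewrite act0 -actM ?groupV // mulVg act1.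
Qed.

(** Commuting involutions are diagonalised by an extremal choice: if v is no eigenvector of s, then
    v + v s is one, is nonzero, and keeps all the eigenrelations of v. *)
Let eigen_exists u : u != 0%R :> W ->
  exists2 v : W, v != 0%R & {in U, forall s, act v s = v \/ act v s = (- v)%R}.
Proof.
move=> ntu.
pose e v := [set s in U | (act v s == v) || (act v s == - v)%R].
case: (@arg_maxnP _ u (fun v => v != 0%R) (fun v => #|e v|) ntu) => v ntv maxv.
exists v => // s Us; suff: s \in e v by rewrite inE Us /= => /orP[]/eqP; [left | right].
apply: contraT => nes; pose v' := (v + act v s)%R.
have Ts := sU Us.
have comm h : h \in U -> act (act v s) h = act (act v h) s.
  move=> Uh; rewrite -!actM ?sU //; congr act.
  have inv2 x : x \in U -> x^-1 = x.
    by move=> Ux; apply: (mulgI x); rewrite mulgV -expg2 (frame_invU fr).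
  by rewrite -[s * h]invgK invMg !inv2 ?groupM.
have ntv' : v' != 0%R.
  apply: contraNneq nes => e0; rewrite inE Us /=; apply/orP; right.
  by rewrite -addr_eq0 addrC -/v' e0.
have : #|e v'| <= #|e v| := maxv v' ntv'.
rewrite leqNgt => /negP[]; apply: proper_card; apply/properP; split.
  apply/subsetP=> h; rewrite !inE => /andP[Uh]; rewrite Uh /= /v' actD comm //.
  by case/orP=> /eqP->; rewrite ?actN ?opprD eqxx ?orbT.
exists s => //; rewrite inE Us /= /v' actD -actM // -expg2 (frame_invU fr) // act1 addrC.
by rewrite eqxx.
Qed.

(* With v an eigenvector of U, of character chi, let s act on W through the scalar chi s and let
   sigma be the (unnormalised) projection on the chi-eigenspace; the relation of s t(s) gives
   sigma (v t(s)) = - 4 chi(s) v. As U and L have no fixed vector, summing over s gives 12 v = 0. *)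
Lemma frame_module_trivial (u : W) : u = 0%R.
Proof.
apply: contraTeq isT => ntu; exfalso.
have [v ntv ev] := eigen_exists ntu.
pose S s (z : W) := if act v s == v then z else (- z)%R.
have S0 s : S s 0%R = 0%R by rewrite /S oppr0 if_same.
have SD s : {morph S s : a b / (a + b)%R} by move=> a b; rewrite /S opprD; case: ifP.
have Ssum s := big_morph (S s) (SD s) (S0 s).
have SK s z : S s (S s z) = z by rewrite /S; case: (act v s == v); rewrite ?opprK.
have Sv s : s \in U -> act v s = S s v.
  by move=> /ev; rewrite /S; case: eqP => // nv [] //.
have Sact s g z : act (S s z) g = S s (act z g) by rewrite /S; case: ifP; rewrite ?actN.
have nv2 : (v == - v)%R = false.
  apply: contraNF ntv => /eqP e2; apply/eqP; apply: tors2.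
  by rewrite mulr2n {2}e2 subrr.
have SM s s' z : s \in U -> s' \in U -> S (s * s') z = S s (S s' z).
  move=> Us Us'; have : act v (s * s') = S s (S s' v).
    by rewrite actM ?sU // Sv // Sact (Sv s').
  have bM : (act v (s * s') == v) = ((act v s == v) == (act v s' == v)).
    have -> : act v (s * s') = S s (S s' v) by rewrite actM ?sU // (Sv s) // Sact (Sv s').
    rewrite /S; case: (act v s == v); case: (act v s' == v); rewrite ?opprK ?eqxx //.
      by rewrite eq_sym nv2.
    by rewrite eq_sym nv2.
  by rewrite /S bM; do 2!case: (_ == v); rewrite ?opprK.
pose sigma z := (\sum_(s in U) S s (act z s))%R.
have sigD : {morph sigma : a b / (a + b)%R}.
  by move=> a b; rewrite /sigma -big_split /=; apply: eq_bigr => s _; rewrite actD SD.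
have sig0 : sigma 0%R = 0%R by rewrite /sigma big1 // => s _; rewrite act0 S0.
have sig_sum := big_morph sigma sigD sig0.
have sigN z : sigma (- z)%R = (- sigma z)%R.
  by apply: (addrI (sigma z)); rewrite -sigD !subrr sig0.
have sigv : sigma v = (v *+ 8)%R.
  rewrite -(frame_cardU fr) -sumr_const; apply: eq_bigr => s Us.
  by rewrite (Sv s Us) SK.
have sigS s z : sigma (S s z) = S s (sigma z) by rewrite /S; case: ifP; rewrite ?sigN.
have sigJ s z : s \in U -> sigma (act z s) = S s (sigma z).
  move=> Us; rewrite [X in S s X](reindex_inj (mulgI s)) /= Ssum.
  rewrite (eq_bigl (fun g => g \in U)); last by move=> g; rewrite groupMl.
  by apply: eq_bigr => g Ug; rewrite SM // SK actM ?sU.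
(* Applying sigma to v + v s t(s) + v t(s) s = 0 gives 8 v + 2 chi(s) sigma(v t(s)) = 0, and the
   factor 2 is cancelled. *)
have rel s : s \in U^# -> (sigma (act v (t s)) = - S s v *+ 4)%R.
  move=> Us; have [Us' Ts Tt Lt] := nt_U Us; have [s2 t2 eV e2] := invol Us.
  have [e3 n1] := frame_t3 fr Us.
  have := order3_sum v (groupM Ts Tt) e3 n1; rewrite e2 (actM Ts Tt) (actM Tt Ts).
  move/(congr1 sigma); rewrite sig0 !sigD sigv (Sv s) // Sact sigS (sigJ s) // -addrA -mulr2n.
  rewrite -[8]/(4 * 2)%N mulrnA -mulrnDl => /tors2/eqP; rewrite addrC addr_eq0 => /eqP e.
  by rewrite -[LHS](SK s) e /S; case: (act v s == v); rewrite ?opprK ?mulNrn ?opprK.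
have zU : (\sum_(s in U^#) S s v = - v)%R.
  apply/eqP; rewrite -addr_eq0 addrC; apply/eqP.
  transitivity (\sum_(s in U) act v s)%R; last first.
    by apply: fixU0; apply: sum_fix; apply: frame_sU fr.
  rewrite [RHS](big_setD1 1) ?group1 //= act1; congr (_ + _)%R.
  by apply: eq_bigr => s /setD1P[_ Us]; rewrite Sv.
have zL : (\sum_(l in L^#) act v l = - v)%R.
  apply/eqP; rewrite -addr_eq0 addrC; apply/eqP.
  transitivity (\sum_(l in L) act v l)%R; last first.
    by apply: fixL0; apply: sum_fix; apply: frame_sL fr.
  by rewrite [RHS](big_setD1 1) ?group1 //= act1.
have imt : t @: U^# = L^#.
  apply/eqP; rewrite eqEcard; apply/andP; split.
    by apply/subsetP=> _ /imsetP[s Us ->]; apply: frame_t fr _ Us.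
  rewrite (card_in_imset (frame_t_inj fr)).
  have := cardsD1 1 U; have := cardsD1 1 L; rewrite !group1 (frame_cardU fr) (frame_cardL fr).
  by rewrite !add1n => -[<-] [<-].
(* The sum over [L^#] is -v, whose image under sigma is -8 v, whereas [rel] and [zU] give 4 v. *)
have : (sigma (\sum_(l in L^#) act v l) = v *+ 4)%R.
  rewrite -imt big_imset /=; last exact: frame_t_inj fr.
  rewrite sig_sum (eq_bigr (fun s => - S s v *+ 4)%R); last exact: rel.
  by rewrite sumrMnl sumrN zU opprK.
rewrite zL sigN sigv => /eqP; rewrite eq_sym -addr_eq0 -mulrnDr => /eqP.
rewrite -[(4 + 8)%N]/(2 * 2 * 3)%N !mulrnA => /tors3/tors2/tors2 v0.
by rewrite v0 eqxx in ntv.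
Qed.

End FrameModule.

Section CoprimeModule.
Import FiniteModule.

Lemma PSL28_module_order3 (gT : finGroupType) (V K M : {group gT}) (p : nat) :
    prime p -> p \notin [:: 2; 3] -> abelian V -> p.-group V -> K \subset 'N(V) ->
    M <| K -> M \subset 'C(V) -> K / M \isog PSL 2 F8 -> ~~ has_order (V <*> K) (3 * p) ->
  V :=: 1.
Proof.
move=> pr_p; rewrite !inE negb_or => /andP[np2 np3] abV pV nVK /andP[sMK nMK] cVM isoT no.
have [cardT simT noT [U [L [t [y [w fr]]]]]] := PSL28P isoT.
have NM x : x \in K -> x \in 'N(M) by apply: subsetP.
have NV x : x \in K -> x \in 'N(V) by apply: subsetP.
pose rp (g : coset_of M) := odflt 1 [pick x in K | coset M x == g].
have rpP g : g \in K / M -> rp g \in K /\ coset M (rp g) = g.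
  case/morphimP=> x Nx Kx ->; rewrite /rp; case: pickP => [z /andP[Kz /eqP]|/(_ x)] //=.
  by rewrite Kx eqxx.
(* K / M acts through chosen representatives; by [actE] the choice is harmless, since M centralises
   V. *)
pose act (u : fmod_of abV) g := actr u (rp g).
have actE u x z : x \in K -> z \in K -> coset M x = coset M z -> actr u x = actr u z :> fmod_of abV.
  move=> Kx Kz e; have : x * z^-1 \in M.
    apply: coset_idr; first by rewrite groupM ?groupV ?NM.
    by rewrite morphM ?groupV ?NM // morphV ?NM //= e mulgV.
  move=> /(subsetP cVM)/centP cxz; apply: val_inj; rewrite !fmvalJ ?NV //.
  rewrite -{1}(mulgKV z x) conjgM; congr (_ ^ z).
  by apply/conjg_fixP/commgP/commute_sym/cxz/fmodP.
have K1 : rp 1 \in K /\ coset M (rp 1) = 1 by apply: rpP; apply: group1.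
(* The order of x itself need not be a power of 3, but its 3-part has the same image modulo M, hence
   the same action on V. *)
have free x : x \in K -> coset M x ^+ 3 = 1 -> coset M x != 1 -> 'C_V[x] = 1.
  move=> Kx x3 ntx; pose z := x.`_3.
  have Kz : z \in K by apply: groupX.
  have ez : coset M z = coset M x.
    rewrite /z morph_constt ?NM // constt_p_elt //.
    by apply: (@pnat_dvd _ 3) => //; rewrite order_dvdn x3.
  have ntz : z != 1 by apply: contraNneq ntx => z1; rewrite -ez z1 morph1.
  have cz : 'C_V[z] = 1.
    apply: (@nonadj_cent1 _ (V <*> K)%G V p 3) => //.
    - by rewrite mulnC.
    - exact: joing_subl.
    - by rewrite (subsetP (joing_subr _ _)).
    exact: p_elt_constt.
  apply/trivgP; rewrite -cz; apply/subsetP=> v /setIP[Vv /cent1P cxv].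
  rewrite inE Vv; apply/cent1P/commgP/conjg_fixP.
  have := actE (fmod abV v) x z Kx Kz (esym ez) => /(congr1 val).
  rewrite !fmvalJ ?NV // fmodK // => <-.
  by apply/conjg_fixP/commgP.
have tors n (u : fmod_of abV) : coprime #|V| n -> (u *+ n = 0 -> u = 0)%R.
  move=> co /(congr1 val); rewrite fmvalZ fmval0 => un.
  apply: val_inj; rewrite fmval0 -(expgK co (fmodP u)) /= un.
  exact: expg1n.
have coVn n : prime n -> p != n -> coprime #|V| n.
  by move=> pr_n nn; rewrite (pnat_coprime pV) // pnatE // !inE eq_sym.
have triv (u : fmod_of abV) : u = 0%R.
  apply: (@frame_module_trivial _ (K / M)%G U L t y w fr (fmod_of abV : finZmodType) act) => {u}.
  - by move=> g a b; apply: actAr.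
  - by move=> u; rewrite /act (actE u _ 1) ?morph1 ?actr1 //; case: K1.
  - move=> g h Tg Th u; have [[Kg eg] [Kh eh]] := (rpP g Tg, rpP h Th).
    have [Kgh egh] := rpP _ (groupM Tg Th).
    rewrite /act -actrM ?NV //; apply: actE; rewrite ?groupM //.
    by rewrite egh morphM ?NM //= eg eh.
  - by move=> u; apply: tors; apply: coVn.
  - by move=> u; apply: tors; apply: coVn.
  move=> g Tg g3 ntg u fu; have [Kg eg] := rpP g Tg.
  have c1 : 'C_V[rp g] = 1 by apply: free; rewrite ?eg.
  apply: val_inj; rewrite fmval0; apply/set1P.
  suff: val u \in 'C_V[rp g] by rewrite c1.
  rewrite inE fmodP; apply/cent1P/commgP/conjg_fixP.
  by rewrite -fmvalJ ?NV //; congr (val _).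
apply/trivgP/subsetP=> v Vv; apply/set1P; rewrite -(fmodK abV Vv).
by rewrite (triv (fmod abV v)).
Qed.
End CoprimeModule.

(** * Simple subnormal sections *)

(** Phrased with subnormal subgroups rather than composition series, so that it passes directly to
    subnormal subgroups and quotients. *)
Definition PSL28_factors (gT : finGroupType) (G : {group gT}) : Prop :=
  forall A B : {group gT}, A <|<| G -> maxnormal B A A ->
    abelian (A / B) \/ A / B \isog PSL 2 F8.

Section Factors.
Variable gT : finGroupType.
Implicit Types G H K M N V A B : {group gT}.

Lemma subnormal_chain G A : A <|<| G ->
  exists2 s, path [rel x y : {group gT} | maxnormal y x x] G s & last G s = A.
Proof.
have [n leGn] := ubnP #|G|; elim: n => // n IHn in G leGn *.
case/subnormalEr => [/val_inj-> | [K [snAK nsKG prKG]]]; first by exists [::].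
have [|N maxN sKN] := @maxgroup_exists _ (fun N : {group gT} => (N \proper G) && (G \subset 'N(N))) K.
  by rewrite prKG normal_norm.
have pNG : N \proper G := maxnormal_proper maxN.
have snAN : A <|<| N.
  by apply: subnormal_trans snAK (normal_subnormal (normalS sKN (proper_sub pNG) nsKG)).
have [|s ps ls] := IHn N _ snAN; first by rewrite (leq_trans (proper_card pNG)).
by exists (N :: s) => //=; apply/andP.
Qed.

(** Any such A and B occur in a composition series: a maximal chain from G to A, then B, then a
    composition series of B. *)
Lemma pseudo_factors G : pseudo_PSL28_solvable G -> PSL28_factors G.
Proof.
move=> psG A B snA maxB; have [s ps ls] := subnormal_chain snA.
have [sB /compsP[lB pB]] := exists_comps B.
apply: (psG (mkSec A B)); exists (s ++ B :: sB).
  by apply/compsP; rewrite last_cat ls cat_path ps ls /= maxB.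
by rewrite pairmap_cat ls mem_cat /= inE eqxx orbT.
Qed.

Lemma factors_subnormal G H : H <|<| G -> PSL28_factors G -> PSL28_factors H.
Proof. by move=> snH pG A B snA; apply: pG; apply: subnormal_trans snA snH. Qed.

Lemma cosetpre_subnormal N (A G : {group coset_of N}) :
  A <|<| G -> coset N @*^-1 A <|<| coset N @*^-1 G.
Proof.
case/subnormalP=> s; elim: s A => [|B s IHs] A /=; first by move=> _ ->; apply: subnormal_refl.
case/andP=> nsAB ps ls; apply: subnormal_trans (IHs _ ps ls).
by apply: normal_subnormal; rewrite cosetpre_normal.
Qed.

Lemma factors_quotient G N : N <| G -> PSL28_factors G -> PSL28_factors (G / N).
Proof.
move=> nsNG pG A B snA maxB.
have snA' : (coset N @*^-1 A) <|<| G by rewrite -(quotientGK nsNG) cosetpre_subnormal.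
have nsBA : coset N @*^-1 B <| coset N @*^-1 A.
  by rewrite cosetpre_normal (maxnormal_normal maxB).
have isoAB : A / B \isog (coset N @*^-1 A) / (coset N @*^-1 B).
  have := third_isog (sub_cosetpre B) (normal_cosetpre A) nsBA.
  by rewrite /= !cosetpreK.
have [||abAB|isoT] := pG [group of coset N @*^-1 A] [group of coset N @*^-1 B]; first exact: snA'.
- by rewrite -quotient_simple // -(isog_simple isoAB) quotient_simple // (maxnormal_normal maxB).
- by left; rewrite (isog_abelian isoAB).
- by right; apply: isog_trans isoAB isoT.
Qed.

Lemma factors_nonsolvable G : PSL28_factors G -> ~~ solvable G ->
  exists K M, [/\ K \subset G, M <| K & K / M \isog PSL 2 F8].
Proof.
have [n leGn] := ubnP #|G|; elim: n => // n IHn in G leGn *.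
move=> pG nsolG; have ntG : G :!=: 1 by apply: contraNneq nsolG => ->; apply: solvable1.
have [N maxN] := ex_maxnormal_ntrivg ntG; have nsNG := maxnormal_normal maxN.
case: (pG G N (subnormal_refl G) maxN) => [abGN|]; last by exists G, N.
have [|||K [M [sKN nsMK isoT]]] := IHn N.
- exact: leq_trans (proper_card (maxnormal_proper maxN)) leGn.
- by apply: factors_subnormal pG; apply: normal_subnormal.
- by apply: contra nsolG => solN; rewrite (series_sol nsNG) solN abelian_sol.
by exists K, M; rewrite (subset_trans sKN) ?normal_sub.
Qed.

End Factors.

(** * Elements of order rp above a section PSL(2,8), for r = 2, 7, 3 *)

Lemma PSL28_nonabelian (gT : finGroupType) (T : {group gT}) : T \isog PSL 2 F8 -> ~~ abelian T.
Proof.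
case/PSL28P=> _ _ _ [U [L [t [y [w fr]]]]]; apply/negP=> /centsP cTT.
have := frame_yw fr; rewrite conjgE (cTT _ (frame_y fr) _ (frame_w fr)) mulKg.
by move/eqP; rewrite eq_sym eq_invg_mul -expg2 -order_dvdn (frame_oy fr).
Qed.

(** By Frattini's argument the normaliser of P in K supplements M, and minimality of K makes it all
    of K. *)
Lemma Frattini_min (gT : finGroupType) (K M P : {group gT}) q : M <| K -> q.-Sylow(M) P ->
    (forall H : {group gT}, H \subset K -> H * M = K -> H :=: K) -> K \subset 'N(P).
Proof.
move=> nsMK sylP minK; rewrite -{1}(minK 'N_K(P)%G) ?subsetIl ?subsetIr //.
by rewrite normC ?(Frattini_arg nsMK sylP) // (subset_trans (subsetIl _ _)) ?normal_norm.
Qed.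

Lemma expg2_abelem (gT : finGroupType) (G : {group gT}) : {in G, forall x, x ^+ 2 = 1} -> 2.-abelem G.
Proof.
move=> sq; have inv x : x \in G -> x^-1 = x.
  by move=> Gx; apply/eqP; rewrite eq_invg_mul -expg2 sq.
apply/(abelemP (isT : prime 2)); split=> //; apply/centsP=> x Gx y Gy.
by rewrite /commute -[LHS]inv ?groupM // invMg !inv.
Qed.

Section Sections.
Variable gT : finGroupType.
Implicit Types G H K L M N V A B S P Q : {group gT}.

Lemma min_supplement K M : M <| K -> exists K1 M1,
  [/\ K1 \subset K, M1 <| K1, M1 \subset M, K1 / M1 \isog K / M
    & forall K2, K2 \subset K1 -> K2 * M1 = K1 -> K2 :=: K1].
Proof.
move=> nsMK; have [sMK nMK] := andP nsMK.
have [|K1 minK1 sK1K] := @mingroup_exists _ (fun H : {group gT} => H * M == K) K.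
  by rewrite mulGSid.
have [/eqP defK min1] := mingroupP minK1; have nMK1 := subset_trans sK1K nMK.
exists K1, (M :&: K1)%G; split=> //.
- by rewrite /normal subsetIr normsI ?normG.
- exact: subsetIl.
- by rewrite -defK quotientMidr; apply: second_isog.
move=> K2 sK21 defK1; apply: min1 => //; rewrite eqEsubset -{1}defK mulSg //=.
by rewrite -defK -defK1 -mulgA mulgS // mul_subG ?subsetIl.
Qed.

Lemma PSL28_Sylow2 K M S : M <| K -> K / M \isog PSL 2 F8 -> 2.-Sylow(K) S ->
  #|S / M| = 8 /\ 2.-abelem (S / M).
Proof.
move=> /andP[sMK nMK] isoT sylS; have [cardT _ _ [U [L [t [y [w fr]]]]]] := PSL28P isoT.
have abU := expg2_abelem (frame_invU fr).
have sylU : 2.-Sylow(K / M) U.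
  rewrite pHallE (frame_sU fr) /= (frame_cardU fr) /= cardT.
  by rewrite p_part.
have sylSM : 2.-Sylow(K / M) (S / M).
  by apply: quotient_pHall (sylS); apply: subset_trans (pHall_sub sylS) nMK.
have [g _ /= ->] := Sylow_trans sylU sylSM.
by rewrite cardJg (frame_cardU fr) abelemJ.
Qed.

Lemma PSL28_section_2p V K M p : prime p -> p != 2 -> abelian V -> p.-group V -> V :!=: 1 ->
    K \subset 'N(V) -> M <| K -> K / M \isog PSL 2 F8 ->
  has_order (V <*> K) (2 * p).
Proof.
move=> pr_p np2 abV pV ntV nVK nsMK isoT; apply: contraT; rewrite [(2 * p)%N]mulnC => no.
have [S sylS] := Sylow_exists 2 K; have [sSK pS _] := and3P sylS.
have [card8 abS] := PSL28_Sylow2 nsMK isoT sylS.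
have rK := free_rank1 abV pV ntV nVK pr_p (isT : prime 2) np2 no.
have nMS := subset_trans sSK (normal_norm nsMK).
have := rank1_2group_quotient pS (leq_trans (p_rankS _ sSK) rK) nMS abS.
by rewrite card8.
Qed.

(* Replacing K by the normaliser of a Sylow p-subgroup of M does not change K / M. *)
Lemma PSL28_section_M_2p K M p : prime p -> p != 2 -> M <| K -> K / M \isog PSL 2 F8 ->
  p %| #|M| -> has_order K (2 * p).
Proof.
move=> pr_p np2 nsMK isoT dvpM; have [sMK nMK] := andP nsMK.
have [P sylP] := Sylow_exists p M; have [sPM pP _] := and3P sylP.
have ntP : P :!=: 1.
  apply: contraTneq dvpM => P1; rewrite -(Hall_prime_dvd sylP) ?inE // P1 cards1.
  by rewrite gtnNdvd ?prime_gt1.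
have defK := Frattini_arg nsMK sylP.
have nMN : 'N_K(P) \subset 'N(M) := subset_trans (subsetIl _ _) nMK.
have isoN : 'N_K(P) / (M :&: 'N_K(P)) \isog PSL 2 F8.
  have e : 'N_K(P) / M = K / M by rewrite -[in RHS]defK quotientMidl.
  by have := second_isog nMN; rewrite /= e => /isog_trans->.
have nsMN : M :&: 'N_K(P) <| 'N_K(P) by rewrite /normal subsetIr normsI ?normG.
have sZ : 'Z(P) <*> 'N_K(P) \subset K.
  by rewrite join_subG subsetIl (subset_trans (center_sub P)) ?(subset_trans sPM).
apply: has_orderS sZ _.
apply: (@PSL28_section_2p 'Z(P)%G 'N_K(P)%G (M :&: 'N_K(P))%G) => //.
- exact: center_abelian.
- exact: pgroupS (center_sub P) pP.
- by rewrite center_nil_eq1 ?(pgroup_nil pP).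
- by rewrite (subset_trans (subsetIr _ _)) ?gFnorms.
Qed.

(** In a minimal supplement K is perfect, 7 does not divide #|M| and the centraliser of V in K lies
    in M. An element x of order 7 normalising a 2-subgroup S over U has [S, x] inside M by
    [order7_2group_cent], so it centralises U modulo M. *)
Lemma PSL28_section_7p V K0 M0 p : prime p -> p != 2 -> p != 7 -> abelian V -> p.-group V ->
    V :!=: 1 -> K0 \subset 'N(V) -> M0 <| K0 -> K0 / M0 \isog PSL 2 F8 ->
  has_order (V <*> K0) (7 * p).
Proof.
move=> pr_p np2 np7 abV pV ntV nVK0 nsM0 iso0.
have [K [M [sK0 nsMK _ isoK minK]]] := min_supplement nsM0.
have nVK := subset_trans sK0 nVK0; have isoT := isog_trans isoK iso0.
apply: has_orderS (genS (setUS V sK0)) _ => {K0 M0 sK0 isoK nVK0 nsM0 iso0}.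
apply: contraT; rewrite [(7 * p)%N]mulnC => no.
have [sMK nMK] := andP nsMK; have pr7 : prime 7 by [].
have sKV : K \subset V <*> K by apply: joing_subr.
have sVV : V \subset V <*> K by apply: joing_subl.
have [cardT simT noT [U [L [t [y [w fr]]]]]] := PSL28P isoT.
have [_ nsT] := simpleP _ simT.
have y2 m : y ^+ m.*2 = 1 -> 7 %| m.
  move/eqP; rewrite -order_dvdn (frame_oy fr) -muln2 => ?.
  by rewrite -(@Gauss_dvdl 7 m 2).
have perfK : K^`(1) = K.
  apply: minK; first exact: der_sub.
  have nMd : K^`(1) \subset 'N(M) := subset_trans (der_sub 1 K) nMK.
  apply/eqP; rewrite eqEsubset mul_subG ?der_sub //=.
  rewrite (normC nMd) -(quotientSK _ nMK) quotient_der //.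
  case: (nsT (K / M)^`(1)%G (der_normal 1 _)) => /= [der1|-> //].
  by case/negP: (PSL28_nonabelian isoT); rewrite /= abelianE (sameP commG1P eqP) -der1.
have rK : 'r_7(K) <= 1 by apply: free_rank1 no.
have cV1 x : x \in K -> 7.-elt x -> x != 1 -> 'C_V[x] = 1.
  by move=> Kx; apply: nonadj_cent1 no sVV pV _ => //; apply: (subsetP sKV).
(* Otherwise a Sylow 7-subgroup Q of M is normal in K and cyclic, hence central as K is perfect. In
   PSL(2,8) the Sylow 7-subgroup is inverted by some element; this lifts to n' acting on the cyclic
   group P = <[u]> as a power k with 7 dividing k + 1. As n' also fixes z of order 7 in Q, one gets
   z^2 = 1. *)
have M7 : ~~ (7 %| #|M|).
  apply/negP=> dv7M; have [Q sylQ] := Sylow_exists 7 M; have [sQM pQ _] := and3P sylQ.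
  have nQK := Frattini_min nsMK sylQ minK.
  have [P sylP sQP] := Sylow_superset (subset_trans sQM sMK) pQ.
  have [sPK pP _] := and3P sylP.
  have cycP : cyclic P.
    rewrite (odd_pgroup_rank1_cyclic pP) ?(leq_trans (p_rankS _ sPK)) //.
    by rewrite odd_2'nat; apply: pi_pnat pP _.
  have cQK : K \subset 'C(Q) by rewrite -{1}perfK cyclic_der1_cent // (cyclicS sQP).
  have sylY : 7.-Sylow(K / M) <[y]>%G.
    by rewrite pHallE cycle_subG (frame_y fr) /= -orderE (frame_oy fr) cardT p_part.
  have sylPM : 7.-Sylow(K / M) (P / M)%G.
    by apply: quotient_pHall (sylP); apply: subset_trans sPK nMK.
  have [g Tg /= defPM] := Sylow_trans sylY sylPM.
  have [u defP] := cyclicP cycP; have Pu : u \in P by rewrite defP cycle_id.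
  have oPM : #|P / M| = 7 by rewrite defPM cardJg -orderE (frame_oy fr).
  have Nu : u \in 'N(M) by rewrite (subsetP nMK) ?(subsetP sPK).
  have ou : #[coset M u] = 7 by rewrite orderE -quotient_cycle // -defP.
  have uw : coset M u ^ (w ^ g) = (coset M u)^-1.
    have : coset M u \in P / M by apply: mem_quotient.
    rewrite defPM; case/imsetP=> _ /cycleP[j ->] ->.
    by rewrite -conjJg conjXg (frame_yw fr) expgVn conjVg.
  have /morphimP[x Nx Kx defx] : w ^ g \in K / M by rewrite groupJ ?(frame_w fr).
  pose X := 'N_K(M <*> P)%G.
  have nsX : M <*> P <| X.
    by rewrite /normal subsetIr subsetI join_subG sMK sPK normG.
  have Xx : x \in X.
    rewrite inE Kx inE -(quotientYK (subset_trans sPK nMK)) -morphpreJ // -defx.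
    by rewrite defP quotient_cycle // -cycleJ uw cycleV subxx.
  have sylPX : 7.-Sylow(M <*> P) P.
    by apply: pHall_subl (sylP); rewrite ?joing_subr // join_subG sMK.
  have := Xx; rewrite -(Frattini_arg nsX sylPX).
  rewrite /= norm_joinEr ?(subset_trans sPK) //.
  case/mulsgP=> _ n /mulsgP[m p' Mm Pp' ->] /setIP[/setIP[Kn _] Nn] defn.
  pose n' := p' * n.
  have [k uk] : exists k, u ^ n' = u ^+ k.
    apply/cycleP; rewrite -defP memJ_norm // groupM // (subsetP (normG P)) //.
  have Kn' : n' \in K by rewrite groupM // (subsetP sPK).
  have cn' : coset M n' = w ^ g.
    by rewrite defx defn -mulgA /= (coset_kerl _ Mm).
  have /dvdnP[a ea] : 7 %| k.+1.
    have Nn' := subsetP nMK _ Kn'.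
    by rewrite -ou order_dvdn expgSr -morphX // -uk morphJ //= cn' uw mulVg.
  have [|z Qz oz] := @Cauchy _ 7 Q pr7; first by rewrite (Hall_prime_dvd sylQ).
  have /cycleP[j defz] : z \in <[u]> by rewrite -defP (subsetP sQP).
  have : z ^+ 2 = 1.
    have e1 : z ^ n' = z.
      by rewrite conjgE -(centP (subsetP cQK _ Kn') z Qz) mulKg.
    have e2 : z ^+ k = z by rewrite -{2}e1 defz conjXg uk -!expgM mulnC.
    by rewrite expg2 -{1}e2 -expgSr ea mulnC expgM -oz expg_order expg1n.
  by move/eqP; rewrite -order_dvdn oz.
(* A normal subgroup of K not inside M covers the simple quotient, so it contains an element of
   order 7, which cannot centralise V. *)
have cVM : 'C_K(V) \subset M.
  have nsC : 'C_K(V) <| K by rewrite /normal subsetIl normsI ?normG // norms_cent.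
  have nMC := subset_trans (normal_sub nsC) nMK.
  case: (nsT ('C_K(V) / M)%G (quotient_normal M nsC)) => /= [|eC].
    by move=> C1; rewrite -quotient_sub1 // C1.
  have /(Cauchy pr7)[c /setIP[Kc cVc] oc] : 7 %| #|'C_K(V)|.
    by apply: dvdn_trans (dvdn_quotient _ M); rewrite eC cardT.
  have := cV1 c Kc; rewrite /p_elt oc pnat_id // -order_gt1 oc => /(_ isT isT) cVc1.
  case/eqP: ntV; apply/trivgP; rewrite -cVc1 subsetI subxx /= sub_cent1.
  exact: cVc.
pose Y0 := [group of coset M @*^-1 U].
have sY0K : Y0 \subset K by rewrite -(quotientGK nsMK) morphpreS // (frame_sU fr).
have [S sylS] := Sylow_exists 2 Y0; have [sSY pS _] := and3P sylS.
have sSK := subset_trans sSY sY0K.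
have pU : 2.-group U by rewrite /pgroup (frame_cardU fr).
have SU : S / M = U.
  have sylSU : 2.-Sylow(Y0 / M) (S / M).
    by apply: quotient_pHall (sylS); apply: subset_trans sSK nMK.
  by have := pHall_id sylSU; rewrite /= cosetpreK => ->.
have /morphimP[a Na Ka defy] := frame_y fr.
pose X := (Y0 <*> <[a]>)%G.
have nsYX : Y0 <| X.
  rewrite /normal joing_subl join_subG normG cycle_subG inE -morphpreJ // -defy.
  by rewrite (normP (frame_ny fr)) subxx.
have Xa : a \in X by rewrite mem_gen // inE cycle_id orbT.
have := Xa; rewrite -(Frattini_arg nsYX sylS) => /mulsgP[b n Yb /setIP[Xn nSn] defa].
have Kn : n \in K.
  by apply: (subsetP _ n Xn); rewrite join_subG sY0K cycle_subG.
have Nn := subsetP nMK n Kn; have [Nb Ub] := morphpreP Yb.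
(* y and the image of n agree modulo U, so the power of y by #[n] lies in U and has square 1; as y
   has order 7, this forces 7 to divide #[n]. *)
have on7 : 7 %| #[n].
  apply: y2; rewrite -muln2 expgM; apply: (frame_invU fr).
  have NUb : coset M b \in 'N(U) := subsetP (normG U) _ Ub.
  have NUn : coset M n \in 'N(U).
    by rewrite -(groupMl _ NUb) -morphM // -defa -defy (frame_ny fr).
  apply: coset_idr; first by rewrite groupX // (frame_ny fr).
  have ey : coset U y = coset U (coset M n).
    by rewrite defy defa /= morphM // (coset_kerl _ Ub).
  rewrite morphX ?(frame_ny fr) //= ey -(morphX _ _ NUn) -(morphX _ _ Nn).
  by rewrite expg_order /= !morph1.
have [x nx ox] := Cauchy pr7 on7.
have Kx : x \in K by apply: (subsetP _ x nx); rewrite cycle_subG.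
have px : 7.-elt x by rewrite /p_elt ox pnat_id.
have ntx : x != 1 by rewrite -order_gt1 ox.
have nSx : x \in 'N(S) by apply: (subsetP _ x nx); rewrite cycle_subG.
have coV2 : coprime #|V| 2.
  by rewrite (pnat_coprime pV) // p'natE // dvdn_prime2.
have := order7_2group_cent pS ox nSx abV coV2 (subset_trans sSK nVK) (subsetP nVK x Kx) (cV1 x Kx px ntx).
have Mx : coset M x != 1.
  apply: contraNneq M7 => /coset_idr Mx; rewrite -ox order_dvdG // Mx //.
  exact: (subsetP nMK).
move=> cVSx; have cSx : coset M x \in 'C(U).
  have Nx := subsetP nMK x Kx; rewrite -sub_cent1 -cent_cycle -quotient_cycle // -SU.
  rewrite quotient_cents2 ?cycle_subG ?(subset_trans sSK) //.
  apply: subset_trans cVM; rewrite subsetI cVSx andbT.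
  by rewrite (subset_trans (commg_sub _ _)) // join_subG sSK cycle_subG.
have ntU : U :!=: 1 by rewrite -cardG_gt1 (frame_cardU fr).
have [h Uh nth] := trivgPn _ ntU.
have := noT 14 isT; rewrite (@has_orderM _ _ 2 7 h (coset M x)) //.
- exact: (subsetP (frame_sU fr)).
- exact: mem_quotient.
- exact/commute_sym/(centP cSx).
- exact: mem_p_elt Uh.
- exact: morph_p_elt (subsetP nMK x Kx) px.
Qed.

(** The absence of orders 6 and 14 makes #|M| prime to 3 and 7. A Sylow 2-subgroup S of M is normal
    in K and centralises V by [Frobenius_cent]. As M / S is a normal Hall subgroup of K / S, a
    complement to it lifts to a supplement of M, so minimality gives M = S, which acts trivially on
    V. *)
Lemma PSL28_section_3p V K0 M0 p : prime p -> p \notin [:: 2; 3] -> abelian V -> p.-group V ->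
    V :!=: 1 -> K0 \subset 'N(V) -> M0 <| K0 -> K0 / M0 \isog PSL 2 F8 ->
    ~~ has_order K0 6 -> ~~ has_order K0 14 ->
  has_order (V <*> K0) (3 * p).
Proof.
move=> pr_p np23 abV pV ntV nVK0 nsM0 iso0 no6 no14.
have [K [M [sK0 nsMK _ isoK minK]]] := min_supplement nsM0.
have nVK := subset_trans sK0 nVK0; have isoT := isog_trans isoK iso0.
have {}no6 : ~~ has_order K (2 * 3) := contra (has_orderS sK0) no6.
have {}no14 : ~~ has_order K (2 * 7) := contra (has_orderS sK0) no14.
apply: has_orderS (genS (setUS V sK0)) _ => {K0 M0 sK0 isoK nVK0 nsM0 iso0}.
apply: contraT => no3.
have [sMK nMK] := andP nsMK.
have sKV : K \subset V <*> K by apply: joing_subr.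
have sVV : V \subset V <*> K by apply: joing_subl.
have [cardT _ _ _] := PSL28P isoT.
have M3 : ~~ (3 %| #|M|).
  by apply: contra no6 => dv; exact: (@PSL28_section_M_2p K M 3 isT isT nsMK isoT dv).
have M7 : ~~ (7 %| #|M|).
  by apply: contra no14 => dv; exact: (@PSL28_section_M_2p K M 7 isT isT nsMK isoT dv).
have [S sylS] := Sylow_exists 2 M; have [sSM pS _] := and3P sylS.
have nSK := Frattini_min nsMK sylS minK; have sSK := subset_trans sSM sMK.
have /(Cauchy (isT : prime 3))[x Kx ox] : 3 %| #|K|.
  by apply: dvdn_trans (dvdn_quotient _ M); rewrite cardT.
have px : 3.-elt x by rewrite /p_elt ox pnat_id.
have ntx : x != 1 by rewrite -order_gt1 ox.
have np2 : p != 2 by apply: contraNneq np23 => ->.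
have np3 : p != 3 by apply: contraNneq np23 => ->.
have cSV : S \subset 'C(V).
  apply: (@Frobenius_cent _ V S x) => //.
  - exact: subset_trans sSK nVK.
  - exact: (subsetP nVK).
  - exact: (subsetP nSK).
  - by rewrite ox.
  - rewrite coprime_sym (pnat_coprime pS) // p'natE //.
    by apply: contraNN np2 => /(pgroupP pV 2 isT); rewrite inE /= eq_sym.
  - exact: nonadj_cent1 no6 sSK pS Kx px ntx.
  - apply: nonadj_cent1 pr_p _ np3 _ sVV pV (subsetP sKV x Kx) px ntx => //.
    by rewrite mulnC.
have nsSK : S <| K by rewrite /normal sSK.
have nsMS : M / S <| K / S := quotient_normal S nsMK.
have hallMS : Hall (K / S) (M / S).
  have := card_isog (third_isog sSM nsSK nsMK).
  rewrite /Hall quotientS //= card_quotient ?normal_norm // => ->.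
  have d3 := contra (fun d => dvdn_trans d (dvdn_quotient M S)) M3.
  have d7 := contra (fun d => dvdn_trans d (dvdn_quotient M S)) M7.
  have d2 : ~~ (2 %| #|M / S|).
    by rewrite card_quotient ?(subset_trans sMK) // -p'natE //; case/and3P: sylS.
  have -> : #|K / M| = (2 ^ 3 * (3 ^ 2 * 7))%N by rewrite cardT.
  have co k : prime k -> ~~ (k %| #|M / S|) -> coprime #|M / S| k.
    by move=> pr_k; rewrite coprime_sym prime_coprime.
  rewrite (coprimeMr _ (2 ^ 3)%N) (coprimeMr _ (3 ^ 2)%N).
  by apply/and3P; split; rewrite ?coprimeXr ?co.
have /splitsP[C /complP[tiC defKS]] := SchurZassenhaus_split hallMS nsMS.
have sCK : C \subset K / S by rewrite -defKS mulG_subr.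
have [K2 defC sSK2 sK2K] := inv_quotientS nsSK sCK.
have K2K : K2 :=: K.
  apply: minK => //; apply/eqP; rewrite eqEsubset mul_subG //=.
  have nSK2 := subset_trans sK2K nSK; have nSM := subset_trans sMK nSK.
  rewrite (normC (subset_trans sK2K nMK)) -(mulSGid sSM) -mulgA -quotientSK //.
  by rewrite quotientMl // -defC defKS.
have MS : M :=: S.
  apply/eqP; rewrite eqEsubset sSM andbT -quotient_sub1 ?(subset_trans sMK) //.
  by rewrite -tiC subsetI subxx defC K2K quotientS.
case/eqP: ntV; apply: (PSL28_module_order3 pr_p np23 abV pV nVK nsMK _ isoT no3).
by rewrite MS.
Qed.

(** * Minimal normal subgroups *)

(** V is a direct product of copies of a simple subgroup L; this L is subnormal in G, so it is
    itself one of the factors. *)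
Lemma minnormal_PSL28 G V : PSL28_factors G -> V <| G -> minnormal V G -> ~~ abelian V ->
  exists L, [/\ L <| V, L \isog PSL 2 F8 & [pred q | q \in [:: 2; 3; 7]].-nat #|V|].
Proof.
move=> pG nsVG minV nabV; have csV := minnormal_charsimple minV.
have [H [sHV simH [I /subsetP AutI defV]]] := charsimple_dprod csV.
have ntV : V :!=: 1 by case/mingroupp/andP: minV.
have [f If] : exists f, f \in I.
  by apply/set0Pn; apply: contraNneq ntV => I0; rewrite -defV I0 big_set0.
have AutG (h : {perm gT}) : h \in I -> exists2 L : {group gT}, h @: H = L & H \isog L.
  move=> Ih; exists (autm (AutI h Ih) @* H)%G; last by rewrite sub_isog ?injm_autm.
  by rewrite /= morphimEsub.
have [L defL isoL] := AutG f If.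
have nsLV : L <| V.
  by move: defV; rewrite (bigD1 f) //= defL => /dprod_normal2[].
have simL : simple L by rewrite -(isog_simple isoL).
have snL : L <|<| G.
  exact: subnormal_trans (normal_subnormal nsLV) (normal_subnormal nsVG).
have iso1 := quotient1_isog L.
have [abL|isoT] := pG L 1%G snL (etrans (esym (simple_maxnormal L)) simL).
  case/negP: nabV; apply: (@abelem_abelian _ (pdiv #|V|)); apply: charsimple_solvable => //.
  apply: nilpotent_sol; have [_ csV1] := charsimpleP _ csV.
  have ntL : L :!=: 1 by case/simpleP: simL.
  have sLF : L \subset 'F(V).
    by apply: Fitting_max nsLV _; apply: abelian_nil; rewrite (isog_abelian iso1).
  rewrite -(csV1 'F(V)%G) ?Fitting_nil ?Fitting_char //.
  by apply: contraNneq ntL => F1; rewrite -subG1 -F1.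
have {}isoT : L \isog PSL 2 F8 by apply: isog_trans iso1 isoT.
exists L; split=> //; rewrite -(bigdprod_card defV).
apply: (big_ind (fun n => _.-nat n)) => //= [m n pm pn|h Ih]; first by rewrite pnatM pm.
have [L1 -> isoL1] := AutG h Ih.
rewrite -(card_isog isoL1) (card_isog isoL); have [-> _ _ _] := PSL28P isoT.
by [].
Qed.

(** An element x of order p may normalise L and then a Sylow r-subgroup of L, of order 8, 9 or 7;
    acting freely, it would make p divide 7, 8 or 6. Otherwise x moves L through conjugates that
    centralise L, and the product of the conjugates of y is fixed by x. *)
Lemma component_has_order G V L p r : V <| G -> L <| V -> L \isog PSL 2 F8 ->
    prime p -> p \notin [:: 2; 3; 7] -> p %| #|G| -> r \in [:: 2; 3; 7] ->
  has_order G (r * p).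
Proof.
move=> nsVG nsLV isoT pr_p np237 dvpG r237.
have [cardL simL _ _] := PSL28P isoT.
have [x Gx ox] := Cauchy pr_p dvpG.
have px : p.-elt x by rewrite /p_elt ox pnat_id.
have ntx : x != 1 by rewrite -order_gt1 ox prime_gt1.
have nrp : r != p by apply: contraNneq np237 => <-.
have pr_r : prime r by move: r237; rewrite !inE => /or3P[] /eqP->.
have sLV := normal_sub nsLV; have sLG := subset_trans sLV (normal_sub nsVG).
have dvrL : r %| #|L| by rewrite cardL; move: r237; rewrite !inE => /or3P[] /eqP->.
have p504 : ~~ (p %| 504).
  apply: contra np237 => dv.
  have : p \in primes 504 by rewrite mem_primes pr_p.
  by rewrite (_ : primes 504 = [:: 2; 3; 7]).
have [nLx|nLx] := boolP (x \in 'N(L)).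
  apply: contraT => no.
  have [|||R sylR nRX] := @sol_coprime_Sylow_exists _ r <[x]>%G L.
  - exact: abelian_sol (cycle_abelian x).
  - by rewrite cycle_subG.
  - by rewrite cardL -orderE ox coprime_sym prime_coprime.
  have [sRL rR _] := and3P sylR.
  have cR1 : 'C_R[x] = 1 by apply: nonadj_cent1 no (subset_trans sRL sLG) rR Gx px ntx.
  have := @pgroup_fix_mod _ _ _ 'J%act p <[x]>%G R px.
  rewrite astabsJ => /(_ nRX); rewrite afixJ cent_cycle cR1 cards1.
  rewrite (card_Hall sylR) cardL => /eqP.
  rewrite eqn_mod_dvd ?part_gt0 // p_part => dvp; case/negP: np237.
  have pr_dvd n : 0 < n -> p %| n -> p \in primes n by move=> n0; rewrite mem_primes pr_p n0.
  move: r237 dvp; rewrite !inE => /or3P[] /eqP->.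
  - by move/(pr_dvd 7 isT); rewrite (_ : primes 7 = [:: 7]) ?inE // => ->; rewrite !orbT.
  - by move/(pr_dvd 8 isT); rewrite (_ : primes 8 = [:: 2]) ?inE // => ->.
  by move/(pr_dvd 6 isT); rewrite (_ : primes 6 = [:: 2; 3]) ?inE // orbA => ->.
have ZL1 : L :&: 'C(L) = 1.
  have [_ nsL] := simpleP _ simL; case: (nsL 'Z(L)%G (center_normal L)) => // ZL.
  case/negP: (PSL28_nonabelian isoT); rewrite -ZL; exact: center_abelian.
have cLz z : z \in G -> z \notin 'N(L) -> L :^ z \subset 'C(L).
  move=> Gz nLz; have nsLzV : L :^ z <| V.
    rewrite /normal -(normsP (normal_norm nsVG) z Gz) conjSg sLV normJ conjSg.
    exact: normal_norm.
  apply: normal_TI_cent (nsLzV) nsLV _; rewrite setIC.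
  have nsI : L :&: (L :^ z) <| L.
    rewrite /normal subsetIl; apply: normsI; first exact: normG.
    exact: subset_trans sLV (normal_norm nsLzV).
  have [_ nsL] := simpleP _ simL; case: (nsL _ nsI) => // /setIidPl sLz.
  by case/negP: nLz; apply/normP/esym/eqP; rewrite eqEcard sLz cardJg leqnn.
have [y Ly oy] := Cauchy pr_r dvrL.
pose w := \prod_(i < p.-1) y ^ (x ^+ i.+1).
have cLw : w \in 'C(L).
  apply: group_prod => i _.
  have xi : x ^+ i.+1 \notin 'N(L).
    apply: contra nLx; rewrite -!cycle_subG => /(subset_trans _)-> //.
    have : generator <[x]> (x ^+ i.+1).
      rewrite generator_coprime ox prime_coprime // gtnNdvd //.
      by rewrite -[in leqRHS](prednK (prime_gt0 pr_p)) ltnS.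
    by move/eqP=> <-.
  by apply: (subsetP (cLz _ _ xi)); rewrite ?groupX ?memJ_conjg.
have cyw : commute y w by apply/commute_sym/(centP cLw).
have zx : commute (y * w) x.
  have xp : x ^+ p = 1 by rewrite -ox expg_order.
  apply/commgP/conjg_fixP.
  have defyw : y * w = \prod_(i < p.-1.+1) y ^ (x ^+ i) by rewrite big_ord_recl expg0 conjg1.
  rewrite {1}defyw (big_morph (conjg^~ x) (fun a b => conjMg a b x) (conj1g x)) big_ord_recr /=.
  rewrite -conjgM -expgSr prednK ?prime_gt0 // xp conjg1 [RHS]cyw.
  by congr (_ * _); apply: eq_bigr => i _; rewrite -conjgM -expgSr.
(* If (y w)^n = 1, then y^n is the inverse of w^n, which centralises L, so y^n lies in the trivial
   centre of L. *)
have dvz : r %| #[y * w].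
  rewrite -oy order_dvdn.
  have := expg_order (y * w); rewrite expgMn // => /eqP; rewrite -eq_invg_mul => /eqP e.
  have : y ^+ #[y * w] \in L :&: 'C(L).
    by rewrite inE groupX //= -groupV e groupX.
  by rewrite ZL1 inE.
have [z zz oz] := Cauchy pr_r dvz.
have Gz : z \in G.
  apply: (subsetP _ _ zz); rewrite cycle_subG groupM ?(subsetP sLG y) //.
  by apply: group_prod => i _; rewrite groupJ ?groupX ?(subsetP sLG y).
apply: (@has_orderM _ _ r p z x) => //.
- by case/cycleP: zz => k ->; apply/commute_sym/commuteX/commute_sym.
- by rewrite /p_elt oz pnat_id.
- by rewrite -order_gt1 oz prime_gt1.
Qed.

End Sections.

(** Minimal normal subgroups are divided out until one is nonabelian or a p-group; element orders
    lift back from the quotients. *)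
Lemma PSL28_reduction (gT : finGroupType) (G : {group gT}) p : prime p -> p \notin [:: 2; 3; 7] ->
    p %| #|G| -> PSL28_factors G -> ~~ solvable G ->
  (forall r, r \in [:: 2; 3; 7] -> has_order G (r * p)) \/
  exists (rT : finGroupType) (V K M : {group rT}),
    [/\ abelian V, p.-group V, V :!=: 1 & K \subset 'N(V)]
    /\ [/\ M <| K, K / M \isog PSL 2 F8 & forall n, has_order (V <*> K) n -> has_order G n].
Proof.
move=> pr_p np; have [n leGn] := ubnP #|G|; elim: n => // n IHn in gT G leGn *.
move=> dvpG pG nsolG; have ntG : G :!=: 1 by apply: contraNneq nsolG => ->; apply: solvable1.
have [V minV sVG] := minnormal_exists ntG (normG G).
have [ntV nVG] := andP (mingroupp minV); have nsVG : V <| G by apply/andP.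
have [abV|nabV] := boolP (abelian V); last first.
  by left=> r r237; have [L [nsLV isoT _]] := minnormal_PSL28 pG nsVG minV nabV;
     apply: component_has_order nsVG nsLV isoT _ _ _ _.
have nsolGV : ~~ solvable (G / V).
  by apply: contra nsolG => solGV; rewrite (series_sol nsVG) abelian_sol.
have [pV|npV] := boolP (p.-group V).
  right; have [K [M [sKG nsMK isoT]]] := factors_nonsolvable pG nsolG.
  exists gT, V, K, M; split; split=> //; first exact: subset_trans sKG nVG.
  by move=> m; apply: has_orderS; rewrite join_subG sVG.
have dvp : p %| #|G / V|.
  have /is_abelemP[q pr_q abqV] : is_abelem V.
    exact: charsimple_solvable (minnormal_charsimple minV) (abelian_sol abV).
  move: dvpG; rewrite -(Lagrange sVG) -card_quotient // Euclid_dvdM // => /orP[|//].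
  move/(pgroupP (abelem_pgroup abqV) p pr_p); rewrite inE /= => /eqP epq.
  by case/negP: npV; rewrite epq abelem_pgroup.
have [|H|[rT [V1 [K [M [H1 [nsMK isoT ord]]]]]]] := IHn _ (G / V)%G _ dvp (factors_quotient nsVG pG) nsolGV.
- exact: leq_trans (ltn_quotient ntV sVG) leGn.
- by left=> r /H; apply: has_order_quotient.
- right; exists rT, V1, K, M; split=> //; split=> // m /ord; apply: has_order_quotient.
Qed.

Lemma nonsolvable_2p_7p (gT : finGroupType) (G : {group gT}) p r : prime p -> p \notin [:: 2; 3; 7] ->
    p %| #|G| -> PSL28_factors G -> ~~ solvable G -> r \in [:: 2; 7] -> has_order G (r * p).
Proof.
move=> pr_p np dvp pG nsol r27; have [np2 np3 np7] : [/\ p != 2, p != 3 & p != 7].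
  by move: np; rewrite !inE !negb_or => /and3P.
have [->|[rT [V [K [M [[abV pV ntV nVK] [nsMK isoT ord]]]]]]] := PSL28_reduction pr_p np dvp pG nsol.
  by [].
  by move: r27; rewrite !inE => /orP[]->; rewrite ?orbT.
apply: ord; move: r27; rewrite !inE => /orP[] /eqP->.
  exact: PSL28_section_2p nsMK isoT.
exact: PSL28_section_7p nsMK isoT.
Qed.

Lemma nonsolvable_3p (gT : finGroupType) (G : {group gT}) p : prime p -> p \notin [:: 2; 3; 7] ->
    p %| #|G| -> PSL28_factors G -> ~~ solvable G -> ~~ has_order G 6 -> ~~ has_order G 14 ->
  has_order G (3 * p).
Proof.
move=> pr_p np dvp pG nsol no6 no14; have np23 : p \notin [:: 2; 3].
  by move: np; rewrite !inE !negb_or => /and3P[-> ->].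
have [->//|[rT [V [K [M [[abV pV ntV nVK] [nsMK isoT ord]]]]]]] := PSL28_reduction pr_p np dvp pG nsol.
have sKVK : K \subset V <*> K by apply: joing_subr.
apply: (ord); apply: PSL28_section_3p nsMK isoT _ _ => //.
  by apply: contra no6 => /(has_orderS sKVK)/ord.
by apply: contra no14 => /(has_orderS sKVK)/ord.
Qed.

(** Induction through a minimal normal V. If V is nonabelian, only its prime 3 must be kept: the
    normaliser of a Sylow 3-subgroup P of V still covers a Hall {2, 7}'-subgroup of the solvable
    group found in the quotient, and what remains of V modulo P is a {2, 7}-group, split off by
    Schur-Zassenhaus. *)
Lemma solvable_subgroup_27' (gT : finGroupType) (G : {group gT}) : PSL28_factors G ->
  exists K : {group gT}, [/\ K \subset G, solvable K
    & forall p, prime p -> p \notin [:: 2; 7] -> p %| #|G| -> p %| #|K|].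
Proof.
have [n leGn] := ubnP #|G|; elim: n => // n IHn in gT G leGn *.
move=> pG; have [G1|ntG] := eqVneq (G : {set gT}) 1.
  by exists G; split=> //; rewrite G1 solvable1.
have [V minV sVG] := minnormal_exists ntG (normG G).
have [ntV nVG] := andP (mingroupp minV); have nsVG : V <| G by apply/andP.
have [||K1 [sK1 solK1 K1p]] := IHn _ (G / V)%G.
- exact: leq_trans (ltn_quotient ntV sVG) leGn.
- exact: factors_quotient.
have split_p p : prime p -> p %| #|G| = (p %| #|V|) || (p %| #|G / V|).
  by move=> pr_p; rewrite -Euclid_dvdM // card_quotient // Lagrange.
have [abV|nabV] := boolP (abelian V).
  have [K defK1 sVK sKG] := inv_quotientS nsVG sK1.
  have nsVK : V <| K := normalS sVK sKG nsVG.
  exists K; split=> //; first by rewrite (series_sol nsVK) -defK1 solK1 abelian_sol.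
  move=> p pr_p np; rewrite split_p // => /orP[dv|dv]; first exact: dvdn_trans dv (cardSg sVK).
  apply: dvdn_trans (K1p p pr_p np dv) _; rewrite defK1; exact: dvdn_quotient.
have [L [nsLV isoT piV]] := minnormal_PSL28 pG nsVG minV nabV.
have [cardL _ _ _] := PSL28P isoT.
pose pi := [pred q | q \notin [:: 2; 7]].
have [K2 hallK2] := Hall_exists pi solK1; have [sK21 piK2 _] := and3P hallK2.
have [H defH sVH sHG] := inv_quotientS nsVG (subset_trans sK21 sK1).
have nsVH : V <| H := normalS sVH sHG nsVG.
have [P sylP] := Sylow_exists 3 V; have [sPV pP _] := and3P sylP.
pose N := 'N_H(P)%G; have defHN := Frattini_arg nsVH sylP.
have nVN : N \subset 'N(V) by rewrite (subset_trans (subsetIl _ _)) // normal_norm.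
have nPN : N \subset 'N(P) by apply: subsetIr.
have sPN : P \subset N by rewrite subsetI normG (subset_trans sPV).
pose W := (V :&: N)%G; have sPW : P \subset W by rewrite subsetI sPV.
have nsWN : W <| N by rewrite /normal subsetIr normsI ?normG.
have isoNW : N / W \isog K2.
  have e : N / V = K2 by rewrite defH -defHN quotientMidl.
  by rewrite -e; apply: second_isog.
have nsPN : P <| N by apply/andP.
have sylPW : 3.-Sylow(W) P by apply: pHall_subl (sylP); rewrite ?subsetIl.
have nsWPN := quotient_normal P nsWN.
have isoNPW := third_isog sPW nsPN nsWN.
have hallW : Hall (N / P) (W / P).
  rewrite /Hall quotientS ?normal_sub // -(card_quotient (normal_norm nsWPN)).
  rewrite (card_isog isoNPW) (card_isog isoNW) coprime_sym (pnat_coprime piK2) //.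
  rewrite card_quotient ?(subset_trans (subsetIr _ _)) //.
  apply/pnatP=> // q pr_q dvq.
  have q3 : q != 3 by case/and3P: sylPW => _ _ /(pnat_dvd dvq); rewrite pnatE.
  have : q %| #|V|.
    by apply: dvdn_trans dvq (dvdn_trans (dvdn_indexg _ _) (cardSg (subsetIl _ _))).
  by move/(pgroupP piV q pr_q); rewrite !inE (negPf q3) negbK.
have /splitsP[C /complP[tiC defNP]] := SchurZassenhaus_split hallW nsWPN.
have sCN : C \subset N / P by rewrite -defNP mulG_subr.
have [K defC sPK sKN] := inv_quotientS nsPN sCN.
have isoC : C \isog K2.
  have nWC := subset_trans sCN (normal_norm nsWPN).
  apply: isog_trans (quotient_isog nWC tiC) _.
  have e : C / (W / P) = N / P / (W / P) by rewrite -defNP quotientMidl.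
  by rewrite /= e (isog_trans isoNPW).
exists K; split.
- by rewrite (subset_trans sKN) // (subset_trans (subsetIl _ _)).
- rewrite (@series_sol _ K P) ?(normalS sPK sKN) // ?(pgroup_sol pP) //=.
  rewrite -defC (isog_sol isoC); exact: solvableS sK21 solK1.
move=> p pr_p np; rewrite split_p // => /orP[dv|dv].
  have p3 : p = 3.
    have := pgroupP piV p pr_p dv; rewrite !inE; move: np; rewrite !inE !negb_or.
    by case/andP=> /negPf-> /negPf->; rewrite orbF => /eqP.
  by apply: dvdn_trans (cardSg sPK); rewrite p3 (Hall_prime_dvd sylP) // -p3.
apply: dvdn_trans (_ : #|C| %| _); last by rewrite defC dvdn_quotient.
by rewrite (card_isog isoC) (Hall_prime_dvd hallK2) // K1p.
Qed.

(** * The complement of the prime graph *)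

Section Complement.
Variables (gT : finGroupType) (G : {group gT}).
Hypothesis pG : PSL28_factors G.

(** In the nonsolvable case 2 and 7 can be non-adjacent only to each other and to 3, so they take
    the two colours other than that of 3, whatever the remaining primes have. *)
Lemma factors_3coloring : exists c : nat -> 'I_3,
  forall p q, prime p -> prime q -> p %| #|G| -> q %| #|G| -> p != q ->
    ~~ has_order G (p * q) -> c p != c q.
Proof.
have [solG|nsolG] := boolP (solvable G); first exact: solvable_3coloring.
have [K [sKG solK Kp]] := solvable_subgroup_27' pG.
have [c cP] := solvable_3coloring solK.
pose c' p : 'I_3 := if p == 7 then (c 3 + 1)%R else if p == 2 then (c 3 + 2%:R)%R else c p.
have adj r p : prime p -> p \notin [:: 2; 3; 7] -> p %| #|G| -> r \in [:: 2; 7] -> has_order G (r * p).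
  by move=> *; apply: nonsolvable_2p_7p.
have shift (a b d : 'I_3) : ((a + b)%R == (a + d)%R) = (b == d) by apply: (inj_eq (addrI a)).
have c72 : [&& c' 7 != c' 2, c' 7 != c' 3 & c' 2 != c' 3].
  have s0 b : (c 3 + b == c 3)%R = (b == 0)%R by rewrite -{2}(addr0 (c 3)) shift.
  by rewrite /c' /= shift !s0.
exists c'; move=> p q; wlog le_pq : p q / (q \in [:: 2; 7]) ==> (p \in [:: 2; 7]).
  move=> IH pr_p pr_q dvp dvq npq no; have [le|] := boolP ((q \in [:: 2; 7]) ==> (p \in [:: 2; 7])).
    exact: IH.
  rewrite negb_imply => /andP[_ /negPf np]; rewrite eq_sym.
  by apply: IH; rewrite ?np // 1?eq_sym // mulnC.
move=> pr_p pr_q dvp dvq npq no; have [p27|np27] := boolP (p \in [:: 2; 7]).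
  have q237 : q \in [:: 2; 3; 7] by apply: contraR no => nq; apply: adj.
  case/and3P: c72 => c1 c2 c3; move: p27 q237 npq; rewrite !inE.
  by case/orP=> /eqP-> /or3P[] /eqP-> // _; rewrite 1?[c' 2 == c' 7]eq_sym.
have nq27 : q \notin [:: 2; 7] by apply: contra np27 => q27; rewrite q27 in le_pq.
have cE r : r \notin [:: 2; 7] -> c' r = c r.
  by rewrite !inE negb_or /c' => /andP[/negPf-> /negPf->].
rewrite !cE //; apply: cP; rewrite ?Kp //.
by apply: contra no; apply: has_orderS.
Qed.

(** A prime p outside 2, 3, 7 is adjacent to 2 and 7, so the other two vertices avoid these; all
    three then divide the order of one solvable subgroup, against [solvable_three_primes]. *)
Lemma factors_triangle p q r : prime p -> prime q -> prime r ->
    p %| #|G| -> q %| #|G| -> r %| #|G| -> p != q -> p != r -> q != r ->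
    ~~ has_order G (p * q) -> ~~ has_order G (p * r) -> ~~ has_order G (q * r) ->
  ~~ solvable G /\ p \in [:: 2; 3; 7].
Proof.
move=> pr_p pr_q pr_r dvp dvq dvr npq npr nqr no1 no2 no3.
have three (H : {group gT}) : H \subset G -> solvable H ->
    ~~ [&& p %| #|H|, q %| #|H| & r %| #|H|].
  move=> sHG solH; apply/and3P=> -[dp dq dr].
  have := solvable_three_primes pr_p pr_q pr_r npq npr nqr solH dp dq dr.
  by case/or3P=> /(has_orderS sHG); apply/negP.
have nsolG : ~~ solvable G.
  by apply/negP=> /(three G (subxx _)); rewrite dvp dvq dvr.
split=> //; apply: contraT => np.
have adj s : s \in [:: 2; 7] -> has_order G (s * p) by apply: nonsolvable_2p_7p.
have nq : q \notin [:: 2; 7] by apply: contra no1 => /adj; rewrite mulnC.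
have nr : r \notin [:: 2; 7] by apply: contra no2 => /adj; rewrite mulnC.
have np' : p \notin [:: 2; 7] by move: np; rewrite !inE !negb_or => /and3P[-> _ ->].
have [K [sKG solK Kp]] := solvable_subgroup_27' pG.
by have := three K sKG solK; rewrite !Kp.
Qed.

Let X := complement (prime_graph G).

Lemma compl_prime_adj (x y : X) :
  adj x y = (x != y) && ~~ has_order G (val x * val y).
Proof.
by rewrite -[LHS]/((x != y) && ~~ ((x != y) && has_order G (val x * val y))); case: (x == y).
Qed.

Lemma vertexP (x : X) : prime (val x) /\ val x %| #|G|.
Proof. by have := valP x; rewrite mem_primes cardG_gt0 => /and3P[]. Qed.

Lemma complement_triangle (A : {set X}) : triangle A ->
  [/\ ~~ solvable G, forall x : X, (x \in A) = (val x \in [:: 2; 3; 7])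
    & forall m n, m \in [:: 2; 3; 7] -> n \in [:: 2; 3; 7] -> m != n -> ~~ has_order G (m * n)].
Proof.
case/andP=> /eqP A3 /forall_inP adjA.
have adjP x y : x \in A -> y \in A -> x != y -> ~~ has_order G (val x * val y).
  by move=> Ax Ay nxy; have /forall_inP/(_ y Ay) := adjA x Ax; rewrite nxy compl_prime_adj nxy.
have A237 x : x \in A -> ~~ solvable G /\ val x \in [:: 2; 3; 7].
  move=> Ax; have := cardsD1 x A; rewrite A3 Ax add1n => -[] /esym/eqP/cards2P[y [z [nyz defA]]].
  have : y \in A :\ x by rewrite defA !inE eqxx.
  have : z \in A :\ x by rewrite defA !inE eqxx orbT.
  rewrite !in_setD1 => /andP[nzx Az] /andP[nyx Ay].
  have [pr_x dvx] := vertexP x; have [pr_y dvy] := vertexP y; have [pr_z dvz] := vertexP z.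
  apply: (@factors_triangle _ (val y) (val z)); rewrite ?(inj_eq val_inj) // 1?eq_sym //.
  - by rewrite adjP // eq_sym.
  - by rewrite adjP // eq_sym.
  - by rewrite adjP.
(* Three distinct values inside a list of length three exhaust it. *)
have [|||_ sA] := @uniq_min_size _ [seq val x | x in A] [:: 2; 3; 7].
- by rewrite map_inj_uniq ?enum_uniq //; apply: val_inj.
- by move=> _ /imageP[x Ax ->]; case: (A237 x Ax).
- by rewrite size_map -cardE A3.
have Am m : m \in [:: 2; 3; 7] -> exists2 x, x \in A & m = val x by rewrite -sA => /imageP.
split.
- by have [x Ax _] := Am 2 isT; case: (A237 x Ax).
- move=> x; apply/idP/idP=> [/A237[] //|/Am[y Ay /val_inj->] //].
by move=> m n /Am[x Ax ->] /Am[y Ay ->] nxy; apply: adjP.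
Qed.

Lemma complement_prime_graph :
  [/\ colorable 3 X, (forall A B : {set X}, triangle A -> triangle B -> A = B)
    & (forall A : {set X}, triangle A -> isolated A)].
Proof.
split.
- have [c cP] := factors_3coloring; exists (fun x : X => c (val x)) => x y.
  rewrite compl_prime_adj => /andP[nxy no].
  have [[pr_x dvx] [pr_y dvy]] := (vertexP x, vertexP y).
  by apply: cP; rewrite ?(inj_eq val_inj).
- move=> A B /complement_triangle[_ memA _] /complement_triangle[_ memB _].
  by apply/setP=> x; rewrite memA memB.
move=> A /complement_triangle[nsolG memA no] x y; rewrite !memA => x237 ny.
have [pr_y dvy] := vertexP y; rewrite compl_prime_adj negb_and negbK; apply/orP; right.
rewrite negbK; have [x3|x3] := eqVneq (val x) 3.
  rewrite x3; apply: nonsolvable_3p => //; first exact: (no 2 3).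
  exact: (no 2 7).
apply: nonsolvable_2p_7p => //.
by move: x237; rewrite !inE (negPf x3).
Qed.

End Complement.

(** * Transport of the conditions along graph isomorphisms *)

Section GraphIso.
Variables (X Y : sgraph) (f : X -> Y).
Hypotheses (bijf : bijective f) (monof : {mono f : x y / adj x y}).

Let injf : injective f := bij_inj bijf.

Lemma compl_mono (x y : complement X) : adj (f x : complement Y) (f y) = adj x y.
Proof.
by rewrite -[LHS]/((f x != f y) && ~~ adj (f x) (f y)) monof (inj_eq injf).
Qed.

Lemma colorable_iso k : colorable k (complement Y) -> colorable k (complement X).
Proof. by case=> c cP; exists (c \o f) => x y axy; apply: cP; rewrite compl_mono. Qed.

Lemma triangle_iso (A : {set complement X}) :
  triangle A -> triangle ([set f x | x in A] : {set complement Y}).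
Proof.
case/andP=> A3 /forall_inP adjA; rewrite /triangle card_imset // A3 /=.
apply/forall_inP=> _ /imsetP[x Ax ->]; apply/forall_inP=> _ /imsetP[y Ay ->].
rewrite (inj_eq injf); have := compl_mono x y; rewrite /= => ->.
exact: (forall_inP (adjA x Ax)).
Qed.

Lemma complement_iso :
  [/\ colorable 3 (complement Y),
      (forall A B : {set complement Y}, triangle A -> triangle B -> A = B)
    & (forall A : {set complement Y}, triangle A -> isolated A)] ->
  [/\ colorable 3 (complement X),
      (forall A B : {set complement X}, triangle A -> triangle B -> A = B)
    & (forall A : {set complement X}, triangle A -> isolated A)].
Proof.
case=> col uniq iso; split; first exact: colorable_iso.
- move=> A B tA tB; apply: (imset_inj injf).
  exact: uniq (triangle_iso tA) (triangle_iso tB).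
move=> A tA x y Ax nAy; rewrite -compl_mono; apply: (iso _ (triangle_iso tA)).
  exact: imset_f.
by apply: contra nAy => /imsetP[z Az /injf->].
Qed.

End GraphIso.

Lemma pseudo_graph_conditions (Gamma : sgraph) (gT : finGroupType) (G : {group gT}) :
    pseudo_PSL28_solvable G -> graph_iso Gamma (prime_graph G) ->
  [/\ colorable 3 (complement Gamma),
      (forall A B : {set complement Gamma}, triangle A -> triangle B -> A = B)
    & (forall A : {set complement Gamma}, triangle A -> isolated A)].
Proof.
move=> /pseudo_factors pG [f bijf monof].
exact: complement_iso bijf monof (complement_prime_graph pG).
Qed.

(** * Orders of elements of coprime semidirect products *)

Section CoprimeSdprod.
Variable gT : finGroupType.
Implicit Types G H K W : {group gT}.

Lemma has_order_quotient_coprime G H n : H <| G -> coprime n #|H| ->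
  has_order (G / H) n = has_order G n.
Proof.
move=> /andP[sHG nHG] co; apply/idP/idP; first exact: has_order_quotient.
case/has_orderP=> x Gx ox; apply/has_orderP; exists (coset H x); first exact: mem_quotient.
have Nx := subsetP nHG x Gx; have cX : coprime #|H| #[x] by rewrite ox coprime_sym.
rewrite -ox !orderE -quotient_cycle //; apply: esym; apply: card_isog.
by apply: quotient_isog; rewrite ?cycle_subG // coprime_TIg.
Qed.

Lemma sdprod_has_order G W K n : W ><| K = G -> coprime n #|W| ->
  has_order G n = has_order K n.
Proof.
move=> defG co; have [nsWG _ _ _ _] := sdprod_context defG.
by rewrite -(has_order_quotient_coprime nsWG co) -(has_order_isog n (sdprod_isog defG)).
Qed.

(** The p-part of an element of order q p lies in the normal Hall subgroup W; its q-part w k may be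
    replaced by k, which acts on the abelian W in the same way. *)
Lemma sdprod_has_orderP G W K p q : W ><| K = G -> abelian W -> coprime #|W| #|K| ->
    prime p -> prime q -> p %| #|W| -> q %| #|K| ->
  reflect (exists x y, [/\ x \in K, y \in W, #[x] = q, #[y] = p & commute x y])
          (has_order G (q * p)).
Proof.
move=> defG abW co pr_p pr_q dvp dvq; have [nsWG sKG defWK nWK tiWK] := sdprod_context defG.
have no_common r : prime r -> r %| #|W| -> r %| #|K| -> false.
  move=> pr_r dvW dvK; have : r %| gcdn #|W| #|K| by rewrite dvdn_gcd dvW.
  by rewrite (eqP co) dvdn1 => /eqP r1; rewrite r1 in pr_r.
have npq : q != p by apply: contraTneq dvq => ->; apply/negP => dvK; have := no_common _ pr_p dvp dvK.
apply: (iffP idP) => [/(has_order_split pr_q pr_p npq)[x [y [Gx Gy ox oy cxy]]]|]; last first.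
  case=> x [y [Kx Wy ox oy cxy]]; apply: (@has_order_mul _ _ _ _ x y) => //.
    exact: subsetP sKG x Kx.
  exact: subsetP (normal_sub nsWG) y Wy.
have hallW : \pi(W).-Hall(G) W by rewrite Hall_pi // -(coprime_sdprod_Hall_l defG).
have Wy : y \in W.
  rewrite (mem_normal_Hall hallW) // /p_elt oy pnatE // inE /= mem_primes pr_p dvp.
  by rewrite cardG_gt0.
have : x \in W * K by rewrite defWK.
case/mulsgP=> w k Ww Kk defx; exists k, y; split=> //; last first.
  apply: (mulgI w); rewrite mulgA -defx cxy defx !mulgA; congr (_ * k).
  exact: (centsP abW).
have Nk := subsetP nWK k Kk; have Nw := subsetP (normG W) w Ww.
have ck : coset W x = coset W k by rewrite defx coset_kerl.
have kq : k ^+ q = 1.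
  apply/set1gP; rewrite -tiWK inE (groupX q Kk) andbT; apply: coset_idr; first exact: groupX.
  rewrite morphX //= -ck -morphX ?defx ?groupM //= -defx -ox expg_order morph1 //.
have ntk : #[k] != 1%N.
  rewrite order_eq1; apply: contraTneq dvq => k1.
  have : x \in W by rewrite defx k1 mulg1.
  by move/order_dvdG; rewrite ox => dvqW; apply/negP => dvK; have := no_common _ pr_q dvqW dvK.
by apply/(prime_nt_dvdP pr_q ntk); rewrite order_dvdn kq.
Qed.

End CoprimeSdprod.

(* The normal factor is all of W because a groupAction has to be trivial outside its range. *)
Lemma module_sdprod (kT : finGroupType) (W : finZmodType) (to : W -> kT -> W) :
    to^~ 1 =1 id -> (forall x, act_morph to x) -> (forall a, {morph to^~ a : x y / (x + y)%R}) ->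
  exists (gT : finGroupType) (f : {morphism [set: W] >-> gT}) (h : {morphism [set: kT] >-> gT}),
    [/\ 'injm f, 'injm h, forall x a, f (to x a) = f x ^ h a,
        f @* [set: W] <*> h @* [set: kT] = [set: gT]
      & forall R : {group W}, (forall x a, x \in R -> to x a \in R) ->
          f @* R ><| h @* [set: kT] = f @* R <*> h @* [set: kT]].
Proof.
move=> to1 toM toD; pose act := TotalAction to1 toM.
have gact : is_groupAction [set: W] act.
  move=> a _; rewrite inE; apply/andP; split; first by apply/subsetP=> x; rewrite inE.
  by apply/morphicP=> x y _ _; rewrite !actpermE /= toD.
pose ga := GroupAction gact; exists (sdprod_groupType ga).
exists (sdpair1_morphism ga), (sdpair2_morphism ga).
split; [exact: injm_sdpair1 | exact: injm_sdpair2 | | exact: sdprodWY (sdprod_sdpair ga) |].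
  by move=> x a; rewrite /= -sdpair_act ?inE.
move=> R stR; apply: sdprodEY.
  apply/subsetP=> _ /morphimP[a _ _ ->]; rewrite inE; apply/subsetP=> _ /imsetP[_ /morphimP[x _ Rx ->] ->].
  by rewrite /= -(sdpair_act ga) ?inE // mem_morphim ?inE ?stR.
by apply/trivgP; rewrite -(im_sdpair_TI ga) setSI ?morphimS ?subsetT.
Qed.

(** * A metacyclic group *)

Lemma eqmod_Fp p m n : prime p -> (m == n %[mod p]) = (m%:R == n%:R :> 'F_p)%R.
Proof. by move=> pr_p; rewrite -val_eqE /= !val_Fp_nat. Qed.

Lemma primitive_mod p c : prime p -> c %| p.-1 ->
  exists u : nat, forall j, (u ^ j == 1 %[mod p]) = (c %| j).
Proof.
move=> pr_p dvc; have [g defg] := cyclicP (field_unit_group_cyclic [set: {unit 'F_p}]%G).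
have og : #[g] = p.-1 by rewrite orderE -defg card_finField_unit card_Fp.
have p1 : 0 < p.-1 by rewrite -subn1 subn_gt0 prime_gt1.
have ou : #[g ^+ (p.-1 %/ c)] = c.
  rewrite orderXdiv og ?divnA // ?mulKn //; last by rewrite dvdn_div.
move: (g ^+ _) ou => u ou; exists (FinRing.uval u : nat) => j.
rewrite (eqmod_Fp _ _ pr_p) natrX natr_Zp -FinRing.val_unitX -FinRing.val_unit1 val_eqE.
by rewrite -order_dvdn ou.
Qed.

Section CRT.
Variables (I : eqType) (s : seq I) (m : I -> nat).
Hypotheses (us : uniq s) (co : {in s &, forall i j, i != j -> coprime (m i) (m j)}).

Lemma coprime_big_prod i r : {subset i :: r <= s} -> i \notin r ->
  coprime (m i) (\prod_(j <- r) m j)%N.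
Proof.
move=> sr ir; rewrite big_seq; elim/big_ind: _ => [||j rj]; first exact: coprimen1.
  by move=> a b ca cb; rewrite coprimeMr ca.
apply: co; rewrite ?sr ?mem_head // ?in_cons ?rj ?orbT //.
by apply: contraNneq ir => ->.
Qed.

Lemma crt_eqmod a b : {in s, forall i, a = b %[mod m i]} -> a = b %[mod (\prod_(i <- s) m i)%N].
Proof.
suff H r : uniq r -> {subset r <= s} -> {in r, forall i, a = b %[mod m i]} ->
    a = b %[mod (\prod_(i <- r) m i)%N] by apply: H.
elim: r => [|i r IHr] /=; first by rewrite big_nil !modn1.
case/andP=> ir ur sr eqab; rewrite big_cons; apply/eqP.
rewrite chinese_remainder ?coprime_big_prod // eqab ?mem_head // eqxx /=; apply/eqP.
apply: IHr => // j rj; first by rewrite sr // in_cons rj orbT.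
by rewrite eqab // in_cons rj orbT.
Qed.

Lemma crt_exists (r : I -> nat) : exists u, {in s, forall i, u = r i %[mod m i]}.
Proof.
suff H t : uniq t -> {subset t <= s} -> exists u, {in t, forall i, u = r i %[mod m i]}.
  by apply: H.
elim: t => [|i t IHt] /=; first by exists 0.
case/andP=> it ut st; have [|u uP] := IHt ut; first by move=> j tj; rewrite st // in_cons tj orbT.
have cit : coprime (m i) (\prod_(j <- t) m j)%N by apply: coprime_big_prod.
exists (chinese (m i) (\prod_(j <- t) m j)%N (r i) u) => j.
rewrite in_cons => /orP[/eqP->|tj]; first exact: chinese_modl.
rewrite -uP //; have /dvdnP[k e] : m j %| (\prod_(j <- t) m j)%N.
  by rewrite (big_rem j) //= dvdn_mulr.
have := chinese_modr cit (r i) u; rewrite e => /(congr1 (modn^~ (m j))).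
by rewrite !modn_dvdm ?dvdn_mull.
Qed.

End CRT.

(** K acts on W through powers of a multiplier u, chosen so that its order modulo [rho d] is [nd d],
    the product of the primes of O to be non-adjacent to [rho d]. *)
Lemma metacyclic_graph (I : finType) (O D : {set I}) (rho : I -> nat) (e : rel I) :
    (forall i, prime (rho i)) -> injective rho -> [disjoint O & D] ->
    {in D, forall d, (\prod_(o in O) rho o)%N %| (rho d).-1} ->
  exists (gT : finGroupType) (W K : {group gT}),
    [/\ W ><| K = [set: gT], cyclic W /\ cyclic K, #|W| = (\prod_(d in D) rho d)%N, #|K| = (\prod_(o in O) rho o)%N
      & forall o d, o \in O -> d \in D -> has_order [set: gT] (rho o * rho d)%N = ~~ e o d].
Proof.
move=> pr_rho inj_rho disOD dvD; set n := (\prod_(o in O) rho o)%N in dvD *; set m := (\prod_(d in D) rho d)%N.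
have rho_gt0 i : 0 < rho i by rewrite prime_gt0.
have n_gt0 : 0 < n by apply: prodn_gt0.
have m_gt0 : 0 < m by apply: prodn_gt0.
have co_rho i j : i != j -> coprime (rho i) (rho j).
  by move=> nij; rewrite prime_coprime // dvdn_prime2 // (inj_eq inj_rho).
pose nd d := (\prod_(o in O | e o d) rho o)%N.
have nd_dvd d : nd d %| n.
  by rewrite /n (bigID (fun o => e o d)) /= dvdn_mulr.
have [om omP] : exists om, {in D, forall d j, (om d ^ j == 1 %[mod rho d]) = (nd d %| j)}.
  have H d : exists w, d \in D -> forall j, (w ^ j == 1 %[mod rho d]) = (nd d %| j).
    have [Dd|_] := boolP (d \in D); last by exists 0.
    by have [w wP] := primitive_mod (pr_rho d) (dvdn_trans (nd_dvd d) (dvD d Dd)); exists w.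
  by have [om omP] := fin_all_exists H; exists om => d /omP.
have [u uP] : exists u, {in enum D, forall d, u = om d %[mod rho d]}.
  by apply: crt_exists; [apply: enum_uniq | move=> i j _ _; apply: co_rho].
have uX d j : d \in D -> (u ^ j == 1 %[mod rho d]) = (nd d %| j).
  by move=> Dd; rewrite -omP // -modnXm uP ?mem_enum // modnXm.
have un : u ^ n = 1 %[mod m].
  rewrite /m -big_enum; apply: crt_eqmod => [|i j _ _|d]; [exact: enum_uniq | exact: co_rho |].
  by rewrite mem_enum => Dd; apply/eqP; rewrite uX.
pose W := 'I_m.-1.+1 : finZmodType; pose K := 'I_n.-1.+1 : finZmodType.
have mulW (x : W) a b : a = b %[mod m] -> (x *+ a = x *+ b)%R.
  move=> eab; have {}eab : a = b %[mod m.-1.+1] by rewrite prednK.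
  by apply: val_inj; rewrite !Zp_mulrn /= -modnMmr eab modnMmr.
pose to (x : W) (z : K) : W := (x *+ (u ^ z))%R.
have [|||gT [f [h [injf injh fh defT sd]]]] := @module_sdprod K W to.
- by move=> x; rewrite /to expn0 mulr1n.
- move=> x a b; rewrite /to -mulrnA -expnD; apply: mulW => /=.
  rewrite [X in (_ + _) %% X]prednK // [in RHS](divn_eq (a + b) n) expnD mulnC [(_ %/ _ * n)%N]mulnC expnM.
  have e1 k : (u ^ n) ^ k = 1 %[mod m] by rewrite -modnXm un modnXm exp1n.
  by rewrite -[RHS]modnMmr e1 modnMmr muln1.
- by move=> a x y; rewrite /to mulrnDl.
pose fW := (f @* [set: W])%G; pose hK := (h @* [set: K])%G.
have defG : fW ><| hK = [set: gT]%G by rewrite /= -defT; apply: (sd [set: W]%G (fun x a _ => in_setT _)).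
have cardW : #|fW| = m by rewrite card_injm // cardsT card_ord prednK.
have cardK : #|hK| = n by rewrite card_injm // cardsT card_ord prednK.
have co : coprime #|fW| #|hK|.
  rewrite cardW cardK /m; elim/big_ind: _ => [|a b ca cb|d Dd]; first exact: coprime1n.
    by rewrite coprimeMl ca.
  rewrite /n; elim/big_ind: _ => [|a b ca cb|o Oo]; first exact: coprimen1.
    by rewrite coprimeMr ca.
  by apply: co_rho; apply: contraTneq Dd => ->; rewrite (disjointFr disOD Oo).
exists gT, fW, hK; split=> //.
  by split; apply: morphim_cyclic; apply/cyclicP; exists Zp1; exact: Zp_cycle.
move=> o d Oo Dd.
have abW : abelian fW by apply/morphim_abelian/FinRing.zmod_abelian.
have dvd : rho d %| #|fW| by rewrite cardW /m (bigD1 d) //= dvdn_mulr.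
have dvo : rho o %| #|hK| by rewrite cardK /n (bigD1 o) //= dvdn_mulr.
(* An element z of order [rho o] is a multiple of N = n / rho o but not of n. It fixes w exactly
   when [nd d] divides z: this fails if [rho o] divides [nd d], and otherwise [nd d] divides N. *)
have key (w : W) (z : K) : #[w] = rho d -> #[z] = rho o -> (to w z == w) = ~~ e o d.
  move=> ow oz; have -> : (to w z == w) = (u ^ z == 1 %[mod rho d]).
    by rewrite -ow -eq_expg_mod_order !FinRing.zmodXgE.
  rewrite uX //; pose N := (\prod_(i in O | i != o) rho i)%N.
  have defn : n = (rho o * N)%N by rewrite /n (bigD1 o).
  have nz : ~~ (n %| z).
    apply: contraL (prime_gt1 (pr_rho o)) => dvz; rewrite -leqNgt -oz leq_eqVlt order_eq1.
    apply/orP; left; apply/eqP/val_inj => /=.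
    apply/eqP; apply: contraLR dvz; rewrite -lt0n => z0.
    by rewrite gtnNdvd // (leq_trans (ltn_ord z)) // prednK.
  have Nz : N %| z.
    rewrite -(dvdn_pmul2l (rho_gt0 o)) -defn; have := expg_order z.
    rewrite oz FinRing.zmodXgE Zp_mulrn => /(congr1 val)/eqP.
    by rewrite mulnC -[_ == _]/(_ %| _) [X in X %| _]prednK.
  move: (nat_of_ord z) nz Nz => k nz Nz; have [eod|neod] /= := boolP (e o d).
    apply: contraNF nz; rewrite /nd (bigD1 o) ?Oo //= => dvz.
    have coN : coprime (rho o) N.
      rewrite /N; elim/big_ind: _ => [|a b ca cb|i /andP[_ nio]]; first exact: coprimen1.
        by rewrite coprimeMr ca.
      by rewrite co_rho // eq_sym.
    by rewrite defn Gauss_dvd // Nz andbT (dvdn_trans _ dvz) // dvdn_mulr.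
  apply: dvdn_trans Nz; rewrite /N (bigID (fun i => e i d)) /= dvdn_mulr // /nd.
  rewrite (eq_bigl (fun i => (i \in O) && (i != o) && e i d)) ?dvdnn // => i.
  by case: (eqVneq i o) => [->|_]; rewrite ?(negPf neod) ?andbF ?andbT.
have commE w z : commute (h z) (f w) <-> to w z = w.
  split=> [c|e1]; last first.
    apply/commute_sym/commgP/conjg_fixP. by rewrite -fh e1.
  by apply: (injmP injf); rewrite ?inE //= fh conjgE -c mulKg.
apply/(sdprod_has_orderP defG abW co)/idP => //.
  case=> _ [_ [/morphimP[z _ _ ->] /morphimP[w _ _ ->] oz ow /commE/eqP]].
  by rewrite key -?(order_injm injf) -?(order_injm injh) ?inE.
move=> ne; have [w Ww ow] := Cauchy (pr_rho d) dvd; have [z Kz oz] := Cauchy (pr_rho o) dvo.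
exists z, w; split=> //; case/morphimP: Ww ow => x _ _ ->; case/morphimP: Kz oz => y _ _ -> oy ox.
apply/commE/eqP.
by rewrite key -?(order_injm injf) -?(order_injm injh) ?inE.
Qed.

(** * Induced modules *)

Lemma coprime_primeP a b : 0 < a -> (forall s, prime s -> s %| a -> ~~ (s %| b)) -> coprime a b.
Proof.
move=> a0 H; rewrite /coprime; apply: contraT => n1.
have g0 : 0 < gcdn a b by rewrite gcdn_gt0 a0.
have pr : prime (pdiv (gcdn a b)) by rewrite pdiv_prime // ltn_neqAle eq_sym n1.
have := pdiv_dvd (gcdn a b); rewrite dvdn_gcd => /andP[da db].
by have := H _ pr da; rewrite db.
Qed.

(** A linear character of L over the prime field with kernel N; its values are natural numbers so
    that they can act as multiples on an additive group. *)
Lemma cyclic_char (gT : finGroupType) (L N : {group gT}) p :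
    N <| L -> cyclic (L / N) -> prime p -> #|L / N| %| p.-1 ->
  exists lam : gT -> nat, {in L &, forall x y, lam (x * y) = lam x * lam y %[mod p]}
    /\ {in L, forall x, (lam x == 1 %[mod p]) = (x \in N)}.
Proof.
move=> /andP[sNL nNL] /cyclicP[h defLN] pr_p; rewrite defLN -orderE => dvh.
have [u uP] := primitive_mod pr_p dvh.
have H x : exists j, x \in L -> coset N x = h ^+ j.
  have [Lx|_] := boolP (x \in L); last by exists 0.
  have /cycleP[j e] : coset N x \in <[h]> by rewrite -defLN mem_quotient.
  by exists j.
have [j jP] := fin_all_exists H.
have uE a b : a = b %[mod #[h]] -> u ^ a = u ^ b %[mod p].
  have uh k : (u ^ #[h]) ^ k = 1 %[mod p] by apply/eqP; rewrite -expnM uP dvdn_mulr.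
  have red c : u ^ c = u ^ (c %% #[h]) %[mod p].
    by rewrite {1}(divn_eq c #[h]) expnD mulnC [(_ %/ _ * _)%N]mulnC expnM -modnMmr uh modnMmr muln1.
  by move=> e; rewrite red e -red.
exists (fun x => u ^ j x)%N; split=> [x y Lx Ly|x Lx].
  rewrite -expnD; apply: uE; apply/eqP; rewrite -eq_expg_mod_order expgD.
  by rewrite -!jP ?groupM // morphM ?(subsetP nNL).
rewrite uP order_dvdn -jP //; apply/eqP/idP => [|Nx]; last exact: coset_id.
exact/coset_idr/(subsetP nNL).
Qed.

Definition ffmod (T : finType) (Z : finZmodType) : Type := {ffun T -> Z}.
HB.instance Definition _ (T : finType) (Z : finZmodType) := GRing.Zmodule.on (ffmod T Z).
HB.instance Definition _ (T : finType) (Z : finZmodType) := Finite.on (ffmod T Z).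
HB.instance Definition _ (T : finType) (Z : finZmodType) := [finGroupMixin of ffmod T Z for +%R].

Section Induced.
Variables (kT : finGroupType) (J : finType) (p : J -> nat) (L N : J -> {group kT}).
Hypotheses (pr_p : forall i, prime (p i)) (inj_p : injective p).
Hypotheses (nsL : forall i, L i <| [set: kT]) (nsN : forall i, N i <| [set: kT]).
Hypothesis sNL : forall i, N i \subset L i.

(** Functions take values in Z / M for the product M of all the primes, which contains a copy of
    each Z / p i; thus the modules for all i live in one function group. *)
Let M := (\prod_i p i)%N.
Let Z : finZmodType := 'I_M.-1.+1.
Let W : finZmodType := ffmod (J * kT)%type Z.
Variables (lam : J -> kT -> nat) (a : J -> Z).
Hypothesis lamM : forall i, {in L i &, forall x y, lam i (x * y) = lam i x * lam i y %[mod p i]}.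
Hypothesis lam1 : forall i, {in L i, forall x, (lam i x == 1 %[mod p i]) = (x \in N i)}.
Hypothesis ord_a : forall i, #[a i] = p i.

Let to (f : W) (k : kT) : W := [ffun t => f (t.1, t.2 * k^-1)].

(** The direct sum over i of the modules induced from [lam i]: functions that are [p i]-torsion and
    equivariant under left multiplication by [L i], while [to] is right translation. *)
Let R := [set f : W | [forall i, forall g, (f (i, g) *+ p i == 0)%R &&
  [forall l in L i, f (i, l * g)%g == (f (i, g) *+ lam i l)%R]]].

Lemma induced_mem (f : W) : reflect
  ((forall i g, f (i, g) *+ p i = 0)%R /\
   forall i l g, l \in L i -> f (i, l * g)%g = (f (i, g) *+ lam i l)%R) (f \in R).
Proof.
rewrite inE; apply: (iffP forallP) => [H | [H1 H2] i].
  split=> [i g|i l g Ll]; have /forallP/(_ g)/andP[/eqP // _ /forall_inP H2] := H i.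
  by apply/eqP/H2.
apply/forallP=> g; rewrite H1 eqxx; apply/forall_inP=> l Ll.
by rewrite H2.
Qed.

Lemma induced_group_set : group_set R.
Proof.
apply/group_setP; split=> [|f f' /induced_mem[t1 e1] /induced_mem[t2 e2]]; apply/induced_mem.
  by split=> *; rewrite !ffunE mul0rn.
by split=> [i g|i l g Ll]; rewrite !ffunE mulrnDl ?t1 ?t2 ?addr0 // e1 // e2.
Qed.

Canonical induced_group := Group induced_group_set.

Lemma induced_act1 : to^~ 1 =1 id.
Proof. by move=> f; apply/ffunP=> -[i g]; rewrite ffunE /= invg1 mulg1. Qed.

Lemma induced_actM f : act_morph to f.
Proof. by move=> x y; apply/ffunP=> -[i g]; rewrite !ffunE /= invMg mulgA. Qed.

Lemma induced_actD k : {morph to^~ k : f f' / (f + f')%R}.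
Proof. by move=> f f'; apply/ffunP=> t; rewrite !ffunE. Qed.

Lemma induced_stable f k : f \in R -> to f k \in R.
Proof.
move/induced_mem=> [t1 e1]; apply/induced_mem; split=> [i g|i l g Ll]; rewrite !ffunE //=.
by rewrite -mulgA e1.
Qed.

Lemma zmod_order_dvd (z : Z) m : (z *+ m == 0)%R = (#[z] %| m).
Proof. by rewrite order_dvdn. Qed.

Lemma zmod_order (z : Z) q : prime q -> (z *+ q = 0)%R -> z != 0%R -> #[z] = q.
Proof.
move=> pr_q /eqP; rewrite zmod_order_dvd => dv nz.
by apply/(prime_nt_dvdP pr_q) => //; rewrite order_eq1.
Qed.

Lemma order_induced (f : W) q : prime q -> f != 0%R -> (f *+ q)%R = 0%R -> #[f] = q.
Proof.
move=> pr_q nz fq; apply/(prime_nt_dvdP pr_q); first by rewrite order_eq1.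
by rewrite order_dvdn; apply/eqP.
Qed.

Let v0 i : W := [ffun t => if (t.1 == i) && (t.2 \in L i) then (a i *+ lam i t.2)%R else 0%R].

Lemma zmod_mulrn_mod i (z : Z) m n : (z *+ p i = 0)%R -> m = n %[mod p i] -> (z *+ m = z *+ n)%R.
Proof.
move=> zp e; rewrite (divn_eq m (p i)) (divn_eq n (p i)) e !mulrnDr ![(_ * p i)%N]mulnC !mulrnA zp.
by rewrite !mul0rn.
Qed.

Lemma ap i : (a i *+ p i)%R = 0%R.
Proof. by rewrite -(ord_a i); exact: expg_order. Qed.

Lemma v0_mem i : v0 i \in R.
Proof.
apply/induced_mem; split=> [j g|j l g Ll]; rewrite !ffunE /=.
  by case: eqP => [->|_] /=; rewrite ?mul0rn //; case: ifP => _; rewrite ?mul0rn // mulrnAC ap mul0rn.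
case: eqP => [e|_] /=; rewrite ?mul0rn //; rewrite e in Ll *.
rewrite groupMl //; case: ifP => Lg; rewrite ?mul0rn // -mulrnA.
by apply: (zmod_mulrn_mod (ap i)); rewrite lamM // mulnC.
Qed.

Lemma v0_1 i : v0 i (i, 1) = a i.
Proof.
rewrite ffunE /= eqxx group1 /= -[RHS]mulr1n; apply: (zmod_mulrn_mod (ap i)).
by apply/eqP; rewrite lam1 ?group1.
Qed.

Lemma a_neq0 i : a i != 0%R.
Proof. by rewrite -order_gt1 ord_a prime_gt1. Qed.

Lemma v0p i : (v0 i *+ p i)%R = 0%R.
Proof.
apply/ffunP=> t; rewrite ffunMnE !ffunE; case: ifP => _; rewrite ?mul0rn //.
by rewrite mulrnAC ap mul0rn.
Qed.

Lemma order_v0 i : #[v0 i] = p i.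
Proof.
apply: order_induced (v0p i) => //; apply: contraNneq (a_neq0 i) => v00.
by rewrite -v0_1 v00 ffunE.
Qed.

Lemma induced_prime s : prime s -> (s %| #|R|) = [exists i, s == p i].
Proof.
move=> pr_s; apply/idP/existsP => [/(Cauchy pr_s)[f Rf ordf]|[i /eqP->]]; last first.
  by rewrite -(order_v0 i) order_dvdG ?v0_mem.
have [t nz] : exists t, f t != 0%R.
  apply/existsP; apply: contraT; rewrite negb_exists => /forallP f0.
  have : #[f] != 1%N by rewrite ordf; case: (s) pr_s => [|[]].
  by rewrite order_eq1 => /eqP[]; apply/ffunP=> t; rewrite ffunE; apply/eqP; rewrite -[_ == _]negbK f0.
case: t nz => i g nz; exists i; have [t1 _] := induced_mem _ Rf.
rewrite -(zmod_order (pr_p i) (t1 i g) nz) eq_sym; apply/eqP; apply: zmod_order => //.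
have : (f *+ s)%R (i, g) = 0%R by rewrite -ordf (_ : f *+ #[f] = 0)%R ?ffunE //; exact: expg_order.
by rewrite ffunMnE.
Qed.

(** For k in [L i] outside [N i], normality makes k act at each coordinate as a value of [lam i]
    different from 1, so nothing of order [p i] is fixed. For k in [N i] the vector [v0 i] is fixed,
    and for k outside [L i] its sum over <[k]> is. *)
Lemma induced_fixedP i (k : kT) : prime #[k] ->
  reflect (exists v : W, [/\ v \in R, #[v] = p i & to v k = v]) ((k \in N i) || (k \notin L i)).
Proof.
move=> pr_k; apply: (iffP idP) => [|[v [Rv ov fixv]]]; last first.
  apply: contraT; rewrite negb_or negbK => /andP[nNk Lk]; have [t1 e1] := induced_mem _ Rv.
  have vp : (v *+ p i)%R = 0%R by rewrite -ov; exact: expg_order.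
  have : #[v] != 1%N by rewrite ov; case: (p i) (pr_p i) => [|[]].
  rewrite order_eq1 => /eqP[]; apply/ffunP=> -[j g]; rewrite ffunE; apply/eqP; apply: contraT => nz.
  have ji : j = i.
    apply: inj_p; rewrite -(zmod_order (pr_p j) (t1 j g) nz); apply: zmod_order => //.
    by rewrite -ffunMnE vp ffunE.
  rewrite ji in nz; have := congr1 (fun f : W => f (i, g)) fixv; rewrite ffunE /=.
  have gkE : g * k^-1 * g^-1 = k^-1 ^ g^-1 by rewrite conjgE invgK mulgA.
  have Lgk : g * k^-1 * g^-1 \in L i.
    by rewrite gkE memJ_norm ?groupV // (subsetP (normal_norm (nsL i))) ?inE.
  rewrite -[g * k^-1](mulgKV g) e1 // -[RHS]mulr1n => /eqP.
  rewrite -[_ == _]/((v (i, g) : Z) ^+ _ == v (i, g) ^+ 1) eq_expg_mod_order.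
  rewrite (zmod_order (pr_p i) (t1 i g) nz) lam1 //.
  rewrite gkE memJ_norm ?groupV ?(negPf nNk) //.
  by rewrite (subsetP (normal_norm (nsN i))) ?inE.
case/orP=> [Nk|nLk].
  exists (v0 i); split; [exact: v0_mem | exact: order_v0 |].
  apply/ffunP=> -[j g]; rewrite !ffunE /=; case: eqP => [_|//] /=.
  have Lk := subsetP (sNL i) k Nk; rewrite groupMr ?groupV //; case: ifP => // Lg.
  apply: (zmod_mulrn_mod (ap i)); rewrite lamM ?groupV //.
  have /eqP e1 : lam i k^-1 == 1 %[mod p i] by rewrite lam1 ?groupV.
  by rewrite -modnMmr e1 modnMmr muln1.
pose v := (\sum_(c in <[k]>) to (v0 i) c)%R.
have Rv : v \in R by apply: (@group_prod _ induced_group) => c _; apply/induced_stable/v0_mem.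
(* Only c = 1 contributes at (i, 1): any other element of <[k]> generates it and so lies outside
   [L i]. *)
have v1 : v (i, 1) = a i.
  rewrite sum_ffunE (bigD1 1) ?group1 //= ffunE /= invg1 mulg1 v0_1 big1 ?addr0 // => c /andP[kc ntc].
  rewrite !ffunE /= eqxx mul1g groupV; case: ifP => // Lc; case/negP: nLk.
  have oc : #[c] = #[k] by apply/(prime_nt_dvdP pr_k); rewrite ?order_eq1 // (order_dvdG kc).
  have ck : <[c]> = <[k]> by apply/eqP; rewrite eqEcard cycle_subG kc -!orderE oc leqnn.
  by rewrite -cycle_subG -ck cycle_subG.
exists v; split=> //.
  apply: order_induced => //; first by apply: contraNneq (a_neq0 i) => v0'; rewrite -v1 v0' ffunE.
  rewrite /v -sumrMnl big1 // => c _; apply/ffunP=> t; rewrite ffunMnE !ffunE.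
  by case: ifP => _; rewrite ?mul0rn // mulrnAC ap mul0rn.
rewrite {1}/v (big_morph (to^~ k) (induced_actD k) (_ : to 0%R k = 0%R)).
  rewrite /v [RHS](reindex_inj (mulIg k)) /=; apply: eq_big => [c|c _]; last by rewrite induced_actM.
  by rewrite groupMr ?cycle_id.
by apply/ffunP=> t; rewrite !ffunE.
Qed.

End Induced.

Lemma induced_sdprod (kT : finGroupType) (J : finType) (p : J -> nat) (L N : J -> {group kT}) :
    (forall i, prime (p i)) -> injective p -> (forall i, ~~ (p i %| #|[set: kT]|)) ->
    (forall i, [/\ L i <| [set: kT], N i <| [set: kT], N i \subset L i,
       cyclic (L i / N i) & #|L i / N i| %| (p i).-1]) ->
  exists (gT : finGroupType) (G W K : {group gT}),
    [/\ W ><| K = G, abelian W, K \isog [set: kT],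
        forall s, prime s -> (s %| #|W|) = [exists i, s == p i]
      & forall i r, prime r -> r %| #|[set: kT]| ->
          has_order G (r * p i)%N = [exists k : kT, (#[k] == r) && ((k \in N i) || (k \notin L i))]].
Proof.
move=> pr_p inj_p p_kT LN.
have nsL i : L i <| [set: kT] by case: (LN i).
have nsN i : N i <| [set: kT] by case: (LN i).
have sNL i : N i \subset L i by case: (LN i).
have H i : exists lam : kT -> nat, {in L i &, forall x y, lam (x * y) = lam x * lam y %[mod p i]}
    /\ {in L i, forall x, (lam x == 1 %[mod p i]) = (x \in N i)}.
  by case: (LN i) => *; apply: cyclic_char => //; apply: normalS (nsN i); rewrite ?subsetT.
have [lam lamP] := fin_all_exists H => {H}.
pose M := (\prod_i p i)%N; pose Z := 'I_M.-1.+1 : finZmodType.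
have M0 : 0 < M by apply: prodn_gt0 => i; rewrite prime_gt0.
have H i : exists a : Z, #[a] = p i.
  have : p i %| #|[set: Z]| by rewrite cardsT card_ord prednK // /M (bigD1 i) //= dvdn_mulr.
  by case/(Cauchy (pr_p i)) => x _ ox; exists x.
have [a oa] := fin_all_exists H => {H}.
have lamM i : {in L i &, forall x y, lam i (x * y) = lam i x * lam i y %[mod p i]} by case: (lamP i).
have lam1 i : {in L i, forall x, (lam i x == 1 %[mod p i]) = (x \in N i)} by case: (lamP i).
have [gT [f [h [injf injh fh _ sd]]]] := module_sdprod (@induced_act1 kT J p) (@induced_actM kT J p) (@induced_actD kT J p).
pose R := @induced_group kT J p L lam.
have defG := sd R (fun f k => @induced_stable kT J p L lam f k).
have cardR : #|f @* R| = #|R| by rewrite card_injm ?subsetT.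
have primeR s : prime s -> (s %| #|f @* R|) = [exists i, s == p i].
  by rewrite cardR; apply: (induced_prime pr_p lamM lam1 oa).
have abW : abelian (f @* R) by apply/morphim_abelian/FinRing.zmod_abelian.
have cardK : #|h @* [set: kT]| = #|[set: kT]| by rewrite card_injm ?subsetT.
exists gT, (f @* R <*> h @* [set: kT])%G, (f @* R)%G, (h @* [set: kT])%G; split=> //.
  by rewrite isog_sym sub_isog.
move=> i r pr_r dvr.
have co : coprime #|f @* R| #|h @* [set: kT]|.
  apply: coprime_primeP => [|s pr_s]; first exact: cardG_gt0.
  by rewrite primeR // cardK => /existsP[j /eqP->].
have dvp : p i %| #|f @* R| by rewrite primeR //; apply/existsP; exists i.
have dvr' : r %| #|h @* [set: kT]| by rewrite cardK.
apply/(sdprod_has_orderP defG abW co (pr_p i) pr_r dvp dvr')/existsP.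
  case=> _ [_ [/morphimP[k _ _ ->] /morphimP[v _ Rv ->] ok ov c]].
  have {}ok : #[k] = r by rewrite -ok (order_injm injh) ?inE.
  exists k; rewrite ok eqxx /=; apply/(induced_fixedP pr_p inj_p nsL nsN sNL lamM lam1 oa); first by rewrite ok.
  exists v; split=> //; first by rewrite -ov (order_injm injf) ?inE.
  by apply: (injmP injf); rewrite ?inE //= fh conjgE -c mulKg.
case=> k /andP[/eqP ok]; case/(induced_fixedP pr_p inj_p nsL nsN sNL lamM lam1 oa); first by rewrite ok.
move=> v [Rv ov fv]; exists (h k), (f v); split.
- by rewrite mem_morphim ?inE.
- by rewrite mem_morphim // in_setT.
- by rewrite (order_injm injh) ?inE.
- by rewrite (order_injm injf) ?inE.
by apply/commute_sym/commgP/conjg_fixP; rewrite -fh fv.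
Qed.

(** * Primes in arithmetic progressions *)

Section Dirichlet.
Import Num.Theory.

Local Open Scope ring_scope.

Lemma Cyclotomic_dvd (F : fieldType) d : (0 < d)%N ->
  \prod_(e <- divisors d) map_poly intr 'Phi_e = 'X^d - 1 :> {poly F}.
Proof.
move=> d0; rewrite -rmorph_prod /= prod_Cyclotomic // rmorphB /= rmorph1.
by rewrite map_polyXn.
Qed.

Lemma Cyclotomic_root1 (F : fieldType) n (z : F) : (0 < n)%N ->
  root (map_poly intr 'Phi_n) z -> z ^+ n = 1.
Proof.
move=> n0 rz; apply/eqP; rewrite -subr_eq0 -[_ - 1](_ : ('X^n - 1 : {poly F}).[z] = _).
  by rewrite -Cyclotomic_dvd // (big_rem n) -?dvdn_divisors //= hornerM (rootP rz) mul0r.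
by rewrite !hornerE.
Qed.

(** If z had a smaller order m, it would also be a root of some Phi_e with e dividing m, against the
    separability of X^n - 1. *)
Lemma Cyclotomic_root (F : fieldType) n (z : F) : (0 < n)%N -> n%:R != 0 :> F ->
  root (map_poly intr 'Phi_n) z -> n.-primitive_root z.
Proof.
move=> n0 nF rz; have dn : n \in divisors n by rewrite -dvdn_divisors.
have zn := Cyclotomic_root1 n0 rz.
have [m prim_m dvmn] := prim_order_exists n0 zn.
have m0 := prim_order_gt0 prim_m.
have [<- //|nmn] := eqVneq m n.
have : separable_poly ('X^n - 1 : {poly F}) by apply: separable_Xn_sub_1.
rewrite -Cyclotomic_dvd // (big_rem n) //= separable_mul => /and3P[_ _ cop].
have rootb s : root (\prod_(e <- s) map_poly intr 'Phi_e) z = has (fun e => root (map_poly intr 'Phi_e) z) s.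
  elim: s => [|e s IHs]; first by rewrite big_nil /root hornerC oner_eq0.
  by rewrite big_cons rootM IHs.
have := coprimep_root cop rz; case/negP.
have : root (\prod_(e <- divisors m) map_poly intr 'Phi_e) z.
  by rewrite Cyclotomic_dvd // /root !hornerE (prim_expr_order prim_m) subrr.
rewrite rootb => /hasP[e em re].
have [de _] : (e %| m)%N /\ true by rewrite dvdn_divisors.
have en : e \in rem n (divisors n).
  rewrite mem_rem_uniq ?divisors_uniq // !inE -dvdn_divisors // (dvdn_trans de) // andbT.
  apply: contraNneq nmn => e_n; rewrite eqn_dvd dvmn -e_n.
  by rewrite e_n in de *; rewrite de.
by rewrite -[_ == 0]/(root _ z) rootb; apply/hasP; exists e.
Qed.

(** A prime q dividing Phi_n(x) satisfies x^n = 1 modulo q, so it does not divide x. With x a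
    multiple of n and of B factorial, q exceeds B and does not divide n, so x has order n modulo q
    and n divides q - 1. *)
Lemma primes_1_mod n B : (0 < n)%N -> exists2 q, prime q & (B < q)%N && (n %| q.-1)%N.
Proof.
move=> n0; pose c := (n * B`!)%N; have c0 : (0 < c)%N by rewrite muln_gt0 n0 fact_gt0.
(* A nonroot x of P makes Phi_n(x) different from 0, 1 and -1, so that it has a prime divisor; one
   occurs among more multiples of c than the degree of P. *)
pose P := 'Phi_n * ('Phi_n ^+ 2 - 1) : {poly int}.
have szPhi : (1 < size 'Phi_n)%N by rewrite size_Cyclotomic ltnS totient_gt0.
have nzP : P != 0.
  apply: mulf_neq0; first exact/monic_neq0/Cyclotomic_monic.
  apply: contraTneq szPhi => /eqP; rewrite subr_eq0 => /eqP/(congr1 (size \o @polyseq _)) /=; rewrite size_poly1 => e2.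
  have := size_exp 'Phi_n 2; rewrite e2 /= muln2 => /esym/eqP; rewrite double_eq0 -leqNgt.
  by case: (size _) => [|[]].
have /allPn[x /mapP[y _ ex] ny] : ~~ all (root P) [seq (c * y)%:Z | y <- iota 0 (size P)].
  set rs := map _ _; apply/negP => /(max_poly_roots nzP) H.
  have : uniq rs.
    rewrite map_inj_uniq ?iota_uniq // => y y' /eqP.
    by rewrite eqz_nat eqn_pmul2l // => /eqP.
  by move/H; rewrite size_map size_iota ltnn.
set v := ('Phi_n).[x].
have [nv0 nv1] : v != 0 /\ v ^+ 2 != 1.
  move: ny; rewrite /root /P hornerM mulf_eq0 negb_or => /andP[nv n2]; split=> //.
  by move: n2; rewrite !hornerE subr_eq0.
have v1 : (1 < `|v|)%N.
  rewrite ltn_neqAle eq_sym absz_gt0 nv0 andbT; apply: contraNneq nv1 => e.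
  by rewrite -real_normK ?num_real // -abszE e.
have pr_q := pdiv_prime v1; set q := pdiv _ in pr_q.
have rz : root (map_poly intr 'Phi_n) ((c * y)%:R : 'F_q).
  rewrite /root -[(c * y)%:R]/((c * y)%:Z%:~R : 'F_q) -ex horner_map /= -(dvdz_pcharf (pchar_Fp pr_q)).
  by rewrite dvdzE pdiv_dvd.
have z1 := Cyclotomic_root1 n0 rz.
have nz : (c * y)%:R != 0 :> 'F_q.
  by apply: contraTneq (oner_neq0 'F_q) => z0; rewrite -z1 z0 expr0n gtn_eqF // eqxx.
have : ~~ (q %| c * y)%N by rewrite (dvdn_pcharf (pchar_Fp pr_q)).
rewrite !Euclid_dvdM // !negb_or => /andP[/andP[nqn nqB] _].
exists q => //; apply/andP; split.
  by rewrite ltnNge; apply: contra nqB => leqB; rewrite dvdn_fact // prime_gt0.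
have prim : n.-primitive_root ((c * y)%:R : 'F_q).
  by apply: Cyclotomic_root => //; rewrite -(dvdn_pcharf (pchar_Fp pr_q)).
rewrite (prim_order_dvd prim); apply/eqP/(mulfI nz).
rewrite mulr1 -exprS prednK ?prime_gt0 //.
have := expf_card ((c * y)%:R : 'F_q); by rewrite [X in _ ^+ X](card_Fp pr_q).
Qed.
End Dirichlet.

Lemma primes_family (T : finType) n B : 0 < n ->
  exists rho : T -> nat, injective rho /\ forall t, [/\ prime (rho t), B < rho t & n %| (rho t).-1].
Proof.
move=> n0; have H k : exists s : seq nat, [/\ size s = k, uniq s &
    forall q, q \in s -> [/\ prime q, B < q & n %| q.-1]].
  elim: k => [|k [s [ss us sP]]]; first by exists [::].
  have [q pr_q /andP[Bq dvq]] := primes_1_mod (B + \sum_(i <- s) i) n0.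
  exists (q :: s); split=> [||r]; first by rewrite /= ss.
    rewrite /= us andbT; apply: contraL Bq => sq; rewrite -leqNgt (big_rem q sq) /=.
    by rewrite addnCA leq_addr.
  rewrite in_cons => /orP[/eqP->|/sP//]; split=> //.
  exact: leq_ltn_trans (leq_addr _ _) Bq.
have [s [ss us sP]] := H #|T|.
exists (fun t => nth 0 s (enum_rank t)); split=> [t t' /eqP|t].
  by rewrite nth_uniq ?ss // => /eqP/ord_inj/enum_rank_inj.
by apply: sP; rewrite mem_nth ?ss.
Qed.

(** * Solvable groups with a prescribed prime graph *)

Lemma abelian_has_order (gT : finGroupType) (A : {group gT}) p q : abelian A ->
    prime p -> prime q -> p != q -> p %| #|A| -> q %| #|A| -> has_order A (p * q).
Proof.
move=> abA pr_p pr_q npq dvp dvq.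
have [x Ax ox] := Cauchy pr_p dvp; have [y Ay oy] := Cauchy pr_q dvq.
by apply: (@has_order_mul _ _ _ _ x y) => //; apply: (centsP abA).
Qed.

Lemma squarefree_subgroup (gT : finGroupType) (A B : {group gT}) : A \subset B ->
    (forall r, prime r -> r %| #|B| -> r %| #|A|) ->
    (forall r, prime r -> ~~ (r ^ 2 %| #|B|)) -> A :=: B.
Proof.
move=> sAB dvA sq; apply/eqP; rewrite eqEsubset sAB /= -indexg_eq1; apply: contraT => n1.
have gt1 : 1 < #|B : A| by rewrite ltn_neqAle eq_sym n1 indexg_gt0.
have pr := pdiv_prime gt1; have dvB := dvdn_trans (pdiv_dvd _) (dvdn_indexg B A).
have := sq _ pr; rewrite -(Lagrange sAB) expnS expn1 dvdn_mul ?pdiv_dvd //.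
exact: dvA.
Qed.

Lemma prod_primes_dvd (I : finType) (A : {set I}) (rho : I -> nat) s :
    (forall i, prime (rho i)) -> prime s ->
  (s %| \prod_(i in A) rho i)%N = [exists i in A, s == rho i].
Proof.
move=> pr_rho pr_s; rewrite -big_enum.
transitivity (has (fun i => s == rho i) (enum A)).
  elim: (enum A) => [|i r IHr] /=; first by rewrite big_nil dvdn1; case: (s) pr_s => [|[]].
  by rewrite big_cons Euclid_dvdM // IHr dvdn_prime2.
apply/hasP/exists_inP => -[i]; rewrite ?mem_enum => Ai e; exists i => //.
by rewrite mem_enum.
Qed.

Lemma prod_primes_squarefree (I : finType) (A : {set I}) (rho : I -> nat) s :
    (forall i, prime (rho i)) -> injective rho -> prime s ->
  ~~ (s ^ 2 %| (\prod_(i in A) rho i)%N).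
Proof.
move=> pr_rho inj_rho pr_s; apply/negP => dv2.
have : s %| (\prod_(i in A) rho i)%N by apply: dvdn_trans dv2; rewrite dvdn_exp.
rewrite prod_primes_dvd // => /exists_inP[i Ai /eqP es]; move: dv2.
rewrite (big_setD1 i) //= es expnS expn1 dvdn_pmul2l ?prime_gt0 //.
rewrite prod_primes_dvd // => /exists_inP[j]; rewrite !inE => /andP[nji _].
by rewrite (inj_eq inj_rho) eq_sym (negPf nji).
Qed.

Section Levels.
Variables (I : finType) (e : rel I) (rho : I -> nat) (O D : {set I}).
Hypothesis tri : forall x y z, ~~ [&& e x y, e y z & e x z].
Hypotheses (pr_rho : forall i, prime (rho i)) (inj_rho : injective rho).
Hypothesis disOD : [disjoint O & D].
Variables (gT : finGroupType) (W K : {group gT}).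
Hypothesis defG : W ><| K = [set: gT].
Hypotheses (cycW : cyclic W) (cycK : cyclic K).
Hypotheses (cardW : #|W| = (\prod_(d in D) rho d)%N) (cardK : #|K| = (\prod_(o in O) rho o)%N).
Hypothesis OD_order : forall o d, o \in O -> d \in D ->
  has_order [set: gT] (rho o * rho d)%N = ~~ e o d.

Let dvW d : d \in D -> rho d %| #|W|.
Proof. by move=> Dd; rewrite cardW prod_primes_dvd //; apply/exists_inP; exists d. Qed.

Let dvK o : o \in O -> rho o %| #|K|.
Proof. by move=> Oo; rewrite cardK prod_primes_dvd //; apply/exists_inP; exists o. Qed.

Let coWK : coprime #|W| #|K|.
Proof.
apply: coprime_primeP => [|s pr_s]; first exact: cardG_gt0.
rewrite cardW cardK !prod_primes_dvd // => /exists_inP[d Dd /eqP->].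
apply/exists_inP => -[o Oo /eqP/inj_rho edo]; move: Dd.
by rewrite edo (disjointFr disOD Oo).
Qed.

(** One commuting pair suffices: in a cyclic group, elements of the same order are powers of each
    other. *)
Let commOD o d x y : o \in O -> d \in D -> ~~ e o d -> x \in K -> y \in W ->
  #[x] = rho o -> #[y] = rho d -> commute x y.
Proof.
move=> Oo Dd neod Kx Wy ox oy.
have := OD_order Oo Dd; rewrite neod.
case/(sdprod_has_orderP defG (cyclic_abelian cycW) coWK (pr_rho d) (pr_rho o) (dvW Dd) (dvK Oo)).
move=> x' [y' [Kx' Wy' ox' oy' c']].
have cyc_gen (H : {group gT}) u v : cyclic H -> u \in H -> v \in H -> #[u] = #[v] -> exists k, u = v ^+ k.
  move=> cycH Hu Hv ouv; have : <[u]> :==: <[v]>.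
    by rewrite (eq_subG_cyclic cycH) ?cycle_subG // -!orderE ouv.
  by move/eqP=> euv; apply/cycleP; rewrite -euv cycle_id.
have [k ->] := cyc_gen K x x' cycK Kx Kx' (etrans ox (Logic.eq_sym ox')).
have [l ->] := cyc_gen W y y' cycW Wy Wy' (etrans oy (Logic.eq_sym oy')).
exact/commuteX/commute_sym/commuteX/commute_sym.
Qed.

Variable j : I.
Let piD : nat_pred := [pred q | [exists d in D, (q == rho d) && e d j]].
Let piO : nat_pred := [pred q | [exists o in O, (q == rho o) && e o j]].

(* The quotient lev_L / lev_N is cyclic since e is triangle-free: the neighbours of j in O and D
   are pairwise non-adjacent. *)
Definition lev_N := 'O_piD^'(W).
Definition lev_L := W <*> 'O_piO(K).

Lemma lev_piD d : d \in D -> (rho d \in piD) = e d j.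
Proof.
move=> Dd; apply/exists_inP/idP => [[d' _ /andP[/eqP/inj_rho->]]//|edj].
by exists d; rewrite ?eqxx.
Qed.

Lemma lev_piO o : o \in O -> (rho o \in piO) = e o j.
Proof.
move=> Oo; apply/exists_inP/idP => [[o' _ /andP[/eqP/inj_rho->]]//|eoj].
by exists o; rewrite ?eqxx.
Qed.

Lemma lev_nsN : lev_N <| [set: gT].
Proof. by rewrite gFnormal_trans //; case/sdprod_context: defG. Qed.

Lemma lev_nsL : lev_L <| [set: gT].
Proof.
have [nsWG sKG defWK nWK tiWK] := sdprod_context defG.
rewrite /normal subsetT /= -defWK mul_subG //.
  by rewrite (subset_trans (joing_subl _ 'O_piO(K))) ?normG.
by rewrite normsY // gFnorm.
Qed.

Lemma lev_sNL : lev_N \subset lev_L.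
Proof. by rewrite (subset_trans (pcore_sub _ _)) ?joing_subl. Qed.

(** All orders being squarefree, commutation is checked on elements of prime order only; their
    primes come from vertices joined to j, which are not joined to each other. *)
Lemma lev_cent : 'O_piO(K) \subset 'C('O_piD(W)).
Proof.
have sqK r : prime r -> ~~ (r ^ 2 %| #|'O_piO(K)|).
  move=> pr_r; apply: contra (prod_primes_squarefree O pr_rho inj_rho pr_r).
  by rewrite -cardK => /dvdn_trans->; rewrite // cardSg ?pcore_sub.
have sqW r : prime r -> ~~ (r ^ 2 %| #|'O_piD(W)|).
  move=> pr_r; apply: contra (prod_primes_squarefree D pr_rho inj_rho pr_r).
  by rewrite -cardW => /dvdn_trans->; rewrite // cardSg ?pcore_sub.
rewrite -(squarefree_subgroup (subsetIl 'O_piO(K)%G 'C('O_piD(W))%G) _ sqK) ?subsetIr //.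
move=> r pr_r dvr; have [x Qx ox] := Cauchy pr_r dvr.
suff cx : x \in 'C_('O_piO(K))('O_piD(W)) by rewrite -ox order_dvdG.
rewrite inE Qx /= -sub_cent1.
have /exists_inP[o Oo /andP[/eqP er eoj]] : r \in piO.
  exact: (pgroupP (pcore_pgroup piO K)) dvr.
rewrite -(squarefree_subgroup (subsetIl 'O_piD(W)%G 'C[x]%G) _ sqW) ?subsetIr //.
move=> s pr_s dvs; have [y Dy oy] := Cauchy pr_s dvs.
have /exists_inP[d Dd /andP[/eqP es edj]] : s \in piD.
  exact: (pgroupP (pcore_pgroup piD W)) dvs.
have neod : ~~ e o d by apply: contra (tri o d j) => ->; rewrite edj.
suff cy : y \in 'C_('O_piD(W))[x] by rewrite -oy order_dvdG.
rewrite inE Dy; apply/cent1P/commute_sym; apply: (commOD Oo Dd neod); rewrite -?er -?es //.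
  exact: subsetP (pcore_sub _ _) x Qx.
exact: subsetP (pcore_sub _ _) y Dy.
Qed.

Lemma lev_cyclic : cyclic (lev_L / lev_N).
Proof.
have nilW := abelian_nil (cyclic_abelian cycW).
have /dprodP[_ defW _ _] := nilpotent_pcoreC piD nilW.
have [_ _ _ nWK _] := sdprod_context defG.
have sQK : 'O_piO(K) \subset K by apply: pcore_sub.
have defL : lev_L = lev_N * ('O_piD(W) <*> 'O_piO(K)).
  rewrite /lev_L norm_joinEr ?(subset_trans sQK) // cent_joinEr ?lev_cent //.
  rewrite mulgA /lev_N -[in LHS]defW; congr (_ * _).
  by apply: normC; rewrite (subset_trans (pcore_sub _ _)) // (subset_trans _ (gFnorm _ W)).
rewrite defL quotientMidl quotient_cyclic //= cent_joinEr ?lev_cent //.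
apply: cyclicM; rewrite ?(cyclicS (pcore_sub _ _)) ?lev_cent //.
exact: coprimegS sQK (coprimeSg (pcore_sub _ _) coWK).
Qed.

Lemma lev_dvd : #|lev_L / lev_N| %| ((\prod_(o in O) rho o) * (\prod_(d in D) rho d))%N.
Proof.
apply: dvdn_trans (dvdn_quotient _ _) _; rewrite -cardK -cardW mulnC.
by rewrite (sdprod_card defG) cardSg ?subsetT.
Qed.

Lemma lev_D d : d \in D ->
  [exists k : gT, (#[k] == rho d) && ((k \in lev_N) || (k \notin lev_L))] = ~~ e d j.
Proof.
move=> Dd; have hallW : Hall [set: gT] W by rewrite -(coprime_sdprod_Hall_l defG).
have inW k : #[k] = rho d -> k \in W.
  move=> ok; rewrite (mem_normal_Hall (Hall_pi hallW)) ?inE //; last by case/sdprod_context: defG.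
  by rewrite /p_elt ok pnatE // inE /= mem_primes pr_rho cardG_gt0 dvW.
apply/existsP/idP => [[k /andP[/eqP ok]]|nedj].
  rewrite [k \in lev_L](subsetP (joing_subl _ _)) ?inW // orbF => Nk.
  have := mem_p_elt (pcore_pgroup piD^' W) Nk.
  by rewrite /p_elt ok pnatE // inE /= lev_piD.
have [k Wk ok] := Cauchy (pr_rho d) (dvW Dd); exists k; rewrite ok eqxx /=.
apply/orP; left; rewrite -cycle_subG pcore_max //.
  by rewrite /pgroup -orderE ok pnatE // inE /= lev_piD.
by rewrite -sub_abelian_normal ?cyclic_abelian // cycle_subG.
Qed.

(** If o is joined to j, the index of [lev_L] is prime to [rho o], so elements of that order lie in
    [lev_L], but not in [lev_N], which is inside W. Otherwise an element of that order in K avoids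
    [lev_L]. *)
Lemma lev_O o : o \in O ->
  [exists k : gT, (#[k] == rho o) && ((k \in lev_N) || (k \notin lev_L))] = ~~ e o j.
Proof.
move=> Oo; have [nsWG sKG defWK nWK tiWK] := sdprod_context defG.
have nsL := lev_nsL; have nWo : ~~ (rho o %| #|W|).
  rewrite cardW prod_primes_dvd //; apply/exists_inP => -[d Dd /eqP/inj_rho eod].
  by move: Dd; rewrite -eod (disjointFr disOD Oo).
have hallQ := nilpotent_pcore_Hall piO (abelian_nil (cyclic_abelian cycK)).
have sQK := pcore_sub piO K.
have defL : lev_L = W * 'O_piO(K) by rewrite /lev_L norm_joinEr ?(subset_trans sQK).
apply/existsP/idP => [[k /andP[/eqP ok]]|neoj].
  case/orP=> [Nk|nLk].
    case/negP: nWo; rewrite -ok order_dvdG //; exact: subsetP (pcore_sub _ _) k Nk.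
  apply: contra nLk => eoj.
  have Nk : k \in 'N(lev_L) by rewrite (subsetP (normal_norm nsL)) ?inE.
  apply: coset_idr => //; apply/eqP; rewrite -order_eq1; apply: contraT => n1.
  have o_k : #[coset lev_L k] = rho o.
    by apply/(prime_nt_dvdP (pr_rho o) n1); rewrite -ok; apply: morph_order.
  have : rho o %| #|[set: gT] / lev_L|.
    by rewrite -o_k order_dvdG // mem_quotient ?inE.
  rewrite card_quotient ?normal_norm // -divgS ?subsetT // -(sdprod_card defG).
  have cardL : #|lev_L| = (#|W| * #|'O_piO(K)|)%N.
    by rewrite defL TI_cardMg //; apply/trivgP; rewrite -tiWK setIS.
  rewrite -[X in (_ %/ X)%N]/#|lev_L| cardL.
  rewrite divnMl ?cardG_gt0 // divgS // => dvo.
  case/and3P: hallQ => _ _ /(pnat_dvd dvo).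
  by rewrite pnatE // inE /= lev_piO // eoj.
have [k Kk ok] := Cauchy (pr_rho o) (dvK Oo); exists k; rewrite ok eqxx /=.
apply/orP; right; apply: contra neoj; rewrite defL => /mulsgP[w q Ww Qq ek].
have Kq := subsetP sQK q Qq; have : w \in W :&: K.
  by rewrite inE Ww -(groupMr w Kq) -ek.
rewrite tiWK => /set1P w1; rewrite w1 mul1g in ek; rewrite -lev_piO // -ok.
have := mem_p_elt (pcore_pgroup piO K) Qq; by rewrite -ek /p_elt ok pnatE.
Qed.

End Levels.

(** Three families of primes are chosen with increasing lower bounds, which makes them disjoint, and
    each vertex picks from the family of its colour. *)
Lemma layered_primes (I : finType) (c : I -> 'I_3) B : exists rho : I -> nat,
  let n k := (\prod_(i | c i == k :> nat) rho i)%N in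
  [/\ injective rho, forall i, prime (rho i) /\ B < rho i,
      forall i, c i = 1%N :> nat -> n 0%N %| (rho i).-1
    & forall i, c i = 2%N :> nat -> (n 0%N * n 1%N)%N %| (rho i).-1].
Proof.
have prodn (rho : I -> nat) (P : pred I) : (forall i, prime (rho i)) -> 0 < (\prod_(i | P i) rho i)%N.
  by move=> pr; apply: prodn_gt0 => i; rewrite prime_gt0.
have bound (rho : I -> nat) b i : rho i <= b + (\sum_i rho i)%N.
  by rewrite (bigD1 i) //= addnCA leq_addr.
have [r0 [inj0 r0P]] := primes_family I B (ltn0Sn 0).
have pr0 i : prime (r0 i) by case: (r0P i).
have [r1 [inj1 r1P]] := primes_family I (B + \sum_i r0 i)%N (prodn r0 (fun i => c i == 0%N :> nat) pr0).
have pr1 i : prime (r1 i) by case: (r1P i).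
pose n0 := (\prod_(i | c i == 0%N :> nat) r0 i)%N.
pose n1 := (\prod_(i | c i == 1%N :> nat) r1 i)%N.
have n01 : 0 < (n0 * n1)%N by rewrite muln_gt0 !prodn.
have [r2 [inj2 r2P]] := primes_family I (B + \sum_i r0 i + \sum_i r1 i)%N n01.
pose rho i := if c i == 0%N :> nat then r0 i else if c i == 1%N :> nat then r1 i else r2 i.
have rho0 i : c i = 0%N :> nat -> rho i = r0 i by rewrite /rho => ->.
have rho1 i : c i = 1%N :> nat -> rho i = r1 i by rewrite /rho => ->.
have rho2 i : c i = 2%N :> nat -> rho i = r2 i by rewrite /rho => ->.
have cP i : [\/ c i = 0%N :> nat, c i = 1%N :> nat | c i = 2%N :> nat].
  by case: (c i) => -[|[|[|k]]] lt /=; [exact: Or31|exact: Or32|exact: Or33|].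
have lt01 i j : r0 i < r1 j by apply: leq_ltn_trans (bound r0 B i) _; case: (r1P j).
have lt02 i j : r0 i < r2 j.
  by case: (r2P j) => _ b _; apply: leq_ltn_trans b; rewrite (leq_trans (bound r0 B i)) ?leq_addr.
have lt12 i j : r1 i < r2 j by case: (r2P j) => _ b _; apply: leq_ltn_trans b; apply: bound.
have prod0 : (\prod_(i | c i == 0%N :> nat) rho i)%N = n0 by apply: eq_bigr => i /eqP/rho0.
have prod1 : (\prod_(i | c i == 1%N :> nat) rho i)%N = n1 by apply: eq_bigr => i /eqP/rho1.
exists rho; rewrite /= prod0 prod1; split.
- move=> i j; case: (cP i) => ci; case: (cP j) => cj;
    rewrite ?(rho0 _ ci) ?(rho1 _ ci) ?(rho2 _ ci) ?(rho0 _ cj) ?(rho1 _ cj) ?(rho2 _ cj) => eij.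
  + exact: inj0.
  + by have := lt01 i j; rewrite eij ltnn.
  + by have := lt02 i j; rewrite eij ltnn.
  + by have := lt01 j i; rewrite eij ltnn.
  + exact: inj1.
  + by have := lt12 i j; rewrite eij ltnn.
  + by have := lt02 j i; rewrite eij ltnn.
  + by have := lt12 j i; rewrite eij ltnn.
  exact: inj2.
- move=> i; case: (cP i) => ci; rewrite ?(rho0 _ ci) ?(rho1 _ ci) ?(rho2 _ ci).
  + by case: (r0P i).
  + by case: (r1P i) => ? b _; split=> //; apply: leq_ltn_trans (leq_addr _ _) b.
  by case: (r2P i) => ? b _; split=> //; apply: leq_ltn_trans b; rewrite -addnA leq_addr.
- by move=> i ci; rewrite rho1 //; case: (r1P i).
by move=> i ci; rewrite rho2 //; case: (r2P i).
Qed.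

Lemma solvable_realization (I : finType) (e : rel I) (c : I -> 'I_3) B :
    symmetric e -> (forall x y, e x y -> c x != c y) ->
    (forall x y z, ~~ [&& e x y, e y z & e x z]) ->
  exists (gT : finGroupType) (G : {group gT}) (rho : I -> nat),
    [/\ solvable G, injective rho, forall i, prime (rho i) /\ B < rho i,
        forall s, prime s -> (s %| #|G|) = [exists i, s == rho i]
      & forall i j, i != j -> has_order G (rho i * rho j)%N = ~~ e i j].
Proof.
move=> esym col tri; have [rho [inj_rho rhoP dv1 dv2]] := layered_primes c B.
have pr_rho i : prime (rho i) by case: (rhoP i).
pose O := [set i | c i == 0%N :> nat]; pose D := [set i | c i == 1%N :> nat].
have prodO : (\prod_(i | c i == 0%N :> nat) rho i)%N = (\prod_(i in O) rho i)%N.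
  by apply: eq_bigl => i; rewrite inE.
have prodD : (\prod_(i | c i == 1%N :> nat) rho i)%N = (\prod_(i in D) rho i)%N.
  by apply: eq_bigl => i; rewrite inE.
rewrite !prodO !prodD in dv1 dv2.
have disOD : [disjoint O & D].
  by apply/pred0P=> i /=; rewrite !inE; case: (c i) => [[|]].
have [|kT [W1 [K1 [def1 [cycW1 cycK1] cardW1 cardK1 ord1]]]] := metacyclic_graph e pr_rho inj_rho disOD.
  by move=> d; rewrite inE => /eqP/dv1.
have abW1 := cyclic_abelian cycW1; have abK1 := cyclic_abelian cycK1.
have card1 : #|[set: kT]| = ((\prod_(i in O) rho i) * (\prod_(i in D) rho i))%N.
  by rewrite -(sdprod_card def1) cardW1 cardK1 mulnC.
have dvd1 s : prime s -> (s %| #|[set: kT]|) = [exists i, (c i != 2%N :> nat) && (s == rho i)].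
  move=> pr_s; rewrite card1 Euclid_dvdM // !prod_primes_dvd //.
  apply/orP/existsP => [[]/exists_inP[i]|[i /andP[ci2 es]]].
  - by rewrite inE => /eqP ci es; exists i; rewrite ci.
  - by rewrite inE => /eqP ci es; exists i; rewrite ci.
  have [ci|ci] : c i = 0%N :> nat \/ c i = 1%N :> nat.
    by move: ci2; case: (c i) => -[|[|[|k]]] lt //= _; [left | right].
  - by left; apply/exists_inP; exists i; rewrite ?inE ?ci.
  by right; apply/exists_inP; exists i; rewrite ?inE ?ci.
pose J := {i : I | c i == 2%N :> nat}; pose p (j : J) := rho (val j).
pose L (j : J) : {group kT} := [group of lev_L e rho O W1 K1 (val j)].
pose N (j : J) : {group kT} := [group of lev_N e rho D W1 (val j)].
have p_kT j : ~~ (p j %| #|[set: kT]|).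
  rewrite dvd1 ?pr_rho //; apply/existsP => -[i /andP[ci /eqP/inj_rho ej]].
  by rewrite -ej (eqP (valP j)) in ci.
have inj_p : injective p by move=> j j' /inj_rho/val_inj.
have [||gT [G [W2 [K2 [def2 abW2 isoK2 dvW2 ord2]]]]] := induced_sdprod (L := L) (N := N) _ inj_p p_kT.
- by move=> j; apply: pr_rho.
- move=> j; split.
  + exact: (lev_nsL _ _ _ def1).
  + exact: (lev_nsN _ _ _ def1).
  + exact: lev_sNL.
  + exact: (lev_cyclic tri pr_rho inj_rho disOD def1 cycW1 cycK1 cardW1 cardK1 ord1).
  exact: dvdn_trans (lev_dvd _ def1 cardW1 cardK1 _) (dv2 _ (eqP (valP j))).
have co2 s : prime s -> s %| #|[set: kT]| -> ~~ (s %| #|W2|).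
  by move=> pr_s dvs; rewrite dvW2 //; apply/existsP => -[j /eqP es]; move: (p_kT j); rewrite -es dvs.
have dvOD i : c i != 2%N :> nat -> rho i %| #|[set: kT]|.
  by move=> ci; rewrite dvd1 //; apply/existsP; exists i; rewrite ci eqxx.
exists gT, G, rho; split=> //.
- have [nsW2 _ _ _ _] := sdprod_context def2.
  rewrite (series_sol nsW2) (abelian_sol abW2) /= -(isog_sol (sdprod_isog def2)) (isog_sol isoK2).
  have [nsW1 _ _ _ _] := sdprod_context def1.
  by rewrite (series_sol nsW1) (abelian_sol abW1) /= -(isog_sol (sdprod_isog def1)) abelian_sol.
- move=> s pr_s; rewrite -(sdprod_card def2) (card_isog isoK2) Euclid_dvdM // dvW2 // dvd1 //.
  apply/orP/existsP => [[/existsP[j es]|/existsP[i /andP[_ es]]]|[i es]].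
  + by exists (val j).
  + by exists i.
  have [ci|ci] := eqVneq (c i : nat) 2%N; last by right; apply/existsP; exists i; rewrite ci.
  by left; apply/existsP; exists (exist _ i (introT eqP ci)).
move=> i j; wlog le_ij : i j / c i <= c j.
  move=> IH nij; have [le|lt] := leqP (c i) (c j); first exact: IH.
  by rewrite mulnC esym IH 1?eq_sym // ltnW.
move=> nij; have nrho : rho i != rho j by rewrite (inj_eq inj_rho).
(* Vertices of one colour are not joined by e, and both their primes divide the order of one abelian
   layer. *)
have [cij|ncij] := eqVneq (c i) (c j).
  have -> : e i j = false by apply: contraTF (eqxx (c i)) => /col; rewrite cij eqxx.
  apply/idP; have [cj|cj] := eqVneq (c j : nat) 2%N.
    have ci : c i = 2%N :> nat by rewrite cij.
    have [nsW2 _ _ _ _] := sdprod_context def2; apply: has_orderS (normal_sub nsW2) _.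
    apply: abelian_has_order; rewrite ?dvW2 //; apply/existsP.
      by exists (exist _ i (introT eqP ci)).
    by exists (exist _ j (introT eqP cj)).
  have [_ sK2 _ _ _] := sdprod_context def2; apply: has_orderS sK2 _.
  rewrite (has_order_isog _ isoK2).
  have [cj1|cj1] : c j = 0%N :> nat \/ c j = 1%N :> nat.
    by move: cj; case: (c j) => -[|[|[|k]]] lt //= _; [left | right].
    have [_ sK1 _ _ _] := sdprod_context def1; apply: has_orderS sK1 _.
    apply: abelian_has_order; rewrite // cardK1 prod_primes_dvd //; apply/exists_inP.
      by exists i; rewrite ?inE ?cij ?cj1.
    by exists j; rewrite ?inE ?cj1.
  have [nsW1 _ _ _ _] := sdprod_context def1; apply: has_orderS (normal_sub nsW1) _.
  apply: abelian_has_order; rewrite // cardW1 prod_primes_dvd //; apply/exists_inP.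
    by exists i; rewrite ?inE ?cij ?cj1.
  by exists j; rewrite ?inE ?cj1.
have {le_ij ncij} lt_ij : c i < c j by rewrite ltn_neqAle le_ij andbT.
have [cj|cj] := eqVneq (c j : nat) 2%N.
  pose j' : J := exist _ j (introT eqP cj).
  have dvi : rho i %| #|[set: kT]| by apply: dvOD; apply: contraTneq lt_ij => ->; rewrite cj.
  rewrite (ord2 j' _ (pr_rho i) dvi).
  have [ci|ci] : c i = 0%N :> nat \/ c i = 1%N :> nat.
    by move: lt_ij; rewrite cj; case: (c i) => -[|[|k]] lt //= _; [left | right].
    by apply: (lev_O e pr_rho inj_rho disOD def1 cycK1 cardW1 cardK1); rewrite inE ci.
  by apply: (lev_D e pr_rho inj_rho disOD def1 cycW1 cardW1 cardK1); rewrite inE ci.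
have [ci {}cj] : c i = 0%N :> nat /\ c j = 1%N :> nat.
  by move: lt_ij cj; case: (c j) => -[|[|[|k]]] lt //=; case: (c i) => -[|k] lt'.
rewrite (sdprod_has_order def2).
  by rewrite (has_order_isog _ isoK2) ord1 // inE ?ci ?cj.
by rewrite coprimeMl !prime_coprime // !co2 ?dvOD ?ci ?cj.
Qed.

(** * Extensions of PSL(2,8) by solvable groups *)

Lemma factors_pseudo (gT : finGroupType) (G : {group gT}) :
  PSL28_factors G -> pseudo_PSL28_solvable G.
Proof.
move=> pG S [s /compsP[_ ps] Ss].
have [A [B [-> snA maxB]]] : exists A B : {group gT}, [/\ S = mkSec A B, A <|<| G & maxnormal B A A].
  suff ind (A : {group gT}) : A <|<| G -> path [rel x y : {group gT} | maxnormal y x x] A s ->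
      S \in pairmap (@mkSec gT) A s ->
      exists A B : {group gT}, [/\ S = mkSec A B, A <|<| G & maxnormal B A A].
    exact: ind (subnormal_refl G) ps Ss.
  elim: s A {ps Ss} => //= H s IHs A snA /andP[maxH ps].
  rewrite in_cons => /orP[/eqP->|]; first by exists A, H.
  apply: IHs ps; apply: subnormal_trans snA.
  exact/normal_subnormal/maxnormal_normal.
exact: pG.
Qed.

Lemma solvable_simple_abelian (gT : finGroupType) (G : {group gT}) :
  solvable G -> simple G -> abelian G.
Proof. by move=> solG simG; apply/cyclic_abelian/prime_cyclic/simple_sol_prime. Qed.

Lemma solvable_factors (gT : finGroupType) (G : {group gT}) : solvable G -> PSL28_factors G.
Proof.
move=> solG A B snA maxB; left; apply: solvable_simple_abelian.
  exact/quotient_sol/(solvableS (subnormal_sub snA)).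
by rewrite quotient_simple // maxnormal_normal.
Qed.

(** A subnormal A meets the simple T in 1, and then embeds into G / T, or contains T. In the second
    case a maximal normal B either contains T, so that A / B is a solvable quotient, or meets T
    trivially, and then A = B T and A / B is T. *)
Lemma extension_factors (gT : finGroupType) (G T : {group gT}) :
  T <| G -> T \isog PSL 2 F8 -> solvable (G / T) -> PSL28_factors G.
Proof.
move=> nsTG isoT solGT A B snA maxB; have [_ simT _ _] := PSL28P isoT.
have [ntT nsT] := simpleP _ simT; have nTG := normal_norm nsTG.
have sAG := subnormal_sub snA; have nTA := subset_trans sAG nTG.
have [AT1|sTA] : A :&: T = 1 \/ T \subset A.
  have := setI_subnormal (normal_sub nsTG) snA.
  case/subnormalEr=> [/setIidPr|[K [snK nsKT prK]]]; first by right.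
  left; case: (nsT K nsKT) => eK; last by rewrite eK properxx in prK.
  by apply/trivgP; rewrite -eK (subnormal_sub snK).
  have isoA : A \isog A / T by apply: quotient_isog; rewrite // setIC.
  apply: solvable_factors (subnormal_refl A) maxB.
  by rewrite (isog_sol isoA) (solvableS _ solGT) ?quotientS.
have nsBA := maxnormal_normal maxB; have [sBA nBA] := andP nsBA.
have nsTA : T <| A := normalS sTA sAG nsTG.
have nsBT : B :&: T <| T by rewrite /normal subsetIr normsI ?normG // (subset_trans sTA).
case: (nsT _ nsBT) => [BT1|/setIidPr sTB].
  have nsBYT : B <*> T <| A by rewrite normalY.
  have defA : B <*> T = A.
    apply/eqP; apply: contraNT ntT => neA; have /maxgroupP[_ max] := maxB.
    have eB : B <*> T = B.
      apply: max; last exact: joing_subl.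
      by rewrite properEneq neA (normal_sub nsBYT) (normal_norm nsBYT).
    by rewrite -subG1 -BT1 subsetI subxx -eB joing_subr.
  right; rewrite -{1}defA quotientYidl ?(subset_trans sTA) //.
  apply: isog_trans isoT; rewrite isog_sym.
  by apply: quotient_isog; rewrite // (subset_trans sTA).
left; apply: solvable_simple_abelian; last by rewrite quotient_simple.
rewrite -(isog_sol (third_isog sTB nsTA nsBA)) quotient_sol //.
by rewrite (solvableS _ solGT) ?quotientS.
Qed.

Lemma PSL28_product (hT : finGroupType) (H : {group hT}) : solvable H ->
    (forall s, prime s -> s %| #|H| -> 7 < s) ->
  exists (gT : finGroupType) (G : {group gT}),
    [/\ pseudo_PSL28_solvable G,
        forall s, prime s -> (s %| #|G|) = (s \in [:: 2; 3; 7]) || (s %| #|H|),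
        forall r s, r \in [:: 2; 3; 7] -> s \in [:: 2; 3; 7] -> r != s -> ~~ has_order G (r * s),
        forall r s, r \in [:: 2; 3; 7] -> prime s -> s %| #|H| -> has_order G (r * s)
      & forall r s, prime r -> prime s -> r %| #|H| -> s %| #|H| -> has_order G (r * s) = has_order H (r * s)].
Proof.
move=> solH H7; pose T := PSL 2 F8.
have [cardT _ noT _] := PSL28P (isog_refl T).
have defG := setX_dprod T H.
have isoT : setX_group T [1 hT]%G \isog T by rewrite isog_sym; apply: isog_setX1.
have isoH : setX_group [1 coset_of 'Z(SL 2 F8)]%G H \isog H by rewrite isog_sym; apply: isog_set1X.
have cardT1 := card_isog isoT; have cardH1 := card_isog isoH; rewrite cardT in cardT1.
have prT s : prime s -> (s %| 504) = (s \in [:: 2; 3; 7]).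
  by move=> pr_s; have := mem_primes s 504; rewrite pr_s (_ : primes 504 = [:: 2; 3; 7]).
have pr237 r : r \in [:: 2; 3; 7] -> prime r /\ r <= 7.
  by rewrite !inE => /or3P[] /eqP->.
have np r : prime r -> r %| #|H| -> r \notin [:: 2; 3; 7].
  by move=> pr_r /(H7 r pr_r); apply: contraL => /pr237[_]; rewrite -leqNgt.
exists _, (setX_group T H); split.
- apply/factors_pseudo/(@extension_factors _ _ (setX_group T 1%G)).
  + by case/dprod_normal2: defG.
  + exact: isoT.
  by rewrite -(isog_sol (sdprod_isog (dprodWsd defG))) (isog_sol isoH).
- by move=> s pr_s; rewrite -(dprod_card defG) cardT1 cardH1 Euclid_dvdM // prT.
- move=> r s r237 s237 nrs; rewrite (sdprod_has_order (dprodWsdC defG)).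
    rewrite (has_order_isog _ isoT); apply: noT.
    move: r237 s237 nrs; rewrite !inE => /or3P[] /eqP-> /or3P[] /eqP-> //.
  rewrite cardH1 coprimeMl; apply/andP.
  have coH q : q \in [:: 2; 3; 7] -> coprime q #|H|.
    move=> q237; have [pr_q _] := pr237 q q237; rewrite prime_coprime //.
    by apply: contraL q237; apply: np.
  by split; apply: coH.
- move=> r s r237 pr_s dvs; have [pr_r _] := pr237 r r237.
  have nrs : r != s by apply: contraTneq r237 => ->; apply: np.
  have /(Cauchy pr_r)[x Tx ox] : r %| #|setX_group T [1 hT]%G| by rewrite cardT1 prT.
  have /(Cauchy pr_s)[y Hy oy] : s %| #|setX_group [1 coset_of 'Z(SL 2 F8)]%G H| by rewrite cardH1.
  have [_ defTH cTH _] := dprodP defG.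
  apply: (@has_order_mul _ _ r s x y) => //.
  + by rewrite -defTH (subsetP (mulG_subl _ _)).
  + by rewrite -defTH (subsetP (mulG_subr _ _)).
  exact/commute_sym/(centsP cTH).
move=> r s pr_r pr_s dvr dvs; rewrite (sdprod_has_order (dprodWsd defG)) ?(has_order_isog _ isoH) //.
rewrite cardT1 coprimeMl !prime_coprime // !prT //.
by rewrite !np.
Qed.

(** * From primes and element orders back to graphs *)

Lemma prime_graph_iso (Gamma : sgraph) (gT : finGroupType) (G : {group gT}) (sigma : Gamma -> nat) :
    injective sigma -> (forall x, prime (sigma x)) ->
    (forall s, prime s -> (s %| #|G|) = [exists x, s == sigma x]) ->
    (forall x y, x != y -> has_order G (sigma x * sigma y) = adj x y) ->
  graph_iso Gamma (prime_graph G).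
Proof.
move=> inj_s pr_s dvG ord.
have mem_s x : sigma x \in primes #|G|.
  by rewrite mem_primes pr_s cardG_gt0 dvG //; apply/existsP; exists x.
pose f (x : Gamma) : prime_graph G := SeqSub (mem_s x).
have inj_f : injective f by move=> x y /(congr1 val)/inj_s.
have surj (p : prime_graph G) : exists x, f x == p.
  have := valP p; rewrite mem_primes => /and3P[pr_p _]; rewrite dvG // => /existsP[x /eqP e].
  by exists x; apply/eqP/val_inj.
exists f; last first.
  move=> x y; rewrite -[LHS]/((f x != f y) && has_order G (sigma x * sigma y)) (inj_eq inj_f).
  by have [->|/ord->//] := eqVneq x y; rewrite adj_irr.
exists (fun p => xchoose (surj p)) => [x|p]; last exact/eqP/(xchooseP (surj p)).
by apply: inj_f; apply/eqP/(xchooseP (surj (f x))).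
Qed.

Lemma triangle3 (X : sgraph) (x y z : X) : adj x y -> adj y z -> adj x z -> triangle [set x; y; z].
Proof.
move=> xy yz xz; have neq (u v : X) : adj u v -> u != v.
  by apply: contraTneq => ->; rewrite adj_irr.
rewrite /triangle; apply/andP; split.
  by rewrite -setUA cardsU1 cards2 !inE !negb_or !neq.
apply/forall_inP=> u; rewrite !inE -orbA => u3; apply/forall_inP=> v; rewrite !inE -orbA => v3.
by apply/implyP; case/or3P: u3 => /eqP->; case/or3P: v3 => /eqP->; rewrite ?eqxx // adj_sym.
Qed.

Lemma realization (Gamma : sgraph) :
    colorable 3 (complement Gamma) ->
    (forall A B : {set complement Gamma}, triangle A -> triangle B -> A = B) ->
    (forall A : {set complement Gamma}, triangle A -> isolated A) ->
  exists (gT : finGroupType) (G : {group gT}),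
    pseudo_PSL28_solvable G /\ graph_iso Gamma (prime_graph G).
Proof.
case=> c col uniqT isoT; pose X := complement Gamma.
have adjX (x y : Gamma) : x != y -> adj x y = ~~ adj (x : X) (y : X).
  by move=> nxy; rewrite -[adj (_ : X) _]/((x != y) && ~~ adj x y) nxy negbK.
have [A tA|noT] := pickP (@triangle X); last first.
  have tri (x y z : X) : ~~ [&& adj x y, adj y z & adj x z].
    by apply/and3P=> -[xy yz xz]; have := noT [set x; y; z]; rewrite triangle3.
  have [gT [G [rho [solG inj_rho rhoP dvG ord]]]] := solvable_realization 0 (@adj_sym X) col tri.
  exists gT, G; split; first exact/factors_pseudo/solvable_factors.
  apply: (@prime_graph_iso Gamma _ G rho) => // [x|x y nxy]; first by case: (rhoP x).
  by rewrite ord // adjX // negbK.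
(* A is the only triangle, so none survives outside it and [solvable_realization] applies there; the
   bound 7 keeps its primes apart from those of PSL(2,8). *)
pose I := {x : X | x \notin A}; pose e : rel I := fun x y => adj (val x) (val y).
have tri (x y z : I) : ~~ [&& e x y, e y z & e x z].
  apply/and3P=> -[xy yz xz]; have := uniqT _ _ tA (triangle3 xy yz xz).
  move=> eA; have : val x \in [set val x; val y; val z] by rewrite !inE eqxx.
  by rewrite -eA => Ax; have := valP x; rewrite Ax.
have [||hT [H [rho [solH inj_rho rhoP dvH ordH]]]] := @solvable_realization I e (fun x => c (val x)) 7 _ _ tri.
- by move=> x y; apply: adj_sym.
- by move=> x y; apply: col.
have [|gT [G [pG dvG ord1 ord2 ord3]]] := PSL28_product solH.
  by move=> s pr_s; rewrite dvH // => /existsP[i /eqP->]; case: (rhoP i).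
exists gT, G; split=> //.
have A3 : size (enum A) = 3 by rewrite -cardE; case/andP: tA => /eqP.
(* The vertices of A receive 2, 3, 7 in the order of enumeration; any matching would do, as these
   primes are pairwise non-adjacent. *)
pose sA (x : X) := nth 0 [:: 2; 3; 7] (index x (enum A)).
pose sigma (x : Gamma) := if insub x is Some i then rho i else sA x.
have sigmaA (x : X) : x \in A -> sigma x = sA x by move=> Ax; rewrite /sigma insubN ?negbK.
have sigmaI (i : I) : sigma (val i) = rho i by rewrite /sigma valK.
have sA237 x : x \in A -> sA x \in [:: 2; 3; 7].
  by move=> Ax; rewrite mem_nth // -[size _]A3 index_mem mem_enum.
have sA_inj x y : x \in A -> y \in A -> sA x = sA y -> x = y.
  have lt3 u : u \in A -> index u (enum A) < 3 by move=> Au; rewrite -A3 index_mem mem_enum.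
  move=> Ax Ay /eqP; rewrite nth_uniq ?lt3 // => /eqP.
  by move/(congr1 (nth x (enum A))); rewrite !nth_index ?mem_enum.
have cases (x : Gamma) : (x : X) \in A \/ exists i : I, x = val i.
  by case: (boolP ((x : X) \in A)) => [|nA]; [left | right; exists (exist _ x nA)].
have pr237 r : r \in [:: 2; 3; 7] -> prime r /\ r <= 7.
  by rewrite !inE => /or3P[] /eqP->.
have dv_rho i : rho i %| #|H| by case: (rhoP i) => pr _; rewrite dvH //; apply/existsP; exists i.
have sym_ord r s : has_order G (r * s)%N = has_order G (s * r)%N by rewrite mulnC.
apply: (@prime_graph_iso _ _ _ sigma).
- move=> x y; case: (cases x) => [Ax|[i ->]]; case: (cases y) => [Ay|[j ->]];
    rewrite ?sigmaI ?sigmaA // => exy.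
  + exact: sA_inj.
  + have [_] := pr237 _ (sA237 x Ax); rewrite exy leqNgt.
    by case: (rhoP j) => _ ->.
  + have [_] := pr237 _ (sA237 y Ay); rewrite -exy leqNgt.
    by case: (rhoP i) => _ ->.
  by rewrite (inj_rho _ _ exy).
- move=> x; case: (cases x) => [Ax|[i ->]]; rewrite ?sigmaI ?sigmaA //.
    by case: (pr237 _ (sA237 x Ax)).
  by case: (rhoP i).
- move=> s pr_s; rewrite dvG // dvH //; apply/orP/existsP => [[s237|/existsP[i /eqP->]]|[x /eqP->]].
  + have lt_i : index s [:: 2; 3; 7] < size (enum A) by rewrite A3 index_mem.
    have [x0 _] : exists x0, x0 \in A by apply/card_gt0P; rewrite cardE A3.
    pose x := nth x0 (enum A) (index s [:: 2; 3; 7]).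
    have Ax : x \in A by rewrite -mem_enum mem_nth.
    exists x; rewrite sigmaA // /sA index_uniq ?enum_uniq //.
    by rewrite nth_index.
  + by exists (val i); rewrite sigmaI.
  case: (cases x) => [Ax|[i ->]]; rewrite ?sigmaI ?sigmaA //.
    by left; apply: sA237.
  by right; apply/existsP; exists i.
move=> x y nxy; rewrite adjX //.
have adjA u v : u \in A -> v \in A -> u != v -> adj u v.
  by move=> Au Av nuv; case/andP: tA => _ /forall_inP/(_ u Au)/forall_inP/(_ v Av)/implyP->.
case: (cases x) nxy => [Ax|[i ->]]; case: (cases y) => [Ay|[j ->]] nxy; rewrite ?sigmaI ?sigmaA //.
- rewrite adjA //; apply/negbTE/ord1; rewrite ?sA237 //.
  by apply: contraNneq nxy => /sA_inj->.
- rewrite (negPf (isoT _ tA _ _ Ax (valP j))); case: (rhoP j) => pr_j _.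
  by apply: ord2; rewrite ?sA237.
- rewrite adj_sym (negPf (isoT _ tA _ _ Ay (valP i))) sym_ord; case: (rhoP i) => pr_i _.
  by apply: ord2; rewrite ?sA237.
case: (rhoP i) (rhoP j) => pr_i _ [pr_j _].
by rewrite ord3 // ordH // (inj_eq val_inj).
Qed.

Theorem theorem5p9 (Gamma : sgraph) :
  (exists (gT : finGroupType) (G : {group gT}),
     pseudo_PSL28_solvable G /\ graph_iso Gamma (prime_graph G))
  <->
  [/\ colorable 3 (complement Gamma),
      (forall A B : {set complement Gamma}, triangle A -> triangle B -> A = B)
    & (forall A : {set complement Gamma}, triangle A -> isolated A)].
Proof.
split=> [[gT [G [pG isoG]]]|[col uniqT isoT]]; first exact: pseudo_graph_conditions pG isoG.
exact: realization.
Qed.
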